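(* For any $k=\delta n=n/\mathrm{poly}(\log n)$, there exists an explicit construction of a strong $(k,\epsilon)$-extractor $\mathsf{Ext}:\{0,1\}^n\times\{0,1\}^d\to\{0,1\}^m$, where $\epsilon$ can be as small as $2^{-k^{\Omega(1)}}$, with $d=\Theta\!\left(\log n+\frac{\log^2(1/\epsilon)}{\log n}\right)$, $m=\Theta(\delta\, n^{1/10800}\log(1/\epsilon))=k^{\Theta(1)}$, and locality $\log^2(1/\epsilon)\cdot\mathrm{poly}(\log n)$.
   Context: An $(n,k)$-source is a distribution on $\{0,1\}^n$ with min-entropy at least $k$. $\mathsf{Ext}$ is a strong $(k,\epsilon)$-extractor if for every $(n,k)$-source $X$ and independent uniform seed $U\in\{0,1\}^d$, $U\circ\mathsf{Ext}(X,U)$ is $\epsilon$-close in statistical distance to uniform on $\{0,1\}^{d+m}$. The locality is $\ell$ if for every fixed seed $r$, each output bit of $x\mapsto\mathsf{Ext}(x,r)$ depends on at most $\ell$ bits of $x$. ''$\epsilon$ can be as small as $2^{-k^{\Omega(1)}}$'' means: there is a constant $\alpha\in(0,1)$ such that the statement holds for every $\epsilon\ge 2^{-k^{\alpha}}$. Explicit means polynomial-time computable. Asymptotics are as $n\to\infty$.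
   Formalization: The error ε is assumed bounded away from 1 (ε ≤ ε₀ < 1 for large n); for ε = 1, or ε tending to 1 very fast, log(1/ε) vanishes and m = Θ(δ n^{1/10800} log(1/ε)) = k^{Θ(1)} is impossible. *)

(* Defs.v *)
From HB Require Import structures.
From mathcomp Require Import all_boot all_order all_algebra.
From mathcomp Require Import all_classical all_reals all_analysis.

Set Implicit Arguments.
Unset Strict Implicit.
Unset Printing Implicit Defensive.

Import Order.TTheory GRing.Theory Num.Theory.
Import numFieldNormedType.Exports.

Local Open Scope ring_scope.

Definition log2 {R : realType} (x : R) : R := ln x / ln 2.

(* Finite probability distributions, given by their mass functions. *)

Definition is_dist {R : realType} {T : finType} (P : {ffun T -> R}) : Prop :=
  (forall x, 0 <= P x) /\ \sum_x P x = 1.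

Definition unif (R : realType) (T : finType) : {ffun T -> R} :=
  [ffun=> #|T|%:R^-1].

(* The law of a pair of independent variables. *)
Definition dprod {R : realType} {S T : finType} (P : {ffun S -> R})
  (Q : {ffun T -> R}) : {ffun S * T -> R} := [ffun z => P z.1 * Q z.2].

(* The law of [f X] when [X] has law [P]. *)
Definition dmap {R : realType} {S T : finType} (f : S -> T)
  (P : {ffun S -> R}) : {ffun T -> R} := [ffun y => \sum_(x | f x == y) P x].

Definition stat_dist {R : realType} {T : finType} (P Q : {ffun T -> R}) : R :=
  2^-1 * \sum_x `|P x - Q x|.

Definition min_entropy {R : realType} {T : finType} (P : {ffun T -> R}) : R :=
  - log2 (\big[Num.max/0]_x P x).

Definition is_source {R : realType} (n : nat) (k : R)
  (X : {ffun n.-tuple bool -> R}) : Prop :=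
  is_dist X /\ k <= min_entropy X.

(* The tested variable is [U o Ext(X, U)], a string of length [d + m]. *)
Definition strong_extractor {R : realType} (n d m : nat) (k eps : R)
  (Ext : n.-tuple bool -> d.-tuple bool -> m.-tuple bool) : Prop :=
  forall X : {ffun n.-tuple bool -> R}, is_source k X ->
    stat_dist
      (dmap (fun z => cat_tuple z.2 (Ext z.1 z.2))
         (dprod X (unif R (d.-tuple bool))))
      (unif R ((d + m).-tuple bool)) <= eps.

Definition depends_only_on (n : nat) (f : n.-tuple bool -> bool)
  (S : {set 'I_n}) : Prop :=
  forall x y : n.-tuple bool,
    (forall i, i \in S -> tnth x i = tnth y i) -> f x = f y.

Definition has_locality (n d m : nat)
  (Ext : n.-tuple bool -> d.-tuple bool -> m.-tuple bool) (l : nat) : Prop :=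
  forall (r : d.-tuple bool) (j : 'I_m),
    exists2 S : {set 'I_n}, (#|S| <= l)%N &
      depends_only_on (fun x => tnth (Ext x r) j) S.

(* Deterministic multitape Turing machines with two-way infinite tapes.       *)

Inductive move := Left | Stay | Right.

(* [None] is the blank; [inl b] is the bit [b]; [inr a] is a work symbol.     *)
Definition symbol (A : finType) : finType := option (bool + A)%type.

(* The left part is listed from the head outwards; the cells beyond the two   *)
(* lists are blank.                                                           *)
Record tape (A : finType) := Tape {
  tleft : seq (symbol A);
  thead : symbol A;
  tright : seq (symbol A)
}.

Definition write_move (A : finType) (a : symbol A) (mv : move) (t : tape A) :
    tape A :=
  match mv with
  | Stay => Tape (tleft t) a (tright t)
  | Left => Tape (behead (tleft t)) (head None (tleft t)) (a :: tright t)
  | Right => Tape (a :: tleft t) (head None (tright t)) (behead (tright t))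
  end.

Record machine := Machine {
  ntapes : nat; (* there are [ntapes.+1] tapes *)
  work : finType;
  state : finType;
  start : state;
  halted : pred state;
  trans : state -> {ffun 'I_ntapes.+1 -> symbol work} ->
          state * {ffun 'I_ntapes.+1 -> symbol work * move}
}.

Definition config (M : machine) : Type :=
  state M * ('I_(ntapes M).+1 -> tape (work M)).

Definition step (M : machine) (c : config M) : config M :=
  if halted c.1 then c else
  let r := trans c.1 [ffun i => thead (c.2 i)] in
  (r.1, fun i => write_move (r.2 i).1 (r.2 i).2 (c.2 i)).

Definition word_tape (A : finType) (w : seq bool) : tape A :=
  let s := [seq Some (inl b) | b <- w] in
  Tape [::] (head None s) (behead s).

(* The [i]-th input word is on the [i]-th tape, with the head on its first    *)
(* letter; the other tapes are blank.                                         *)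
Definition init (M : machine) (ws : seq (seq bool)) : config M :=
  (start M, fun i : 'I_(ntapes M).+1 => word_tape (work M) (nth [::] ws i)).

Fixpoint leading_bits (A : finType) (s : seq (symbol A)) : seq bool :=
  if s is Some (inl b) :: s' then b :: leading_bits s' else [::].

(* The output is the block of bits starting at the head of the first tape.    *)
Definition output (M : machine) (c : config M) : seq bool :=
  leading_bits (thead (c.2 ord0) :: tright (c.2 ord0)).

Definition computes_within (M : machine) (t : nat) (ws : seq (seq bool))
    (w : seq bool) : Prop :=
  let c := iter t (@step M) (init M ws) in halted c.1 /\ output c = w.

(* Polynomial-time computability of a family of functions whose [n]-th member *)
(* depends on integer parameters [k n] and [e n]. No computability is assumed *)
(* of the parameters, so they are part of the input, in unary, together with  *)
(* [x] and [u]; [n] is the length of [x].                                     *)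
Definition explicit (k e d m : nat -> nat)
  (Ext : forall n, n.-tuple bool -> (d n).-tuple bool -> (m n).-tuple bool) :
    Prop :=
  exists (M : machine) (c : nat),
  forall n (x : n.-tuple bool) (u : (d n).-tuple bool),
    computes_within M (c * (k n + e n + n + d n) ^ c + c)%N
      [:: nseq (k n) true; nseq (e n) true; tval x; tval u]
      (tval (Ext n x u)).

(* Main.v *)
(* The extractor is Trevisan's: the i-th output bit is the bit of a code word  *)
(* of x at the position that the i-th set of a weak design reads off the seed; *)
(* by the hybrid argument a distinguisher yields few predictors, each of which *)
(* correlates with the code words of few x. The design is found greedily, and  *)
(* the locality comes from the code.                                           *)
(*   A code bit is the parity of w bits, one for each vertex of a random walk  *)
(* on {0,1}^N, where N is the length of n in binary and the steps of the walk  *)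
(* are the vectors s_a(b) with coordinates <a^(i+1), b>, for a in GF(2^(2h)).  *)
(* At a vertex v one reads x at the 2^h positions v + s_a(b), and hashes these *)
(* bits b_j to the sum of the b_j <c^j, g>. The set of positions where two     *)
(* strings differ is, if it is not too small, hit by almost all these cosets,  *)
(* because s has small bias; so the bias of the sum of the two code words      *)
(* decays exponentially in w. The strings too close to a given one form a      *)
(* Hamming ball, which is too small to support min-entropy k. It suffices that *)
(* 2^h is polynomial in log n and w h is about log n + log(1/eps), and then    *)
(* each output bit reads w 2^h bits of x.                                      *)
(*   Polynomial time is proved in the style of Cobham: a class of functions is *)
(* shown to be closed under composition and bounded recursion, by means of     *)
(* programs on bit-string registers, and these programs are compiled to Turing *)
(* machines.                                                                   *)

Require Import Defs.
From HB Require Import structures.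
From mathcomp Require Import all_boot all_order all_algebra.
From mathcomp Require Import all_classical all_reals all_analysis.
From mathcomp Require Import finfield cyclic zify ring lra.

Set Implicit Arguments.
Unset Strict Implicit.
Unset Printing Implicit Defensive.

(** Write N for the bit length of n, e for log(1/eps) rounded up, m for the output length, and h =
    3^j for a power of 3 such that 2^h is polynomial in N but at least (2N)^A.

    The field with 4^h elements is concrete because 2 is a primitive root modulo 3^(j+1)
    ([pow3_dvd_exp2_pred]): words of 2h bits are told apart by their values at a primitive
    3^(j+1)-th root of unity ([felt_inj]). Counting roots in this field gives both the small bias of
    the steps ([shift_vec_bias]) and the quality of the hash at a vertex ([pair_bias_hit]).

    The correlation of two code words is an iterated operator on functions on {0,1}^N
    ([code_pair_walk]): one step weights by the bias at the vertex and averages over a coset. On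
    functions of mean zero the coset average contracts ([coset_avg_contracts]). On constants the
    weight does, since for distant x, x' most cosets meet the positions where they differ
    ([coset_miss]). A step thus costs about 2^(-h/2), and some 13(N + e)/h steps bring the
    correlation below (eps/m)^2/2 ([code_bias], [bias_small]).

    If a test accepts the output on x with probability eps/2 above that of a uniform string, one of
    m 2^d 2^m 2^W predictors has correlation eps/m with the code word of x ([card_distinguished]),
    where W bounds the overlaps of the greedy design ([weak_design]). The x found by one predictor
    lie in few Hamming balls of radius w0 ([card_list]), because almost orthogonal vectors with a
    common large projection are few. With X = n^(1/10) one has m <= 2X^2, d <= 64X^4, W <= 4X^5 and
    k >= X^9, so that this crude count is affordable; w0 = k/(4N) makes a ball cost only 2^(k/4).
    Hence the bad x carry little probability ([strong_extractor_of_list], [strong_at]).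

    The design has words of length t of order N + e over an alphabet of size Q of order t/N, which
    gives d = tQ of order (N + e)^2/N. For a fixed seed the walk is fixed, hence so are the
    positions read ([extractor_locality]). Explicitness rests on bounded recursion ([PT_rec]) and
    the compilation to machines ([exec_step], [PT_machine]). *)

Local Open Scope nat_scope.

(** * Register programs and Turing machines *)

Definition regs := nat -> seq bool.

Definition upd (st : regs) (r : nat) (s : seq bool) : regs :=
  fun j => if j == r then s else st j.

Inductive cmd :=
| Skip
| Push of nat & bool
| Pop of nat
| Seq of cmd & cmd
| Case of nat & cmd & cmd & cmd
| While of nat & cmd.

(* The times are exactly those of the Turing machine code below. *)
Inductive exec : cmd -> regs -> nat -> regs -> Prop :=
| ESkip st : exec Skip st 0 st
| EPush r b st : exec (Push r b) st 2 (upd st r (b :: st r))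
| EPop r st : exec (Pop r) st 1 (upd st r (behead (st r)))
| ESeq c1 c2 st t1 st1 t2 st2 :
    exec c1 st t1 st1 -> exec c2 st1 t2 st2 -> exec (Seq c1 c2) st (t1 + t2) st2
| ECase r ce cf ct st t st' :
    exec (match st r with [::] => ce | false :: _ => cf | true :: _ => ct end)
      st t st' -> exec (Case r ce cf ct) st t.+2 st'
| EWhileE r c st : st r = [::] -> exec (While r c) st 1 st
| EWhile r c st t st1 t' st2 : st r <> [::] ->
    exec c st t st1 -> exec (While r c) st1 t' st2 ->
    exec (While r c) st (t + t').+2 st2.

Fixpoint max_reg (c : cmd) : nat :=
  match c with
  | Skip => 0
  | Push r _ => r
  | Pop r => r
  | Seq c1 c2 => maxn (max_reg c1) (max_reg c2)
  | Case r ce cf ct => maxn r (maxn (max_reg ce) (maxn (max_reg cf) (max_reg ct)))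
  | While r c => maxn r (max_reg c)
  end.

(* An instruction acts on one tape: it reads the symbol under the head, then  *)
(* writes, moves and jumps.                                                   *)
Definition instr : Type := nat * (option bool -> option bool * move * nat).

Definition jump (q : nat) : instr := (0, fun a => (a, Stay, q)).

Fixpoint code_size (c : cmd) : nat :=
  match c with
  | Skip => 0
  | Push _ _ => 2
  | Pop _ => 1
  | Seq c1 c2 => code_size c1 + code_size c2
  | Case _ ce cf ct => (code_size ce + code_size cf + code_size ct).+4
  | While _ c => (code_size c).+2
  end.

Fixpoint code (p : nat) (c : cmd) : seq instr :=
  match c with
  | Skip => [::]
  | Push r b => [:: (r, fun a => (a, Left, p.+1));
                    (r, fun _ => (Some b, Stay, p.+2))]
  | Pop r => [:: (r, fun _ => (None, Right, p.+1))]
  | Seq c1 c2 => code p c1 ++ code (p + code_size c1) c2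
  | Case r ce cf ct =>
      let pe := p.+1 in
      let pf := (pe + code_size ce).+1 in
      let pt := (pf + code_size cf).+1 in
      let q := (pt + code_size ct).+1 in
      [:: (r, fun a => (a, Stay,
             match a with
             | None => pe | Some false => pf | Some true => pt end))] ++
      (code pe ce ++ [:: jump q]) ++ (code pf cf ++ [:: jump q]) ++
      (code pt ct ++ [:: jump q])
  | While r c =>
      [:: (r, fun a => (a, Stay, if a is Some _ then p.+1
                                 else p + (code_size c).+2))] ++
      code p.+1 c ++ [:: jump p]
  end.

Lemma size_code p c : size (code p c) = code_size c.
Proof.
elim: c p => //= [c1 IH1 c2 IH2|r ce IHe cf IHf ct IHt|r c IH] p.
- by rewrite size_cat IH1 IH2.
- by rewrite !size_cat /= IHe IHf IHt; lia.
- by rewrite size_cat /= IH; lia.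
Qed.

Definition bit_of_symbol (a : symbol void) : option bool :=
  if a is Some (inl b) then Some b else None.

Definition symbol_of_bit (a : option bool) : symbol void := omap inl a.

Section Machine.

Variables (K : nat) (prog : seq instr).

Definition prog_machine : machine := {|
  ntapes := K;
  work := void;
  state := 'I_(size prog).+1;
  start := ord0;
  halted := fun q : 'I_(size prog).+1 => q == size prog :> nat;
  trans := fun (q : 'I_(size prog).+1) hs =>
    let i := nth (jump 0) prog q in
    let w := i.2 (bit_of_symbol (hs (inord i.1))) in
    (inord w.2,
     [ffun j => if j == inord i.1 then (symbol_of_bit w.1.1, w.1.2)
                else (hs j, Stay)])
|}.

(** A register is a stack with its top under the head. Cells to the left are unconstrained, since a
    push overwrites the cell it moves to. *)
Definition tape_rep (t : tape void) (s : seq bool) : Prop :=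
  exists j, Defs.thead t :: tright t = [seq Some (inl b) | b <- s] ++ nseq j None.

Definition config_rep (c : config prog_machine) (p : nat) (st : regs) : Prop :=
  c.1 = p :> nat /\ forall i : 'I_K.+1, tape_rep (c.2 i) (st i).

Lemma tape_rep_head t s : tape_rep t s -> bit_of_symbol (Defs.thead t) = ohead s.
Proof. by case=> j; case: s => [|b s] /=; [case: j => [|j]|] => // -[->]. Qed.

Lemma step_rep (c : config prog_machine) p st r f :
  config_rep c p st -> p < size prog -> nth (jump 0) prog p = (r, f) -> r <= K ->
  let w := f (ohead (st r)) in
  w.2 <= size prog ->
  (step c).1 = w.2 :> nat /\
  forall i : 'I_K.+1, (step c).2 i =
    if i == r :> nat then write_move (symbol_of_bit w.1.1) w.1.2 (c.2 i)
    else c.2 i.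
Proof.
case: c => q tp [/= cp ct] pP np rK wP.
have hd : bit_of_symbol (Defs.thead (tp (inord r))) = ohead (st r).
  by have := ct (inord r); rewrite inordK // => /tape_rep_head.
rewrite /step /= cp ifN; last by rewrite neq_ltn pP.
rewrite np /= !ffunE hd; split; first by rewrite inordK.
move=> i; rewrite !ffunE -val_eqE /= inordK //.
by case: eqP => // _; case: (tp i).
Qed.

(** A move to the left promises nothing: it exposes an unconstrained cell, which the second
    instruction of a push overwrites. *)
Lemma tape_rep_write a mv t s :
  tape_rep t s ->
  match mv with
  | Stay => a = symbol_of_bit (ohead s) \/ s = [::]
  | _ => True
  end ->
  match mv with
  | Stay => tape_rep (write_move a mv t) (if a is Some (inl b) then b :: behead s else s)
  | Right => tape_rep (write_move a mv t) (behead s)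
  | Left => True
  end.
Proof.
case=> j; case: t => l h r /=; case: mv => //=.
- case: s => [|b s] /= E.
  + move=> _; case: j E => // j [_ ->]; case: a => [[b|[]]|]; first by exists j.
    by exists j.+1.
  + case: E => _ -> [->|//]; by exists j.
- move=> E _; case: s E => [|b s] /=.
  + by case: j => // j [_ ->]; case: j => [|j]; [exists 1|exists j.+1].
  + case=> _ ->; case: s => [|b' s] /=; last by exists j.
    by case: j => [|j]; [exists 1|exists j.+1].
Qed.

Lemma iter_stepD t1 t2 (c : config prog_machine) :
  iter (t1 + t2) (@step _) c = iter t2 (@step _) (iter t1 (@step _) c).
Proof. by rewrite addnC iterD. Qed.

(** Simulation, by induction on the execution. Surrounding code [pre] and [post] is allowed because
    jump targets are absolute. *)
Lemma exec_step c st t st' : exec c st t st' -> max_reg c <= K ->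
  forall p pre post (cf : config prog_machine),
    prog = pre ++ code p c ++ post -> size pre = p -> config_rep cf p st ->
    config_rep (iter t (@step _) cf) (p + code_size c) st'.
Proof.
have stayP (cf : config prog_machine) p sr r g :
    config_rep cf p sr -> p < size prog ->
    nth (jump 0) prog p = (r, fun a => (a, Stay, g a)) -> r <= K ->
    g (ohead (sr r)) <= size prog ->
    config_rep (step cf) (g (ohead (sr r))) sr.
  move=> cr pP np rK gP; have [/= s1 s2] := step_rep cr pP np rK gP.
  split=> // i; rewrite s2; have := cr.2 i; case: eqP => // -> tr.
  have := @tape_rep_write (symbol_of_bit (ohead (sr r))) Stay _ _ tr.
  by case: (sr r) {s1 s2 gP} tr => [|b s] tr; apply; auto.
have fits pre p' c' post : prog = pre ++ code p' c' ++ post ->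
    size pre + code_size c' <= size prog.
  by move=> ->; rewrite !size_cat size_code; lia.
elim=> {c st t st'}.
- by move=> st _ p pre post cf _ _ /=; rewrite addn0.
- move=> r b st /= rK p pre post cf E sp cr.
  have pP : p.+2 <= size prog by have /= := fits pre p (Push r b) post E; rewrite sp; lia.
  have n0 : nth (jump 0) prog p = (r, fun a => (a, Left, p.+1)).
    by rewrite E nth_cat sp ltnn subnn.
  have n1 : nth (jump 0) prog p.+1 = (r, fun _ => (Some b, Stay, p.+2)).
    by rewrite E nth_cat sp ltnNge leqnSn /= subSnn.
  have [/= s1 s2] := step_rep cr (ltnW pP) n0 rK (ltnW pP).
  set st1 := step cf in s1 s2 *.
  rewrite /config_rep addn2 /step /= s1 ifN; last by rewrite neq_ltn pP.
  rewrite /= n1 /=; split; first by rewrite inordK.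
  move=> i; rewrite !ffunE -val_eqE /= inordK // s2 /upd; have := cr.2 i.
  case: eqP => [->|_]; last by case: (cf.2 i).
  case: (cf.2 i) => l h rr [j E']; exists j.
  move: E' => /=; case: (st r) => [|b0 s0] /=; last by case=> _ ->.
  by case: j => // j [_ ->].
- move=> r st /= rK p pre post cf E sp cr.
  have pP : p.+1 <= size prog by have /= := fits pre p (Pop r) post E; rewrite sp; lia.
  have n0 : nth (jump 0) prog p = (r, fun _ => (None, Right, p.+1)).
    by rewrite E nth_cat sp ltnn subnn.
  have [/= s1 s2] := step_rep cr pP n0 rK pP.
  split; first by rewrite addn1.
  move=> i; rewrite s2 /upd; have := cr.2 i; case: eqP => // -> tr.
  exact: (@tape_rep_write None Right _ _ tr).
- move=> c1 c2 st t1 st1 t2 st2 _ IH1 _ IH2 /=; rewrite geq_max => /andP[k1 k2].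
  move=> p pre post cf E sp cr; rewrite iter_stepD addnA.
  apply: (IH2 k2 _ (pre ++ code p c1) post).
  + by rewrite E -!catA.
  + by rewrite size_cat size_code sp.
  + by apply: (IH1 k1 p pre (code (p + code_size c1) c2 ++ post)); rewrite // E -catA.
- move=> r ce cf0 ct st t st' _ IH /=; rewrite !geq_max => /and4P[rK ke kf kt].
  move=> p pre post cf E sp cr; rewrite -iterS iterSr.
  set q := (_ + _).+4; move: E.
  set pe := p.+1; set pf := (pe + _).+1; set pt := (pf + _).+1 => E.
  have Eq : p + q = (pt + code_size ct).+1 by rewrite /q /pt /pf /pe; lia.
  rewrite Eq; move: E; set q' := (pt + _).+1 => E.
  have pP : q' <= size prog.
    by rewrite E !size_cat /= !size_cat /= !size_code sp /q' /pt /pf /pe; lia.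
  have n0 := stayP cf p st r _ cr _ _ rK.
  have {n0} cr1 : config_rep (step cf)
      (match ohead (st r) with None => pe | Some false => pf | Some true => pt end) st.
    apply: (stayP cf p st r (fun a => match a with
             | None => pe | Some false => pf | Some true => pt end)) => //.
    + by apply: leq_trans pP; rewrite /q' /pt /pf /pe; lia.
    + by rewrite E nth_cat sp ltnn subnn.
    + by case: (ohead _) => [[]|]; apply: leq_trans pP; rewrite /q' /pt /pf /pe; lia.
  have jmpP c0 p0 pre0 post0 : prog = pre0 ++ (code p0 c0 ++ [:: jump q']) ++ post0 ->
      size pre0 = p0 ->
      config_rep (iter t (@step prog_machine) (step cf)) (p0 + code_size c0) st' ->
      config_rep (iter t.+1 (@step prog_machine) (step cf)) q' st'.
    move=> E0 sp0 cr0; rewrite iterS.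
    apply: (stayP _ (p0 + code_size c0) st' 0 (fun=> q')) => //.
    + by rewrite E0 !size_cat /= size_code sp0; lia.
    + by rewrite E0 -!catA nth_cat sp0 ltnNge leq_addr /= addKn nth_cat size_code
         ltnn subnn.
  move: IH cr1; case sr: (st r) => [|[] s] /= IH cr1.
  + have E1 : prog = (pre ++ [:: (r, fun a : option bool => (a, Stay, match a with
             | None => pe | Some false => pf | Some true => pt end))]) ++
       (code pe ce ++ [:: jump q']) ++ ((code pf cf0 ++ [:: jump q']) ++
       (code pt ct ++ [:: jump q']) ++ post).
      by rewrite E -!catA.
    have sz : size (pre ++ [:: (r, fun a : option bool => (a, Stay, match a with
             | None => pe | Some false => pf | Some true => pt end))]) = pe.
      by rewrite size_cat sp addn1.
    apply: (jmpP _ _ _ _ E1 sz).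
    by apply: (IH ke pe _ _ _ _ sz cr1); rewrite {1}E1 -!catA.
  + set ins := (r, _) in E.
    have E1 : prog = (pre ++ ins :: (code pe ce ++ [:: jump q']) ++
       (code pf cf0 ++ [:: jump q'])) ++
       (code pt ct ++ [:: jump q']) ++ post.
      by rewrite E -?catA /= -?catA /= -?catA.
    have sz : size (pre ++ ins :: (code pe ce ++ [:: jump q']) ++
       (code pf cf0 ++ [:: jump q'])) = pt.
      by rewrite size_cat sp /= !size_cat !size_code /pt /pf /pe /=; lia.
    apply: (jmpP _ _ _ _ E1 sz).
    by apply: (IH kt pt _ _ _ _ sz cr1); rewrite {1}E1 -!catA.
  + set ins := (r, _) in E.
    have E1 : prog = (pre ++ ins :: (code pe ce ++ [:: jump q'])) ++
       (code pf cf0 ++ [:: jump q']) ++ ((code pt ct ++ [:: jump q']) ++ post).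
      by rewrite E -?catA /= -?catA /= -?catA.
    have sz : size (pre ++ ins :: (code pe ce ++ [:: jump q'])) = pf.
      by rewrite size_cat sp /= !size_cat !size_code /pf /pe /=; lia.
    apply: (jmpP _ _ _ _ E1 sz).
    by apply: (IH kf pf _ _ _ _ sz cr1); rewrite {1}E1 -!catA.
- move=> r c st sr /=; rewrite geq_max => /andP[rK _] p pre post cf E sp cr.
  have pP : p + (code_size c).+2 <= size prog by have /= := fits pre p (While r c) post E; rewrite sp.
  have := stayP cf p st r (fun a : option bool => if a is Some _ then p.+1
                                 else p + (code_size c).+2) cr.
  rewrite sr /=; apply => //; first by lia.
  by rewrite E nth_cat sp ltnn subnn.
- move=> r c st t st1 t' st2 sr _ IH1 _ IH2 /= kk.
  move: (kk); rewrite geq_max => /andP[rK kc] p pre post cf E sp cr.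
  have pP : p + (code_size c).+2 <= size prog by have /= := fits pre p (While r c) post E; rewrite sp.
  rewrite -[X in config_rep X]/(iter (t + t').+2 (@step prog_machine) cf).
  rewrite -addnS iterSr iter_stepD iterSr.
  apply: (IH2 kk _ pre post _ E sp).
  have cr1 : config_rep (step cf) p.+1 st.
    have := stayP cf p st r (fun a : option bool => if a is Some _ then p.+1
                                 else p + (code_size c).+2) cr.
    have [b ->] : exists b, ohead (st r) = Some b by case: (st r) sr => // b; exists b.
    apply => //; [by lia| |by lia].
    by rewrite E nth_cat sp ltnn subnn.
  set ins := (r, _) in E.
  have E1 : prog = (pre ++ [:: ins]) ++ code p.+1 c ++ ([:: jump p] ++ post).
    by rewrite E -?catA /= -?catA /= -?catA.
  have sz : size (pre ++ [:: ins]) = p.+1 by rewrite size_cat sp addn1.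
  have cr2 := IH1 kc _ _ _ _ E1 sz cr1.
  apply: (stayP _ (p.+1 + code_size c) st1 0 (fun=> p)) => //; try lia.
  by rewrite E1 nth_cat sz ltnNge leq_addr /= addKn nth_cat size_code ltnn subnn.
Qed.

End Machine.

(** * Polynomial bounds *)

Lemma leq_expr m n e : m <= n -> m ^ e <= n ^ e.
Proof. by case: e => // e; rewrite leq_exp2r. Qed.

(** The base is at least 2, so that constants and sums are absorbed by a larger exponent. *)
Definition pbound (A : Type) (mu T : A -> nat) : Prop :=
  exists c, forall a, T a <= (mu a + 2) ^ c.

Section PolyBound.

Variables (A : Type) (mu : A -> nat).

Lemma leq_pbound (T T' : A -> nat) :
  (forall a, T a <= T' a) -> pbound mu T' -> pbound mu T.
Proof. by move=> le [c cP]; exists c => a; apply: leq_trans (le a) (cP a). Qed.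

Lemma pbound_id : pbound mu mu.
Proof. by exists 1 => a; rewrite expn1 leq_addr. Qed.

Lemma pbound_const n : pbound mu (fun=> n).
Proof.
exists n => a; apply: leq_trans (ltnW (ltn_expl n (ltnSn 1))) _.
by apply: leq_expr; lia.
Qed.

Lemma pboundM T T' : pbound mu T -> pbound mu T' -> pbound mu (fun a => T a * T' a).
Proof. by move=> [c cP] [c' cP']; exists (c + c') => a; rewrite expnD leq_mul. Qed.

Lemma pboundD T T' : pbound mu T -> pbound mu T' -> pbound mu (fun a => T a + T' a).
Proof.
move=> [c cP] [c' cP']; exists (c + c').+1 => a.
have p2 : 2 <= mu a + 2 by lia.
have h1 : (mu a + 2) ^ c <= (mu a + 2) ^ (c + c') by rewrite leq_exp2l // leq_addr.
have h2 : (mu a + 2) ^ c' <= (mu a + 2) ^ (c + c') by rewrite leq_exp2l // leq_addl.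
rewrite expnS; apply: leq_trans (leq_mul p2 (leqnn _)).
by rewrite mul2n -addnn leq_add // (leq_trans (cP _), leq_trans (cP' _)).
Qed.

Lemma pboundX T n : pbound mu T -> pbound mu (fun a => T a ^ n).
Proof. by move=> [c cP]; exists (c * n) => a; rewrite expnM leq_expr. Qed.

Lemma pbound_comp (mu' T : A -> nat) : pbound mu mu' -> pbound mu' T -> pbound mu T.
Proof.
move=> h [c cP]; apply: leq_pbound cP _; apply: pboundX; apply: pboundD => //.
exact: pbound_const.
Qed.

End PolyBound.

Lemma pbound_map (A B : Type) (f : A -> B) (mu T : B -> nat) :
  pbound mu T -> pbound (mu \o f) (T \o f).
Proof. by move=> [c cP]; exists c => a; apply: cP. Qed.

(** * Subroutines on registers *)

Definition runs (c : cmd) (st : regs) (B : nat) (st' : regs) : Prop :=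
  exists2 T, T <= B & exec c st T st'.

Lemma runs_le c st B B' st' : B <= B' -> runs c st B st' -> runs c st B' st'.
Proof. by move=> le [T TB ex]; exists T => //; apply: leq_trans le. Qed.

Lemma runs_seq c1 c2 st st1 st2 B1 B2 :
  runs c1 st B1 st1 -> runs c2 st1 B2 st2 -> runs (Seq c1 c2) st (B1 + B2) st2.
Proof.
move=> [T1 b1 e1] [T2 b2 e2]; exists (T1 + T2); first exact: leq_add.
exact: ESeq e1 e2.
Qed.

Lemma runs_while r c st st1 st2 B1 B2 : st r <> [::] ->
  runs c st B1 st1 -> runs (While r c) st1 B2 st2 ->
  runs (While r c) st (B1 + B2).+2 st2.
Proof.
move=> sr [T1 b1 e1] [T2 b2 e2]; exists (T1 + T2).+2; first by rewrite !ltnS leq_add.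
exact: EWhile e1 e2.
Qed.

Lemma runs_while0 r c st : st r = [::] -> runs (While r c) st 1 st.
Proof. by move=> sr; exists 1 => //; apply: EWhileE. Qed.

Lemma updE st r s : upd st r s r = s.
Proof. by rewrite /upd eqxx. Qed.

Lemma updN st r s j : j <> r -> upd st r s j = st j.
Proof. by move/eqP=> jr; rewrite /upd (negbTE jr). Qed.

Lemma upd_id st r s : st r = s -> upd st r s = st.
Proof. by move=> E; apply/funext => j; rewrite /upd; case: eqP => // ->. Qed.

Lemma upd_upd st r s s' : upd (upd st r s) r s' = upd st r s'.
Proof. by apply/funext => j; rewrite /upd; case: eqP. Qed.

Ltac updeq :=
  apply/funext => ?; rewrite /upd; repeat case: eqP => //; intros; subst;
  first [congruence | lia].

Definition clear r := While r (Pop r).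

Lemma runs_clear r st : runs (clear r) st (3 * size (st r) + 1) (upd st r [::]).
Proof.
move E: (st r) => s; elim: s st E => [|b s IH] st E /=.
  by rewrite upd_id //; apply: runs_while0.
have := IH (upd st r s) (updE _ _ _); rewrite upd_upd => h.
have -> : 3 * (size s).+1 + 1 = (1 + (3 * size s + 1)).+2 by lia.
apply: runs_while h; first by rewrite E.
by exists 1 => //; have := EPop r st; rewrite E.
Qed.

Definition transfer r1 (act : bool -> cmd) :=
  While r1 (Case r1 Skip (Seq (Pop r1) (act false)) (Seq (Pop r1) (act true))).

Lemma runs_transfer_step r1 act st b s B st1 st2 B2 : st r1 = b :: s ->
  runs (act b) (upd st r1 s) B st1 -> runs (transfer r1 act) st1 B2 st2 ->
  runs (transfer r1 act) st (B + 5 + B2) st2.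
Proof.
move=> E h1 h2; have -> : B + 5 + B2 = ((1 + B).+2 + B2).+2 by lia.
apply: runs_while h2; first by rewrite E.
case: h1 => T TB ex; exists (1 + T).+2; first by lia.
apply: ECase; rewrite E; have p := EPop r1 st; rewrite E /= in p.
by case: b ex {E} => ex; apply: ESeq p ex.
Qed.

Definition moverev r1 r2 := transfer r1 (Push r2).

Lemma runs_moverev r1 r2 st : r1 <> r2 ->
  runs (moverev r1 r2) st (7 * size (st r1) + 1)
    (upd (upd st r1 [::]) r2 (catrev (st r1) (st r2))).
Proof.
move=> r12; move E: (st r1) => s; elim: s st E => [|b s IH] st E /=.
  by rewrite upd_id ?updN ?upd_id //; [apply: runs_while0 | apply/nesym].
have -> : 7 * (size s).+1 + 1 = 2 + 5 + (7 * size s + 1) by lia.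
apply: (runs_transfer_step E); first by exists 2 => //; apply: EPush.
have := IH (upd (upd st r1 s) r2 (b :: upd st r1 s r2)).
rewrite updN // updE updE updN; last exact: nesym.
move/(_ erefl); congr runs; updeq.
Qed.

(** Emptying one stack onto another reverses it; the detour through [tmp] restores the order. *)
Definition move_reg r1 tmp r2 := Seq (moverev r1 tmp) (moverev tmp r2).

Lemma runs_move r1 tmp r2 st : r1 <> tmp -> tmp <> r2 -> r1 <> r2 ->
  st tmp = [::] -> st r2 = [::] ->
  runs (move_reg r1 tmp r2) st (14 * size (st r1) + 2)
    (upd (upd st r1 [::]) r2 (st r1)).
Proof.
move=> h1 h2 h3 st1 st2.
have -> : 14 * size (st r1) + 2 = (7 * size (st r1) + 1) + (7 * size (st r1) + 1) by lia.
apply: runs_seq; first exact: runs_moverev.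
have := runs_moverev (upd (upd st r1 [::]) tmp (catrev (st r1) (st tmp))) h2.
rewrite updE st1 -/(rev _) size_rev; congr runs.
rewrite updN; last exact: nesym.
rewrite updN; last exact: nesym.
rewrite st2 -/(rev _) revK; updeq.
Qed.

Definition copy_reg r1 tmp r2 :=
  Seq (moverev r1 tmp) (transfer tmp (fun b => Seq (Push r1 b) (Push r2 b))).

Lemma runs_dup r tmp r1 r2 st : tmp <> r1 -> tmp <> r2 -> r1 <> r2 ->
  r = tmp ->
  runs (transfer tmp (fun b => Seq (Push r1 b) (Push r2 b))) st
    (9 * size (st tmp) + 1)
    (upd (upd (upd st tmp [::]) r1 (catrev (st tmp) (st r1))) r2
      (catrev (st tmp) (st r2))).
Proof.
move=> h1 h2 h3 _; move E: (st tmp) => s; elim: s st E => [|b s IH] st E /=.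
  rewrite (upd_id E) upd_id // upd_id //; exact: runs_while0.
have -> : 9 * (size s).+1 + 1 = (2 + 2) + 5 + (9 * size s + 1) by lia.
apply: (runs_transfer_step E).
  apply: runs_seq; first by exists 2 => //; apply: EPush.
  by exists 2 => //; apply: EPush.
set st1 := upd (upd _ _ _) _ _.
have := IH st1; rewrite /st1 !updE.
rewrite updN // updN // updE => /(_ erefl); congr runs.
have e1 : upd st tmp s r1 = st r1 by rewrite updN //; apply: nesym.
have e2 : upd (upd st tmp s) r1 (b :: upd st tmp s r1) r2 = st r2.
  by rewrite !updN //; apply: nesym.
rewrite e2 e1 [in X in upd _ r1 (catrev s X)]updN // updE.
updeq.
Qed.

Lemma runs_copy r1 tmp r2 st : r1 <> tmp -> tmp <> r2 -> r1 <> r2 ->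
  st tmp = [::] -> st r2 = [::] ->
  runs (copy_reg r1 tmp r2) st (16 * size (st r1) + 2) (upd st r2 (st r1)).
Proof.
move=> h1 h2 h3 st1 st2.
have -> : 16 * size (st r1) + 2 = (7 * size (st r1) + 1) + (9 * size (st r1) + 1) by lia.
apply: runs_seq; first exact: runs_moverev.
have := @runs_dup tmp tmp r1 r2
  (upd (upd st r1 [::]) tmp (catrev (st r1) (st tmp))) (nesym h1) h2 h3 erefl.
rewrite updE st1 -/(rev _) size_rev; congr runs.
have e1 : upd (upd st r1 [::]) tmp (rev (st r1)) r1 = [::].
  by rewrite updN // updE.
have e2 : upd (upd st r1 [::]) tmp (rev (st r1)) r2 = [::].
  by rewrite updN ?updN //; apply: nesym.
rewrite e1 e2 -!/(rev _) revK; updeq.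
Qed.

(** * Functions computable in polynomial time *)

Definition esize (env : seq (seq bool)) : nat := sumn [seq size s | s <- env].

(* Functions computed in polynomial time by register programs: the result is  *)
(* put in the empty register [o], and the registers from [z] on, empty at the *)
(* start, are used as work space and left empty.                              *)
Definition PT (f : seq (seq bool) -> seq bool) : Prop :=
  pbound esize (fun env => size (f env)) /\
  exists2 T, pbound esize T & forall rs o z,
    all (fun r => r < z) rs -> o < z -> o \notin rs ->
    exists cm, forall st, st o = [::] -> (forall r, z <= r -> st r = [::]) ->
      runs cm st (T (map st rs)) (upd st o (f (map st rs))).

Lemma PT_ext f g : (forall env, f env = g env) -> PT f -> PT g.
Proof. by move=> /funext ->. Qed.

Lemma PT_size f : PT f -> pbound esize (fun env => size (f env)).
Proof. by case. Qed.

Lemma size_nth_esize env i : size (nth [::] env i) <= esize env.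
Proof.
elim: env i => [|s env IH] [|i] //=; rewrite /esize /=; first exact: leq_addr.
exact: leq_trans (IH i) (leq_addl _ _).
Qed.

Lemma esize_behead env : esize (behead env) <= esize env.
Proof. by case: env => // s env; apply: leq_addl. Qed.

Lemma map_upd st o s rs : o \notin rs -> map (upd st o s) rs = map st rs.
Proof.
move=> on; apply/eq_in_map => r rin; rewrite updN // => E.
by rewrite -E rin in on.
Qed.

Lemma all_lt_notin z rs : all (fun r => r < z) rs -> z \notin rs.
Proof. by move/allP => h; apply/negP => /h; rewrite ltnn. Qed.

Lemma PT_nil : PT (fun=> [::]).
Proof.
split; first exact: (pbound_const _ 0).
exists (fun=> 0); first exact: (pbound_const _ 0).
by move=> rs o z _ _ _; exists Skip => st so _; rewrite upd_id //; exists 0 => //; constructor.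
Qed.

Lemma PT_nth i : PT (fun env => nth [::] env i).
Proof.
have b : pbound esize (fun env => size (nth [::] env i)).
  exists 1 => env; rewrite expn1; apply: leq_trans (size_nth_esize _ _) _; exact: leq_addr.
split=> //; exists (fun env => 16 * size (nth [::] env i) + 2).
  by apply: pboundD; [apply: pboundM => //|]; apply: pbound_const.
move=> rs o z /allP rz oz on; have [lt|ge] := ltnP i (size rs).
  have rin := mem_nth 0 lt; have /= rz' := rz _ rin.
  exists (copy_reg (nth 0 rs i) z o) => st so sz.
  rewrite (nth_map 0) //; apply: runs_copy; rewrite ?(sz z) //; try lia.
  by move=> E; rewrite -E rin in on.
exists Skip => st so _; rewrite nth_default ?size_map // upd_id //.
by exists 0 => //; constructor.
Qed.

Lemma PT_cons b f : PT f -> PT (fun env => b :: f env).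
Proof.
move=> [sf [T bT fP]]; split.
  apply: (@leq_pbound _ _ _ (fun env => 1 + size (f env))) => //.
  by apply: pboundD => //; apply: pbound_const.
exists (fun env => T env + 2); first by apply: pboundD => //; apply: pbound_const.
move=> rs o z rz oz on; have [cm cmP] := fP rs o z rz oz on.
exists (Seq cm (Push o b)) => st so sz; apply: runs_seq; first exact: cmP.
by exists 2 => //; have := EPush o b (upd st o (f (map st rs))); rewrite updE upd_upd.
Qed.

Lemma PT_tail f : PT f -> PT (fun env => behead (f env)).
Proof.
move=> [sf [T bT fP]]; split.
  by apply: leq_pbound sf => env; rewrite size_behead; lia.
exists (fun env => T env + 1); first by apply: pboundD => //; apply: pbound_const.
move=> rs o z rz oz on; have [cm cmP] := fP rs o z rz oz on.
exists (Seq cm (Pop o)) => st so sz; apply: runs_seq; first exact: cmP.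
by exists 1 => //; have := EPop o (upd st o (f (map st rs))); rewrite updE upd_upd.
Qed.

Lemma PT_weaken f : PT f -> PT (fun env => f (behead env)).
Proof.
have wk T : pbound esize T -> pbound esize (fun env => T (behead env)).
  move=> [c cP]; exists c => env; apply: leq_trans (cP _) _.
  by apply: leq_expr; rewrite leq_add2r esize_behead.
move=> [sf [T bT fP]]; split; first exact: (wk (fun env => size (f env))).
exists (fun env => T (behead env)); first exact: wk.
move=> rs o z rz oz on; have [||cm cmP] := fP (behead rs) o z _ oz.
- by case: rs rz {on} => //= r rs /andP[].
- by case: rs on {rz} => //= r rs; rewrite inE negb_or => /andP[].
by exists cm => st so sz; rewrite behead_map; apply: cmP.
Qed.

(** Cobham's recursion on notation. *)
Fixpoint recn (g : seq (seq bool) -> seq bool)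
    (h : bool -> seq (seq bool) -> seq bool) (s : seq bool)
    (env : seq (seq bool)) : seq bool :=
  if s is b :: s' then h b (recn g h s' env :: s' :: env) else g env.

(** Loop invariant: [z] holds the value on the suffix [c] already read, [z.+1] the unread letters in
    reverse, [z.+2] the suffix itself. Registers [z.+3] and [z.+4] receive the result of a step and
    serve to move it; [K] bounds the cost of one letter. *)
Lemma runs_recn_loop (g : seq (seq bool) -> seq bool)
    (h : bool -> seq (seq bool) -> seq bool) (cmh : bool -> cmd)
    (Th : bool -> seq (seq bool) -> nat) rs z V K S :
  let env st := map (st : regs) rs in
  all (fun r => r < z) rs ->
  (forall b st, st z.+3 = [::] -> (forall r, z + 5 <= r -> st r = [::]) ->
     runs (cmh b) st (Th b (map st [:: z, z.+2 & rs]))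
       (upd st z.+3 (h b (map st [:: z, z.+2 & rs])))) ->
  forall st, (forall r, z <= r -> st r = [::]) ->
  (forall c, size c <= S -> size (recn g h c (env st)) <= V) ->
  (forall b c, size c <= S ->
     Th b [:: recn g h c (env st), c & env st] + 17 * V + 10 <= K) ->
  forall l c, size l + size c <= S ->
  runs (transfer z.+1 (fun b => Seq (cmh b) (Seq (clear z)
          (Seq (move_reg z.+3 z.+4 z) (Push z.+2 b)))))
    (upd (upd (upd st z (recn g h c (env st))) z.+1 l) z.+2 c)
    (size l * K + 1)
    (upd (upd st z (recn g h (catrev l c) (env st))) z.+2 (catrev l c)).
Proof.
move=> env rz cmhP st sz V_bound K_bound; elim=> [|b l IH] c lc.
  set s1 := upd _ _ _; have -> : upd (upd st z (recn g h (catrev [::] c) (env st))) z.+2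
      (catrev [::] c) = s1.
    rewrite /s1 /= [upd (upd _ z _) z.+1 _]upd_id //.
    by rewrite updN ?sz //; lia.
  apply: runs_while0; rewrite /s1 updN ?updE //; lia.
have lc' : size l + size (b :: c) <= S by move: lc => /=; lia.
have cS : size c <= S by lia.
have cS' : size (b :: c) <= S by lia.
have := K_bound b c cS; have := V_bound _ cS; have := V_bound _ cS'.
set a := recn g h c _; set a' := recn g h (b :: c) _ => a'V aV KP.
have st_c : st z.+1 = [::] by apply: sz; lia.
have -> : size (b :: l) * K + 1 = (K - 5) + 5 + (size l * K + 1) by rewrite /=; lia.
set s0 := upd _ z.+2 c.
have s0b : s0 z.+1 = b :: l by rewrite /s0 updN ?updE //; lia.
apply: (runs_transfer_step s0b); last exact: IH lc'.
set s1 := upd s0 _ l.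
have env1 : map s1 rs = env st.
  apply/eq_in_map => r /(allP rz) rltz.
  by rewrite /s1 /s0 !updN //; lia.
have s1z : s1 z = a by rewrite /s1 /s0 3?updN ?updE //; lia.
have s1c : s1 z.+2 = c by rewrite /s1 /s0 updN ?updE //; lia.
have e1 : map s1 [:: z, z.+2 & rs] = [:: a, c & env st] by rewrite /= s1z s1c env1.
apply: (@runs_le _ _ (Th b [:: a, c & env st] + ((3 * size a + 1) +
   ((14 * size a' + 2) + 2)))); first by lia.
apply: runs_seq.
  have := cmhP b s1; rewrite e1; apply.
    by rewrite /s1 /s0 !updN ?sz //; lia.
  by move=> r zr; rewrite /s1 /s0 !updN ?sz //; lia.
rewrite -/(recn g h (b :: c) (env st)) -/a'.
apply: runs_seq.
  have := runs_clear z (upd s1 z.+3 a'); rewrite updN ?s1z; last by lia.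
  by apply.
apply: runs_seq.
  have -> : size a' = size (upd (upd s1 z.+3 a') z [::] z.+3).
    by rewrite updN ?updE //; lia.
  apply: runs_move; rewrite ?updE //; try lia.
  by rewrite /s1 /s0 !updN ?sz //; lia.
exists 2 => //.
set s2 := upd _ z _; have := EPush z.+2 b s2; congr exec.
have -> : s2 z.+2 = c by rewrite /s2 !updN ?s1c //; lia.
rewrite /s2 /s1 /s0 [upd _ z [::] z.+3]updN ?updE; last by lia.
apply/funext => r; rewrite /upd; repeat case: eqP => //; move=> *; try lia.
by rewrite sz //; lia.
Qed.

(** The size bound is what prevents iterated polynomial growth from becoming exponential: with it,
    each letter is processed on arguments of polynomial size. *)
Lemma PT_rec g h : PT g -> PT (h false) -> PT (h true) ->
  (exists c, forall s env, size (recn g h s env) <= (size s + esize env + 2) ^ c) ->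
  PT (fun env => recn g h (head [::] env) (behead env)).
Proof.
move=> PTg PT0 PT1 [cb cbP].
have {PT0 PT1} hP b : PT (h b) by case: b.
have sh : pbound esize (fun env => size (head [::] env)).
  by exists 1 => env; rewrite expn1 -nth0 (leq_trans (size_nth_esize _ _)) // leq_addr.
have se : pbound esize (fun env => esize (behead env)).
  by exists 1 => env; rewrite expn1 (leq_trans (esize_behead _)) // leq_addr.
have s2 : pbound esize (fun env => size (head [::] env) + esize (behead env) + 2).
  by apply: pboundD; [apply: pboundD|apply: pbound_const].
pose V env := (size (head [::] env) + esize (behead env) + 2) ^ cb.
have bV : pbound esize V by apply: pboundX.
split.
  by apply: leq_pbound bV => env; apply: cbP.
have {hP} [Th [ThP ch]] : exists Th : bool -> seq (seq bool) -> nat, (forall b rs o z,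
    all (fun r => r < z) rs -> o < z -> o \notin rs ->
    exists cm, forall st, st o = [::] -> (forall r, z <= r -> st r = [::]) ->
      runs cm st (Th b (map st rs)) (upd st o (h b (map st rs)))) /\
    exists ch, forall b env, Th b env <= (esize env + 2) ^ ch.
  have [_ [T0 [c0 b0] P0]] := hP false; have [_ [T1 [c1 b1] P1]] := hP true.
  exists (fun b => if b then T1 else T0); split; first by case.
  exists (c0 + c1) => -[] env; [apply: leq_trans (b1 _) _|apply: leq_trans (b0 _) _];
    rewrite leq_exp2l ?leq_addr ?leq_addl //; lia.
have [{}ch chP] := ch.
have [_ [Tg bTg gP]] := PTg.
pose K env := (V env + (size (head [::] env) + esize (behead env) + 2)) ^ ch +
  17 * V env + 10.
have bK : pbound esize K.
  apply: pboundD; last exact: pbound_const.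
  apply: pboundD; last by apply: pboundM => //; apply: pbound_const.
  by apply: pboundX; apply: pboundD.
exists (fun env => Tg (behead env) + (16 * size (head [::] env) + 2 +
  (7 * size (head [::] env) + 1 + (size (head [::] env) * K env + 1 +
   (3 * size (head [::] env) + 1 + (14 * V env + 2)))))).
  have bM n (T : _ -> nat) m : pbound esize T -> pbound esize (fun env => n * T env + m).
    move=> bT; apply: pboundD; last exact: pbound_const.
    by apply: pboundM => //; apply: pbound_const.
  apply: pboundD.
    case: bTg => c cP; exists c => env; apply: leq_trans (cP _) _.
    by apply: leq_expr; rewrite leq_add2r esize_behead.
  do 2 (apply: pboundD; first exact: bM).
  apply: pboundD.
    by apply: pboundD; [apply: pboundM|apply: pbound_const].
  by apply: pboundD; apply: bM.
move=> [|r0 rs] o z rz oz on /=.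
  have [cm cmP] := gP [::] o z erefl oz erefl.
  exists cm => st so sz; apply: runs_le (cmP st so sz); exact: leq_addr.
move: rz on => /= /andP[r0z rz]; rewrite inE negb_or => /andP[or0 on].
have lt_all y : z <= y -> all (fun r => r < y) rs.
  by move=> zy; apply: sub_all rz => r /leq_trans; apply.
have zn y : z <= y -> y \notin rs by move=> zy; apply: all_lt_notin; apply: lt_all.
have [||cmg cmgP] := gP rs z (z + 5) _ _ (zn z (leqnn z)).
- by apply: lt_all; lia.
- by lia.
have {}ThP b : exists cm, forall st, st z.+3 = [::] ->
    (forall r, z + 5 <= r -> st r = [::]) ->
    runs cm st (Th b (map st [:: z, z.+2 & rs]))
       (upd st z.+3 (h b (map st [:: z, z.+2 & rs]))).
  apply: ThP; last 1 first.
  - by rewrite !inE !negb_or zn; lia.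
  - by rewrite /= lt_all; lia.
  - by lia.
have [cmh0 cmh0P] := ThP false; have [cmh1 cmh1P] := ThP true.
pose cmh (b : bool) := if b then cmh1 else cmh0.
have cmhP b : forall st, st z.+3 = [::] ->
    (forall r, z + 5 <= r -> st r = [::]) ->
    runs (cmh b) st (Th b (map st [:: z, z.+2 & rs]))
       (upd st z.+3 (h b (map st [:: z, z.+2 & rs]))) by case: b.
(* The word is reversed into [z.+1] because the recursion starts from its last letter. *)
exists (Seq cmg (Seq (copy_reg r0 z.+4 z.+2) (Seq (moverev z.+2 z.+1)
  (Seq (transfer z.+1 (fun b => Seq (cmh b) (Seq (clear z)
          (Seq (move_reg z.+3 z.+4 z) (Push z.+2 b)))))
  (Seq (clear z.+2) (move_reg z z.+4 o)))))) => st so sz.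
set s := st r0; set env := map st rs.
apply: runs_seq.
  by apply: cmgP => [|r zr]; apply: sz; lia.
rewrite -/env; set st1 := upd st z (g env).
have st1r : st1 r0 = s by rewrite /st1 updN //; lia.
apply: runs_seq.
  rewrite -st1r; apply: runs_copy; try lia.
    by rewrite /st1 updN ?sz //; lia.
  by rewrite /st1 updN ?sz //; lia.
rewrite st1r; apply: runs_seq.
  have := @runs_moverev z.+2 z.+1 (upd st1 z.+2 s); rewrite updE; apply; lia.
set st2 := upd (upd _ _ _) _ _.
have st2E : st2 = upd (upd (upd st z (recn g h [::] env)) z.+1 (rev s)) z.+2 [::].
  rewrite /st2 /st1 /= [upd _ z.+2 s z.+1]updN; last by lia.
  rewrite [upd _ z _ z.+1]updN; last by lia.
  rewrite sz -/(rev s) //; apply/funext => r; rewrite /upd.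
  by repeat case: eqP => //; move=> *; subst; lia.
have := @runs_recn_loop g h cmh Th rs z (V (s :: env)) (K (s :: env)) (size s) rz
  cmhP st sz.
rewrite -/env => lP; have {lP} := lP _ _ (rev s) [::].
rewrite -st2E size_rev addn0 -/(rev (rev s)) revK => lP.
apply: runs_seq.
  apply: lP => //.
  - move=> c cs; apply: leq_trans (cbP _ _) _; rewrite /V /=; apply: leq_expr.
    by rewrite !leq_add2r.
  - move=> b c cs; rewrite /K !leq_add2r; apply: leq_trans (chP _ _) _.
    apply: leq_expr; rewrite /esize /= -/(esize env) -!addnA.
    have : size (recn g h c env) <= V (s :: env).
      apply: leq_trans (cbP _ _) _; rewrite /V /=; apply: leq_expr.
      by rewrite !leq_add2r.
    by lia.
set st3 := upd (upd st z _) z.+2 s.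
apply: runs_seq.
  have := runs_clear z.+2 st3; have -> : st3 z.+2 = s by rewrite /st3 updE.
  by apply.
set r := recn g h s env.
have rV : size r <= V (s :: env) by apply: cbP.
have st3z : upd st3 z.+2 [::] z = r by rewrite /st3 2?updN ?updE //; lia.
apply: (@runs_le _ _ (14 * size r + 2)); first by lia.
have -> : upd st o r = upd (upd (upd st3 z.+2 [::]) z [::]) o r.
  rewrite /st3; apply/funext => j; rewrite /upd.
  by repeat case: eqP => //; move=> *; rewrite sz //; lia.
rewrite -st3z; apply: runs_move; try lia.
  by rewrite /st3 !updN ?sz //; lia.
by rewrite /st3 !updN //; lia.
Qed.

Lemma leading_bits_rep s j :
  leading_bits ([seq Some (inl b) | b <- s] ++ nseq j None : seq (symbol void)) = s.
Proof. by elim: s => [|b s IH] /=; [case: j|rewrite IH]. Qed.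

Lemma PT_machine f : PT f -> exists M c, forall ws, size ws = 4 ->
  computes_within M (c * esize ws ^ c + c) ws (f ws).
Proof.
move=> [[cs csP] [T [cT cTP] fP]].
have [//|cm cmP] := fP [:: 0; 1; 2; 3] 4 5 erefl erefl _.
pose cm' := Seq cm (Seq (clear 0) (move_reg 4 5 0)).
pose prog := code 0 cm'; pose M := prog_machine (max_reg cm') prog.
have run ws : size ws = 4 -> exists st, st 0 = f ws /\
    runs cm' (nth [::] ws) (T ws + ((3 * esize ws + 1) + (14 * size (f ws) + 2))) st.
  move=> sws; set st := nth [::] ws.
  have stE : map st [:: 0; 1; 2; 3] = ws by rewrite /st; case: ws sws {st} => [|a[|b[|c[|d[]]]]].
  have st5 r : 4 <= r -> st r = [::] by move=> r4; rewrite /st nth_default // sws.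
  eexists; split; last first.
    apply: runs_seq.
      have := cmP st; rewrite stE; apply; first exact: st5.
      by move=> r r5; apply: st5; lia.
    apply: runs_seq.
      have := runs_clear 0 (upd st 4 (f ws)); rewrite updN // => h.
      by apply: runs_le h; rewrite leq_add2r leq_mul2l /=; apply: size_nth_esize.
    set st1 := upd _ 0 _.
    have <- : st1 4 = f ws by rewrite /st1 updN // updE.
    apply: runs_move => //.
    by rewrite /st1 !updN //; apply: st5.
  by rewrite /= updE updN // updE.
have [c cP] : pbound (@id nat) (fun N => (N + 2) ^ cT + ((3 * N + 1) + (14 * (N + 2) ^ cs + 2))).
  have b2 : pbound (@id nat) (fun N => N + 2).
    by apply: pboundD; [exact: pbound_id|exact: pbound_const].
  apply: pboundD; first exact: pboundX.
  apply: pboundD; (apply: pboundD; last exact: pbound_const).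
    by apply: pboundM; [exact: pbound_const|exact: pbound_id].
  by apply: pboundM; [exact: pbound_const|exact: pboundX].
(* For N > 0 one has (N + 2)^c <= 3^c N^c and c <= 3^c; for N = 0 the additive constant suffices. *)
exists M, (3 ^ c) => ws sws.
have [st [st0 [t tB ex]]] := run _ sws.
have {tB} tB : t <= 3 ^ c * esize ws ^ 3 ^ c + 3 ^ c.
  apply: leq_trans tB _; apply: (@leq_trans ((esize ws + 2) ^ c)).
    by apply: leq_trans (cP _); rewrite leq_add // leq_add // leq_add // leq_mul.
  case: (esize ws) => [|N].
    by rewrite add0n; apply: leq_trans (leq_addl _ _); apply: leq_expr.
  apply: leq_trans (leq_addr _ _); rewrite -[X in 3 ^ c * X](muln1).
  apply: (@leq_trans ((3 * N.+1) ^ c)); first by apply: leq_expr; lia.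
  rewrite expnMn muln1 leq_mul2l; apply/orP; right.
  by rewrite leq_pexp2l // ltnW // ltn_expl.
have rep0 : config_rep (init M ws) 0 (nth [::] ws).
  split=> // i /=; rewrite /tape_rep /word_tape /=.
  by case: (nth _ _ _) => [|b s]; [exists 1|exists 0; rewrite cats0].
have progE : prog = [::] ++ code 0 cm' ++ [::] by rewrite cats0.
have repT := exec_step ex (leqnn _) progE erefl rep0.
have halt : halted (iter t (@step M) (init M ws)).1.
  by apply/eqP; rewrite repT.1 add0n -(size_code 0).
(* A halted machine stays put, so the time bound may replace the exact time. *)
have iterH j : iter (t + j) (@step M) (init M ws) = iter t (@step M) (init M ws).
  rewrite iter_stepD; elim: j => //= j ->; by rewrite /step halt.
rewrite /computes_within -(subnKC tB) iterH; split=> //.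
have [j] := repT.2 ord0; rewrite /output => ->; by rewrite leading_bits_rep st0.
Qed.

Lemma esize_drop k env : esize (drop k env) <= esize env.
Proof.
elim: k env => [|k IH] [|s env] //=; apply: leq_trans (IH env) _.
exact: leq_addl.
Qed.

(** Dropping [k] entries serves inside loops, where accumulator and counter precede the
    environment. *)
Lemma PT_let_drop k F a : PT F -> PT a -> PT (fun env => F (a env :: drop k env)).
Proof.
move=> [sF [TF bTF FP]] [sa [Ta bTa aP]].
have sae : pbound esize (fun env => esize (a env :: drop k env)).
  apply: (@leq_pbound _ _ _ (fun env => size (a env) + esize env)) => [env|].
    by rewrite /esize /= leq_add2l; apply: esize_drop.
  by apply: pboundD => //; exact: pbound_id.
have cmp T : pbound esize T -> pbound esize (fun env => T (a env :: drop k env)).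
  by move=> bT; apply: pbound_comp sae (pbound_map _ bT).
split; first exact: (cmp (fun env => size (F env))).
exists (fun env => Ta env + (TF (a env :: drop k env) + (3 * size (a env) + 1))).
  apply: pboundD => //; apply: pboundD; first exact: cmp.
  by apply: pboundD; [apply: pboundM => //|]; apply: pbound_const.
move=> rs o z rz oz on.
have lt_all : all (fun r => r < z.+1) rs by apply: sub_all rz => r /ltnW.
have zn := all_lt_notin rz.
have sub : {subset drop k rs <= rs} by move=> r; apply: mem_drop.
have [cma cmaP] := aP rs z z.+1 lt_all (ltnSn z) zn.
have [|||cm cmP] := FP (z :: drop k rs) o z.+1.
- by rewrite /= ltnSn /=; apply/allP => r /sub /(allP lt_all).
- by lia.
- rewrite inE negb_or; apply/andP; split; first by lia.
  by apply: contra on => /sub.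
exists (Seq cma (Seq cm (clear z))) => st so sz.
apply: runs_seq.
  by apply: cmaP => [|r zr]; apply: sz => //; lia.
set v := a _; apply: runs_seq.
  have := cmP (upd st z v); rewrite /= updE map_drop map_upd //; apply.
    by rewrite updN //; lia.
  by move=> r zr; rewrite updN ?sz //; lia.
set st2 := upd _ o _.
have -> : upd st o (F (v :: drop k (map st rs))) = upd st2 z [::].
  rewrite /st2; apply/funext => r; rewrite /upd.
  by repeat case: eqP => //; move=> *; try lia; rewrite sz //; lia.
have <- : st2 z = v by rewrite /st2 updN ?updE //; lia.
exact: runs_clear.
Qed.

Lemma PT_let F a : PT F -> PT a -> PT (fun env => F (a env :: env)).
Proof. by move=> PF Pa; apply: PT_ext (PT_let_drop 0 PF Pa) => env; rewrite drop0. Qed.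

Definition isize (p : nat * seq (seq bool)) : nat := p.1 + esize p.2.

Lemma pbound_fst : pbound isize fst.
Proof. by exists 1 => p; rewrite expn1 /isize; lia. Qed.

Lemma pbound_snd T : pbound esize T -> pbound isize (fun p => T p.2).
Proof.
by move=> [c cP]; exists c => p; apply: leq_trans (cP _) (leq_expr _ _); rewrite /isize; lia.
Qed.

Lemma PT_rec_open g h s : PT s -> PT g -> PT (h false) -> PT (h true) ->
  (exists c, forall s env, size (recn g h s env) <= (size s + esize env + 2) ^ c) ->
  PT (fun env => recn g h (s env) env).
Proof. by move=> Ps Pg P0 P1 b; have := PT_let (PT_rec Pg P0 P1 b) Ps. Qed.

(** * Unary arithmetic, Booleans and words *)

Definition PTn (a : seq (seq bool) -> nat) : Prop := PT (fun env => nseq (a env) true).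

Definition PTb (p : seq (seq bool) -> bool) : Prop := PTn (fun env => nat_of_bool (p env)).

Lemma PTn_ext a b : (forall env, a env = b env) -> PTn a -> PTn b.
Proof. by move=> /funext ->. Qed.

Lemma PTb_ext a b : (forall env, a env = b env) -> PTb a -> PTb b.
Proof. by move=> /funext ->. Qed.

Lemma PTn_bound a : PTn a -> pbound esize a.
Proof. by move=> /PT_size [c cP]; exists c => env; have := cP env; rewrite size_nseq. Qed.

Lemma PT_wk1 f : PT f -> PT (fun env => f (behead env)).
Proof. exact: PT_weaken. Qed.

Lemma PT_wk2 f : PT f -> PT (fun env => f (behead (behead env))).
Proof. by move=> Pf; apply: (PT_weaken (f := fun env => f (behead env)) (PT_weaken Pf)). Qed.

Lemma PT_wk3 f : PT f -> PT (fun env => f (behead (behead (behead env)))).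
Proof. by move=> Pf; apply: (PT_weaken (f := fun env => f (behead (behead env))) (PT_wk2 Pf)). Qed.

Lemma PT_head : PT (fun env => head [::] env).
Proof. by apply: PT_ext (PT_nth 0) => env; rewrite nth0. Qed.

Lemma PT_size_nat s : PT s -> PTn (fun env => size (s env)).
Proof.
move=> Ps; pose h (b : bool) (env : seq (seq bool)) := true :: head [::] env.
have Ph : PT (h true) by apply: PT_cons; apply: PT_head.
have E s' env : recn (fun=> [::]) h s' env = nseq (size s') true.
  by elim: s' => //= b s' ->.
apply: PT_ext (PT_rec_open Ps PT_nil Ph Ph _) => [env|]; first exact: E.
exists 1 => s' env; rewrite E size_nseq expn1; lia.
Qed.

Lemma PT_iteri g (H : seq (seq bool) -> nat -> seq bool -> seq bool) n :
  PT g -> PTn n ->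
  PT (fun env => H (behead (behead env)) (size (head [::] (behead env))) (head [::] env)) ->
  pbound isize (fun p => size (iteri p.1 (H p.2) (g p.2))) ->
  PT (fun env => iteri (n env) (H env) (g env)).
Proof.
move=> Pg Pn PH [c cP].
pose h (b : bool) (env : seq (seq bool)) :=
  H (behead (behead env)) (size (head [::] (behead env))) (head [::] env).
have E s' env : recn g h s' env = iteri (size s') (H env) (g env).
  by elim: s' => //= b s' ->.
apply: PT_ext (@PT_rec_open g h _ Pn Pg PH PH _) => [env|].
  by rewrite E size_nseq.
by exists c => s' env; rewrite E; apply: (cP (_, _)).
Qed.

Lemma PTn_iteri g (H : seq (seq bool) -> nat -> nat -> nat) n :
  PTn g -> PTn n ->
  PTn (fun env => H (behead (behead env)) (size (head [::] (behead env)))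
                    (size (head [::] env))) ->
  pbound isize (fun p => iteri p.1 (H p.2) (g p.2)) ->
  PTn (fun env => iteri (n env) (H env) (g env)).
Proof.
move=> Pg Pn PH [c cP].
have E i env : iteri i (fun j s => nseq (H env j (size s)) true) (nseq (g env) true) =
    nseq (iteri i (H env) (g env)) true.
  by elim: i => //= i ->; rewrite size_nseq.
apply: PT_ext (@PT_iteri _ (fun env j s => nseq (H env j (size s)) true) _ Pg Pn PH _)
  => [env|]; first exact: E.
by exists c => p; rewrite E size_nseq.
Qed.

Lemma PT_if p a b : PTb p -> PT a -> PT b -> PT (fun env => if p env then a env else b env).
Proof.
move=> Pp Pa Pb; pose h (c : bool) (env : seq (seq bool)) := a (behead (behead env)).
have Ph : PT (h true) by apply: PT_wk2.
apply: PT_ext (PT_rec_open Pp Pb Ph Ph _) => [env|]; first by case: (p env).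
have [c cP] : pbound esize (fun env => size (a env) + size (b env)).
  by apply: pboundD; apply: PT_size.
exists c => s env; apply: (@leq_trans ((esize env + 2) ^ c)).
  by apply: leq_trans (cP env); case: s => [|b' s]; rewrite /h /=; lia.
by apply: leq_expr; lia.
Qed.

Lemma PTn_if p a b : PTb p -> PTn a -> PTn b -> PTn (fun env => if p env then a env else b env).
Proof. by move=> Pp Pa Pb; apply: PT_ext (PT_if Pp Pa Pb) => env; case: (p env). Qed.

Lemma PTb_if p a b : PTb p -> PTb a -> PTb b -> PTb (fun env => if p env then a env else b env).
Proof. by move=> Pp Pa Pb; apply: PTn_ext (PTn_if Pp Pa Pb) => env; case: (p env). Qed.

Lemma PTn_const n : PTn (fun=> n).
Proof. by elim: n => [|n IH]; [exact: PT_nil|exact: (PT_cons true IH)]. Qed.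

Lemma PTb_const b : PTb (fun=> b).
Proof. exact: PTn_const. Qed.

Lemma PTn_succ a : PTn a -> PTn (fun env => (a env).+1).
Proof. exact: (@PT_cons true). Qed.

Lemma PTn_pred a : PTn a -> PTn (fun env => (a env).-1).
Proof. by move=> Pa; apply: PT_ext (PT_tail Pa) => env; case: (a env). Qed.

Lemma PTn_wk1 a : PTn a -> PTn (fun env => a (behead env)).
Proof. exact: (PT_weaken (f := fun env => nseq (a env) true)). Qed.

Lemma PTn_wk2 a : PTn a -> PTn (fun env => a (behead (behead env))).
Proof. exact: (PT_wk2 (f := fun env => nseq (a env) true)). Qed.

Lemma PTn_wk3 a : PTn a -> PTn (fun env => a (behead (behead (behead env)))).
Proof. exact: (PT_wk3 (f := fun env => nseq (a env) true)). Qed.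

Lemma PTn_head : PTn (fun env => size (head [::] env)).
Proof. exact: PT_size_nat PT_head. Qed.

Lemma PTn_head1 : PTn (fun env => size (head [::] (behead env))).
Proof. exact: (PTn_wk1 (a := fun env => size (head [::] env)) PTn_head). Qed.

Lemma PTn_add a b : PTn a -> PTn b -> PTn (fun env => a env + b env).
Proof.
move=> Pa Pb; have E i env : iteri i (fun _ => succn) (a env) = a env + i.
  by elim: i => [|i /= ->]; rewrite ?addn0 ?addnS.
apply: PTn_ext (@PTn_iteri a (fun _ _ => succn) b Pa Pb _ _) => [env||].
- exact: E.
- by apply: PTn_succ PTn_head.
apply: (@leq_pbound _ _ _ (fun p => a p.2 + p.1)) => [p|]; first by rewrite E.
by apply: pboundD; [apply: pbound_snd; apply: PTn_bound|exact: pbound_fst].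
Qed.

Lemma PTn_mul a b : PTn a -> PTn b -> PTn (fun env => a env * b env).
Proof.
move=> Pa Pb; have E i env : iteri i (fun _ r => r + b env) 0 = i * b env.
  by elim: i => //= i ->; rewrite mulSn addnC.
apply: PTn_ext (@PTn_iteri (fun=> 0) (fun env _ r => r + b env) a _ Pa _ _) => [env|||].
- exact: E.
- exact: PTn_const.
- by apply: PTn_add PTn_head _; apply: PTn_wk2.
apply: (@leq_pbound _ _ _ (fun p => p.1 * b p.2)) => [p|]; first by rewrite E.
by apply: pboundM; [exact: pbound_fst|apply: pbound_snd; apply: PTn_bound].
Qed.

Lemma PTn_exp a c : PTn a -> PTn (fun env => a env ^ c).
Proof.
move=> Pa; elim: c => [|c IH]; first exact: (PTn_const 1).
by apply: PTn_ext (PTn_mul Pa IH) => env; rewrite expnS.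
Qed.

Lemma PTn_sub a b : PTn a -> PTn b -> PTn (fun env => a env - b env).
Proof.
move=> Pa Pb; have E i env : iteri i (fun _ => predn) (a env) = a env - i.
  by elim: i => [|i /= ->]; rewrite ?subn0 ?subnS.
apply: PTn_ext (@PTn_iteri a (fun _ _ => predn) b Pa Pb _ _) => [env||].
- exact: E.
- by apply: PTn_pred PTn_head.
apply: (@leq_pbound _ _ _ (fun p => a p.2)) => [p|]; first by rewrite E leq_subr.
by apply: pbound_snd; apply: PTn_bound.
Qed.

Lemma PTb_eq0 a : PTn a -> PTb (fun env => a env == 0).
Proof.
move=> Pa; have E i (env : seq (seq bool)) : iteri i (fun _ _ => 0) 1 = (i == 0).
  by case: i.
apply: PTn_ext (@PTn_iteri (fun=> 1) (fun _ _ _ => 0) a _ Pa _ _) => [env|||].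
- exact: (E _ env).
- exact: PTn_const.
- exact: PTn_const.
apply: (@leq_pbound _ _ _ (fun=> 1)) => [p|]; first by rewrite (E _ [::]); case: eqP.
exact: pbound_const.
Qed.

Lemma PTb_leq a b : PTn a -> PTn b -> PTb (fun env => a env <= b env).
Proof. by move=> Pa Pb; apply: PTb_eq0; apply: PTn_sub. Qed.

Lemma PTb_lt a b : PTn a -> PTn b -> PTb (fun env => a env < b env).
Proof. by move=> Pa Pb; apply: PTb_leq => //; apply: PTn_succ. Qed.

Lemma PTb_and a b : PTb a -> PTb b -> PTb (fun env => a env && b env).
Proof.
by move=> Pa Pb; apply: PTb_ext (PTb_if Pa Pb (PTb_const false)) => env; case: (a env).
Qed.

Lemma PTb_or a b : PTb a -> PTb b -> PTb (fun env => a env || b env).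
Proof.
by move=> Pa Pb; apply: PTb_ext (PTb_if Pa (PTb_const true) Pb) => env; case: (a env).
Qed.

Lemma PTb_neg a : PTb a -> PTb (fun env => ~~ a env).
Proof.
by move=> Pa; apply: PTb_ext (PTb_if Pa (PTb_const false) (PTb_const true)) => env; case: (a env).
Qed.

Lemma PTb_addb a b : PTb a -> PTb b -> PTb (fun env => a env (+) b env).
Proof.
by move=> Pa Pb; apply: PTb_ext (PTb_if Pa (PTb_neg Pb) Pb) => env; case: (a env).
Qed.

Lemma PTb_eqn a b : PTn a -> PTn b -> PTb (fun env => a env == b env).
Proof.
move=> Pa Pb; have := PTb_and (PTb_leq Pa Pb) (PTb_leq Pb Pa).
by apply: PTb_ext => env; rewrite eqn_leq.
Qed.

Lemma PTn_min a b : PTn a -> PTn b -> PTn (fun env => minn (a env) (b env)).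
Proof. by move=> Pa Pb; apply: PTn_if => //; apply: PTb_lt. Qed.

Lemma PTn_sum (F : seq (seq bool) -> nat -> nat) n : PTn n ->
  PTn (fun env => F (behead env) (size (head [::] env))) ->
  PTn (fun env => \sum_(i < n env) F env i).
Proof.
move=> Pn PF; have E i env : iteri i (fun j r => r + F env j) 0 = \sum_(j < i) F env j.
  by elim: i => [|i /= ->]; rewrite ?big_ord0 // big_ord_recr.
apply: PTn_ext (@PTn_iteri (fun=> 0) (fun env j r => r + F env j) n _ Pn _ _) => [env|||].
- exact: E.
- exact: PTn_const.
- by apply: PTn_add PTn_head _; exact: (PTn_wk1 PF).
have [c cP] := PTn_bound PF.
apply: (@leq_pbound _ _ _ (fun p => p.1 * (isize p + 2) ^ c)) => [p|].
  rewrite E -[p.1 in leqRHS]card_ord -sum_nat_const; apply: leq_sum => i _.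
  apply: leq_trans (_ : F p.2 i <= (i + esize p.2 + 2) ^ c) _.
    by have := cP (nseq i true :: p.2); rewrite /= size_nseq /esize /= size_nseq.
  by apply: leq_expr; rewrite /isize; have := ltn_ord i; lia.
apply: pboundM; first exact: pbound_fst.
apply: pboundX; apply: pboundD; [exact: pbound_id|exact: pbound_const].
Qed.

Lemma sum_nat_leq q n : q <= n -> \sum_(i < n) (i < q) = q.
Proof.
elim: n => [|n IH]; first by rewrite leqn0 big_ord0 => /eqP.
rewrite leq_eqVlt => /predU1P[->|qn].
  rewrite (eq_bigr (fun=> 1)) ?sum_nat_const ?card_ord ?muln1 // => i _.
  by rewrite ltn_ord.
by rewrite big_ord_recr /= IH // ltnNge -ltnS qn addn0.
Qed.

(** The quotient counts the [i] below [a] with [i.+1 * b <= a]. *)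
Lemma PTn_div a b : PTn a -> PTn b -> PTn (fun env => a env %/ b env).
Proof.
move=> Pa Pb; apply: PTn_ext (@PTn_sum
  (fun env i => (0 < b env) && (i.+1 * b env <= a env)) a Pa _) => [env|].
  have [b0|b0] := posnP (b env).
    by rewrite b0 divn0 big1.
  rewrite -[RHS](sum_nat_leq (leq_div _ _)).
  by apply: eq_bigr => i _; rewrite -leq_divRL.
apply: PTb_and; first by apply: PTb_lt; [exact: PTn_const|apply: PTn_wk1].
apply: PTb_leq; last by apply: PTn_wk1.
by apply: PTn_mul; [apply: PTn_succ PTn_head|apply: PTn_wk1].
Qed.

Lemma PTn_mod a b : PTn a -> PTn b -> PTn (fun env => a env %% b env).
Proof.
move=> Pa Pb; apply: PTn_ext (PTn_sub Pa (PTn_mul (PTn_div Pa Pb) Pb)) => env.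
by rewrite [X in X - _](divn_eq _ (b env)) addKn.
Qed.

Lemma PTb_odd a : PTn a -> PTb (fun env => odd (a env)).
Proof.
by move=> Pa; apply: PTn_ext (PTn_mod Pa (PTn_const 2)) => env; rewrite modn2.
Qed.

Lemma PTb_parity (F : seq (seq bool) -> nat -> bool) n : PTn n ->
  PTb (fun env => F (behead env) (size (head [::] env))) ->
  PTb (fun env => \big[addb/false]_(i < n env) F env i).
Proof.
move=> Pn PF; apply: PTb_ext (PTb_odd (PTn_sum (F := fun env i => F env i : nat) Pn PF)) => env.
rewrite (big_morph odd oddD (erefl : odd 0 = false)).
by apply: eq_bigr => i _; rewrite oddb.
Qed.

(** A power in unary has to be cut off at a polynomial bound, and the cut-off can be made at each
    multiplication. *)
Lemma PTn_expmin a i B : PTn a -> PTn i -> PTn B ->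
  PTn (fun env => minn (a env ^ i env) (B env)).
Proof.
move=> Pa Pi PB; have E j env :
    iteri j (fun _ r => minn (a env * r) (B env)) (minn 1 (B env)) =
    minn (a env ^ j) (B env).
  elim: j => //= j ->; rewrite expnS.
  have [|] := leqP (a env ^ j) (B env) => // /ltnW h.
  have [->|a0] := posnP (a env); first by rewrite mul0n.
  by rewrite (minn_idPr _) ?(minn_idPr _) //; nia.
apply: PTn_ext (@PTn_iteri (fun env => minn 1 (B env))
  (fun env _ r => minn (a env * r) (B env)) i _ Pi _ _) => [env|||].
- exact: E.
- by apply: PTn_min => //; apply: PTn_const.
- apply: PTn_min; last exact: PTn_wk2.
  by apply: PTn_mul PTn_head; apply: PTn_wk2.
apply: (@leq_pbound _ _ _ (fun p => B p.2)) => [p|]; first by rewrite E geq_minr.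
by apply: pbound_snd; apply: PTn_bound.
Qed.

Lemma PT_consb b s : PTb b -> PT s -> PT (fun env => b env :: s env).
Proof.
move=> Pb Ps; apply: PT_ext (PT_if Pb (PT_cons true Ps) (PT_cons false Ps)) => env.
by case: (b env).
Qed.

Lemma PTb_headb s : PT s -> PTb (fun env => head false (s env)).
Proof.
move=> Ps; pose h (b : bool) (env : seq (seq bool)) := nseq b true.
have E s' env : recn (fun=> [::]) h s' env = nseq (head false s') true by case: s'.
apply: PT_ext (@PT_rec_open _ h _ Ps PT_nil (PTn_const 0) (PTn_const 1) _) => [env|].
  exact: E.
exists 1 => s' env; rewrite E size_nseq expn1; case: (head _ _); lia.
Qed.

Lemma PTb_nth s i : PT s -> PTn i -> PTb (fun env => nth false (s env) (i env)).
Proof.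
move=> Ps Pi; have E j env : iteri j (fun _ => behead) (s env) = drop j (s env).
  by elim: j => [|j /= ->]; rewrite ?drop0 // -drop1 drop_drop add1n.
apply: PTb_ext (@PTb_headb (fun env => iteri (i env) (fun _ => behead) (s env)) _) => [env|].
  by rewrite E -nth0 nth_drop addn0.
apply: PT_iteri => //; first exact: PT_tail PT_head.
apply: (@leq_pbound _ _ _ (fun p => size (s p.2))) => [p|].
  by rewrite E size_drop leq_subr.
exact: (@pbound_snd (fun env => size (s env)) (PT_size Ps)).
Qed.

Lemma PT_mkseq (F : seq (seq bool) -> nat -> bool) n : PTn n ->
  PTb (fun env => F (behead env) (size (head [::] env))) ->
  PT (fun env => mkseq (F env) (n env)).
Proof.
move=> Pn PF.
(* The word is built from its last letter on, since letters are added in front. *)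
pose G m env i := iteri i (fun j s => F env (m - j.+1) :: s) [::].
have sG m env i : size (G m env i) = i by elim: i => //= i ->.
have E m env i : i <= m -> G m env i = map (F env) (iota (m - i) i).
  by elim: i => //= i IH im; rewrite -/(G m env i) IH 1?ltnW // subnSK.
apply: PT_ext (@PT_iteri (fun=> [::])
  (fun env j s => F env (n env - j.+1) :: s) n PT_nil Pn _ _) => [env||].
- by rewrite -[LHS]/(G (n env) env _) E // subnn.
- apply: (@PT_consb (fun env => F (behead (behead env))
    (n (behead (behead env)) - (size (head [::] (behead env))).+1))); last exact: PT_head.
  pose idx env := n (behead (behead env)) - (size (head [::] (behead env))).+1.
  have Pidx : PTn idx.
    by apply: PTn_sub; [apply: PTn_wk2|apply: PTn_succ PTn_head1].
  apply: PT_ext (PT_let_drop 2 PF Pidx) => env /=.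
  by rewrite size_nseq /idx; case: env => [|a [|b env]] //=; rewrite drop0.
apply: (@leq_pbound _ _ _ fst) => [p|]; last exact: pbound_fst.
by rewrite -[iteri _ _ _]/(G (n p.2) p.2 p.1) sG.
Qed.

Lemma PT_cat a b : PT a -> PT b -> PT (fun env => a env ++ b env).
Proof.
move=> Pa Pb; apply: PT_ext (@PT_mkseq (fun env i =>
  if i < size (a env) then nth false (a env) i else nth false (b env) (i - size (a env)))
  (fun env => size (a env) + size (b env)) _ _) => [env||].
- apply: (@eq_from_nth _ false); rewrite size_mkseq ?size_cat // => i iab.
  by rewrite nth_mkseq // nth_cat.
- by apply: PTn_add; apply: PT_size_nat.
have Psa : PTn (fun env => size (a (behead env))).
  by apply: (PTn_wk1 (a := fun env => size (a env))); apply: PT_size_nat.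
apply: PTb_if; first by apply: PTb_lt => //; exact: PTn_head.
  by apply: PTb_nth; [apply: PT_wk1|exact: PTn_head].
by apply: PTb_nth; [apply: PT_wk1|apply: PTn_sub => //; exact: PTn_head].
Qed.

Lemma PTn_argmin (W : seq (seq bool) -> nat -> nat) n : PTn n ->
  PTn (fun env => W (behead env) (size (head [::] env))) ->
  PTn (fun env => iteri (n env) (fun y r => if W env y < W env r then y else r) 0).
Proof.
move=> Pn PW; have E i env :
    iteri i (fun y r => if W env y < W env r then y else r) 0 <= i.
  by elim: i => //= i IH; case: ifP => _ //; apply: leq_trans IH _.
have PWi a : PTn a -> PTn (fun env => W (behead (behead env)) (a env)).
  move=> Pa; apply: PT_ext (PT_let_drop 2 PW Pa) => env /=.
  by rewrite size_nseq; case: env => [|u [|v env]] //=; rewrite drop0.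
apply: (@PTn_iteri (fun=> 0) (fun env y r => if W env y < W env r then y else r)) => //.
- exact: PTn_const.
- apply: PTn_if; [|exact: PTn_head1|exact: PTn_head].
  by apply: PTb_lt; apply: PWi; [exact: PTn_head1|exact: PTn_head].
apply: (@leq_pbound _ _ _ fst) => [p|]; last exact: pbound_fst.
exact: E.
Qed.

(** * The extractor *)

(** The number of binary digits of [n]; exponents below [n] suffice as n < 2^n. *)
Definition bitlen (n : nat) : nat := \sum_(i < n) (2 ^ i <= n).

(** The least power of 3 exceeding [X], tripled whenever the counter catches up. *)
Definition pow3_above (X : nat) : nat :=
  iteri X (fun i r => if r <= i.+1 then 3 * r else r) 1.

Definition bits (h j : nat) : seq bool := mkseq (fun i => odd (j %/ 2 ^ i)) h.

Definition xorv (l : nat) (a b : seq bool) : seq bool :=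
  mkseq (fun i => nth false a i (+) nth false b i) l.

Definition dot (l : nat) (a b : seq bool) : bool :=
  \big[addb/false]_(i < l) (nth false a i && nth false b i).

Definition subword (l p : nat) (r : seq bool) : seq bool :=
  mkseq (fun j => nth false r (p + j)) l.

(* Arithmetic in GF(2)[X] / (X^(2h) + X^h + 1), which is the field with 4^h   *)
(* elements when [h] is a power of 3; the coefficient of X^i is at position i. *)
Definition mulX (h : nat) (a : seq bool) : seq bool :=
  mkseq (fun i => ((0 < i) && nth false a i.-1) (+)
                  (((i == 0) || (i == h)) && nth false a (2 * h).-1)) (2 * h).

(** Horner's scheme, from the top coefficient of [a]. *)
Definition mulf (h : nat) (a b : seq bool) : seq bool :=
  iteri (2 * h)
    (fun i r => mkseq (fun j => nth false (mulX h r) j (+)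
                  (nth false a (2 * h - i.+1) && nth false b j)) (2 * h))
    (nseq (2 * h) false).

Definition powf (h : nat) (a : seq bool) (i : nat) : seq bool :=
  iteri i (fun _ r => mulf h a r) (mkseq (fun j => j == 0) (2 * h)).

(** The powering construction of a small-bias space. *)
Definition shift_vec (N h : nat) (a b : seq bool) : seq bool :=
  mkseq (fun i => dot h (powf h a i.+1) b) N.

(** Truncating the powers of 2 keeps the sum small in unary and does not change the bit: a position
    outside [x] stays outside and reads as [false]. *)
Definition read_at (x v : seq bool) (N : nat) : bool :=
  nth false x (\sum_(i < N) nth false v i * minn (2 ^ i) (size x)).

Definition base_bit (N h : nat) (x v a c g : seq bool) : bool :=
  \big[addb/false]_(j < 2 ^ h)
    (read_at x (xorv N v (shift_vec N h a (bits h j))) N &&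
     dot (2 * h) (powf h c j) g).

(* A codeword index consists of a starting vertex (N bits) and, for each step *)
(* of the walk, of [a] (2h bits), [b] (h bits), [c] and [g] (2h bits each).   *)
Definition vertex (N h : nat) (r : seq bool) (i : nat) : seq bool :=
  iteri i (fun j v => xorv N v (shift_vec N h
             (subword (2 * h) (N + j * (7 * h)) r)
             (subword h (N + j * (7 * h) + 2 * h) r)))
    (subword N 0 r).

Definition code_bit (N h w : nat) (x r : seq bool) : bool :=
  \big[addb/false]_(i < w)
    base_bit N h x (vertex N h r i) (subword (2 * h) (N + i * (7 * h)) r)
      (subword (2 * h) (N + i * (7 * h) + 3 * h) r)
      (subword (2 * h) (N + i * (7 * h) + 5 * h) r).

(* The design is a table of words over an alphabet of size [Q]: entry number  *)
(* [i * t + p], encoded in unary by [Q] bits, is the [p]-th letter of the     *)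
(* [i]-th word.                                                               *)
Definition cell (Q : nat) (T : seq bool) (s y : nat) : bool := nth false T (s * Q + y).

Definition agreement (t Q : nat) (T : seq bool) (i j p : nat) : nat :=
  \sum_(p' < p) \sum_(y < Q) (cell Q T (i * t + p') y && cell Q T (j * t + p') y).

(** Up to the cut-off [B], the increase of the potential, the sum over j < i of 2^agreement, if [y]
    becomes the next letter. Minimising it is the method of conditional expectations. *)
Definition weight (B t Q : nat) (T : seq bool) (i p y : nat) : nat :=
  \sum_(j < i) cell Q T (j * t + p) y * minn (2 ^ agreement t Q T i j p) B.

Definition letter (B t Q : nat) (T : seq bool) (s : nat) : nat :=
  iteri Q (fun y r => if weight B t Q T (s %/ t) (s %% t) y
                         < weight B t Q T (s %/ t) (s %% t) r then y else r) 0.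

Definition design (B t Q M : nat) : seq bool :=
  iteri M (fun s T => T ++ mkseq (fun y => y == letter B t Q T s) Q) [::].

Definition seed_select (t Q : nat) (T : seq bool) (i : nat) (u : seq bool) : seq bool :=
  mkseq (fun p => \big[addb/false]_(y < Q)
                    (cell Q T (i * t + p) y && nth false u (p * Q + y))) t.

Section Construction.

Variables (A C : nat).

(** Puts 2^h between (2N)^A and a polynomial in N, for N the bit length of [n]. *)
Definition field_param (n : nat) : nat := pow3_above (A * (bitlen (bitlen n)).+1).

Definition walk_length (e n : nat) : nat := (C * (bitlen n + e)) %/ field_param n.

Definition index_length (e n : nat) : nat :=
  bitlen n + walk_length e n * (7 * field_param n).

(** Makes t/Q at most N/8, so that the growth (1 + 1/Q)^t of the design potential is a small power
    of [n]. *)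
Definition alphabet (e n : nat) : nat := 8 * (index_length e n %/ bitlen n).+1.

Definition seed_length (e n : nat) : nat := index_length e n * alphabet e n.

(** An integer version of delta n^(1/10800) log(1/eps), with k/n for delta. *)
Definition output_length (k e n : nat) : nat :=
  k * e * 2 ^ ((bitlen n).-1 %/ 10800) %/ n.

Definition extractor (k e : nat) (x u : seq bool) : seq bool :=
  let n := size x in
  let T := design n (index_length e n) (alphabet e n)
             (output_length k e n * index_length e n) in
  mkseq (fun i => code_bit (bitlen n) (field_param n) (walk_length e n) x
           (seed_select (index_length e n) (alphabet e n) T i u))
    (output_length k e n).

End Construction.

(** * Explicitness *)

Ltac pt_var := first
  [ assumption | exact: PTn_head | exact: PTn_head1 | exact: PT_head
  | exact: PTn_const | exact: PTb_const
  | apply: PTn_wk1; assumption | apply: PT_wk1; assumption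
  | apply: PTn_wk2; assumption | apply: PT_wk2; assumption
  | apply: PTn_wk3; assumption | apply: PT_wk3; assumption ].

Ltac pt := lazy beta; repeat first
  [ pt_var
  | lazymatch goal with
    | |- PTb (fun _ => _ (+) _) => apply: PTb_addb
    | |- PTb (fun _ => _ && _) => apply: PTb_and
    | |- PTb (fun _ => _ || _) => apply: PTb_or
    | |- PTb (fun _ => leq (S _) _) => apply: PTb_lt
    | |- PTb (fun _ => leq _ _) => apply: PTb_leq
    | |- PTb (fun _ => @eq_op _ _ 0) => apply: PTb_eq0
    | |- PTb (fun _ => @eq_op _ _ _) => apply: PTb_eqn
    | |- PTb (fun _ => nth false _ _) => apply: PTb_nth
    | |- PTb (fun _ => odd _) => apply: PTb_odd
    | |- PTn (fun _ => nat_of_bool _) => rewrite -/(PTb _)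
    | |- PTn (fun _ => addn _ _) => apply: PTn_add
    | |- PTn (fun _ => muln _ _) => apply: PTn_mul
    | |- PTn (fun _ => subn _ _) => apply: PTn_sub
    | |- PTn (fun _ => divn _ _) => apply: PTn_div
    | |- PTn (fun _ => modn _ _) => apply: PTn_mod
    | |- PTn (fun _ => size _) => apply: PT_size_nat
    | |- PTn (fun _ => predn _) => apply: PTn_pred
    | |- PTn (fun _ => S _) => apply: PTn_succ
    | |- PTn (fun _ => minn (expn _ _) _) => apply: PTn_expmin
    | |- PTn (fun _ => minn _ _) => apply: PTn_min
    | |- PTn (fun _ => if _ then _ else _) => apply: PTn_if
    | |- PT (fun _ => if _ then _ else _) => apply: PT_if
    | |- PT (fun _ => _ ++ _) => apply: PT_cat
    | |- PT (fun _ => nseq _ true) => rewrite -/(PTn _)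
    | |- PT (fun _ => mkseq _ _) => apply: PT_mkseq
    end ].

Lemma PT_nseq_false a : PTn a -> PT (fun env => nseq (a env) false).
Proof.
move=> Pa; apply: PT_ext (@PT_mkseq (fun _ _ => false) a Pa (PTb_const _)) => env.
by apply: (@eq_from_nth _ false); rewrite size_mkseq ?size_nseq // => i ia;
  rewrite nth_mkseq // nth_nseq ia.
Qed.

Lemma PTn_bitlen a : PTn a -> PTn (fun env => bitlen (a env)).
Proof.
move=> Pa; apply: PTn_ext (@PTn_sum
  (fun env i => nat_of_bool (minn (2 ^ i) (a env).+1 <= a env)) a Pa _) => [env|].
  by apply: eq_bigr => i _; rewrite geq_min ltnn orbF.
apply: (@PTb_leq (fun env => minn (2 ^ size (head [::] env)) (a (behead env)).+1)
  (fun env => a (behead env))); pt.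
Qed.

Lemma pow3_above_bounds X : pow3_above X <= 3 * X + 1 /\ X < pow3_above X.
Proof.
rewrite /pow3_above; elim: X => //= X; set r := iteri X _ _ => -[IH1 IH2].
by case: (leqP r X.+1) => h; split; lia.
Qed.

Lemma PTn_pow3_above a : PTn a -> PTn (fun env => pow3_above (a env)).
Proof.
move=> Pa; apply: (@PTn_iteri (fun=> 1)
  (fun _ i r => if r <= i.+1 then 3 * r else r)); try by pt.
apply: (@leq_pbound _ _ _ (fun p => 3 * p.1 + 1)) => [p|].
  exact: (pow3_above_bounds _).1.
by apply: pboundD; [apply: pboundM; [|exact: pbound_fst]|]; apply: pbound_const.
Qed.

Lemma PT_bits h j : PTn h -> PTn j -> PT (fun env => bits (h env) (j env)).
Proof.
move=> Ph Pj; apply: PT_ext (@PT_mkseq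
  (fun env i => odd (j env %/ minn (2 ^ i) (j env).+1)) h Ph _) => [env|]; last by pt.
apply: eq_mkseq => i; rewrite /minn; case: ltnP => // lt.
by rewrite !divn_small.
Qed.

Lemma PT_xorv l a b : PTn l -> PT a -> PT b -> PT (fun env => xorv (l env) (a env) (b env)).
Proof. by move=> *; apply: PT_mkseq; pt. Qed.

Lemma PTb_dot l a b : PTn l -> PT a -> PT b -> PTb (fun env => dot (l env) (a env) (b env)).
Proof.
move=> *; apply: (@PTb_parity (fun env i => nth false (a env) i && nth false (b env) i)); pt.
Qed.

Lemma PT_subword l p r : PTn l -> PTn p -> PT r ->
  PT (fun env => subword (l env) (p env) (r env)).
Proof. by move=> *; apply: PT_mkseq; pt. Qed.

Lemma PT_mulX h a : PTn h -> PT a -> PT (fun env => mulX (h env) (a env)).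
Proof. by move=> *; apply: PT_mkseq; pt. Qed.

Lemma PT_mulf h a b : PTn h -> PT a -> PT b ->
  PT (fun env => mulf (h env) (a env) (b env)).
Proof.
move=> Ph Pa Pb; pose st h a b i r := mkseq (fun j => nth false (mulX h r) j (+)
   (nth false a (2 * h - i.+1) && nth false b j)) (2 * h).
have Pst h' a' b' i r : PTn h' -> PT a' -> PT b' -> PTn i -> PT r ->
    PT (fun env => st (h' env) (a' env) (b' env) (i env) (r env)).
  move=> *; apply: PT_mkseq; pt; apply: PT_mulX; pt.
apply: (@PT_iteri _ (fun env => st (h env) (a env) (b env)) (fun env => 2 * h env)); pt.
- by apply: PT_nseq_false; pt.
- by apply: Pst; pt.
apply: (@leq_pbound _ _ _ (fun p => 2 * h p.2)) => [[[|i] env]|] /=.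
- by rewrite size_nseq.
- by rewrite size_mkseq.
by apply: pboundM; [exact: pbound_const|apply: pbound_snd; apply: PTn_bound].
Qed.

Lemma size_mulf h a b : size (mulf h a b) = 2 * h.
Proof. by rewrite /mulf; case: (2 * h) => [|m] //=; rewrite size_map size_iota. Qed.

Lemma PT_powf h a i : PTn h -> PT a -> PTn i ->
  PT (fun env => powf (h env) (a env) (i env)).
Proof.
move=> Ph Pa Pi; apply: (@PT_iteri _ (fun env _ r => mulf (h env) (a env) r) i) => //.
- by apply: PT_mkseq; pt.
- by apply: PT_mulf; pt.
apply: (@leq_pbound _ _ _ (fun p => 2 * h p.2)) => [[[|j] env]|] /=.
- by rewrite size_mkseq.
- by rewrite size_mulf.
by apply: pboundM; [exact: pbound_const|apply: pbound_snd; apply: PTn_bound].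
Qed.

Lemma PT_shift_vec N h a b : PTn N -> PTn h -> PT a -> PT b ->
  PT (fun env => shift_vec (N env) (h env) (a env) (b env)).
Proof.
move=> *; apply: (@PT_mkseq (fun env i => dot (h env) (powf (h env) (a env) i.+1) (b env))).
  by pt.
by apply: PTb_dot; pt; apply: PT_powf; pt.
Qed.

Lemma PTb_read_at x v N : PT x -> PT v -> PTn N ->
  PTb (fun env => read_at (x env) (v env) (N env)).
Proof.
move=> *; apply: PTb_nth; pt.
apply: (@PTn_sum (fun env i => nth false (v env) i * minn (2 ^ i) (size (x env)))); pt.
Qed.

(* Powers of two are only computed below a polynomial bound. *)
Lemma PTn_exp2 h B : PTn h -> PTn B -> (forall env, 2 ^ h env <= B env) ->
  PTn (fun env => 2 ^ h env).
Proof.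
move=> Ph PB hB; apply: PTn_ext (PTn_expmin (PTn_const 2) Ph PB) => env.
exact/minn_idPl.
Qed.

Lemma PTb_base_bit N h B x v a c g : PTn N -> PTn h -> PTn B ->
  (forall env, 2 ^ h env <= B env) -> PT x -> PT v -> PT a -> PT c -> PT g ->
  PTb (fun env => base_bit (N env) (h env) (x env) (v env) (a env) (c env) (g env)).
Proof.
move=> PN Ph PB hB Px Pv Pa Pc Pg; have P2 := PTn_exp2 Ph PB hB.
apply: (@PTb_parity (fun env j =>
    read_at (x env) (xorv (N env) (v env)
       (shift_vec (N env) (h env) (a env) (bits (h env) j))) (N env) &&
     dot (2 * h env) (powf (h env) (c env) j) (g env)) (fun env => 2 ^ h env)) => //.
pt.
  apply: PTb_read_at; pt; apply: PT_xorv; pt; apply: PT_shift_vec; pt.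
  by apply: PT_bits; pt.
by apply: PTb_dot; pt; apply: PT_powf; pt.
Qed.

Lemma PT_vertex N h r i : PTn N -> PTn h -> PT r -> PTn i ->
  PT (fun env => vertex (N env) (h env) (r env) (i env)).
Proof.
move=> PN Ph Pr Pi; apply: (@PT_iteri _ (fun env j v => xorv (N env) v
   (shift_vec (N env) (h env) (subword (2 * h env) (N env + j * (7 * h env)) (r env))
      (subword (h env) (N env + j * (7 * h env) + 2 * h env) (r env)))) i) => //.
- by apply: PT_subword; pt.
- apply: PT_xorv; pt; apply: PT_shift_vec; pt; apply: PT_subword; pt.
apply: (@leq_pbound _ _ _ (fun p => N p.2)) => [[[|j] env]|] /=.
- by rewrite size_mkseq.
- by rewrite size_mkseq.
by apply: pbound_snd; apply: PTn_bound.
Qed.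

Lemma PTb_code_bit N h w B x r : PTn N -> PTn h -> PTn w -> PTn B ->
  (forall env, 2 ^ h env <= B env) -> PT x -> PT r ->
  PTb (fun env => code_bit (N env) (h env) (w env) (x env) (r env)).
Proof.
move=> PN Ph Pw PB hB Px Pr.
apply: (@PTb_parity (fun env i => base_bit (N env) (h env) (x env)
  (vertex (N env) (h env) (r env) i)
  (subword (2 * h env) (N env + i * (7 * h env)) (r env))
  (subword (2 * h env) (N env + i * (7 * h env) + 3 * h env) (r env))
  (subword (2 * h env) (N env + i * (7 * h env) + 5 * h env) (r env)))) => //.
apply: (@PTb_base_bit _ _ (fun env => B (behead env))); pt; try by (apply: PT_subword; pt).
- by move=> env; apply: hB.
- by apply: PT_vertex; pt.
Qed.

Lemma PTb_cell Q T s y : PTn Q -> PT T -> PTn s -> PTn y ->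
  PTb (fun env => cell (Q env) (T env) (s env) (y env)).
Proof. by move=> *; apply: PTb_nth; pt. Qed.

Lemma PTn_agreement t Q T i j p : PTn t -> PTn Q -> PT T -> PTn i -> PTn j -> PTn p ->
  PTn (fun env => agreement (t env) (Q env) (T env) (i env) (j env) (p env)).
Proof.
move=> Pt PQ PT' Pi Pj Pp.
apply: (@PTn_sum (fun env p' => \sum_(y < Q env)
  (cell (Q env) (T env) (i env * t env + p') y &&
   cell (Q env) (T env) (j env * t env + p') y))) => //.
apply: (@PTn_sum (fun env y =>
  nat_of_bool (cell (Q (behead env)) (T (behead env))
     (i (behead env) * t (behead env) + size (head [::] env)) y &&
   cell (Q (behead env)) (T (behead env))
     (j (behead env) * t (behead env) + size (head [::] env)) y))); pt;
  by apply: PTb_cell; pt.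
Qed.

Lemma PTn_weight B t Q T i p y : PTn B -> PTn t -> PTn Q -> PT T -> PTn i -> PTn p ->
  PTn y ->
  PTn (fun env => weight (B env) (t env) (Q env) (T env) (i env) (p env) (y env)).
Proof.
move=> *; apply: (@PTn_sum (fun env j =>
  cell (Q env) (T env) (j * t env + p env) (y env) *
  minn (2 ^ agreement (t env) (Q env) (T env) (i env) j (p env)) (B env))) => //.
pt; first by apply: PTb_cell; pt.
by apply: PTn_agreement; pt.
Qed.

Lemma PTn_letter B t Q T s : PTn B -> PTn t -> PTn Q -> PT T -> PTn s ->
  PTn (fun env => letter (B env) (t env) (Q env) (T env) (s env)).
Proof.
move=> *; apply: (@PTn_argmin (fun env y => weight (B env) (t env) (Q env) (T env)
  (s env %/ t env) (s env %% t env) y)) => //.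
by apply: PTn_weight; pt.
Qed.

Lemma PT_design B t Q M : PTn B -> PTn t -> PTn Q -> PTn M ->
  PT (fun env => design (B env) (t env) (Q env) (M env)).
Proof.
move=> PB Pt PQ PM; apply: (@PT_iteri (fun=> [::]) (fun env s T =>
  T ++ mkseq (fun y => y == letter (B env) (t env) (Q env) T s) (Q env))) => //.
- exact: PT_nil.
- pt; apply: PTn_letter; pt; first exact: (PT_wk1 PT_head).
  exact: (PT_wk2 PT_head).
apply: (@leq_pbound _ _ _ (fun p => p.1 * Q p.2)) => [[i env]|] /=.
  by elim: i => //= i IH; rewrite size_cat size_mkseq mulSn addnC leq_add2l.
by apply: pboundM; [exact: pbound_fst|apply: pbound_snd; apply: PTn_bound].
Qed.

Lemma PT_seed_select t Q T i u : PTn t -> PTn Q -> PT T -> PTn i -> PT u ->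
  PT (fun env => seed_select (t env) (Q env) (T env) (i env) (u env)).
Proof.
move=> *; apply: PT_mkseq => //.
apply: (@PTb_parity (fun env y => cell (Q (behead env)) (T (behead env))
   (i (behead env) * t (behead env) + size (head [::] env)) y &&
   nth false (u (behead env)) (size (head [::] env) * Q (behead env) + y))); pt.
by apply: PTb_cell; pt.
Qed.

Lemma ltn_bitlen i n : (i < bitlen n) = (2 ^ i <= n).
Proof.
case: n => [|n]; first by rewrite /bitlen big_ord0 ltn0 leqn0 expn_eq0.
have /andP[lo hi] := @trunc_log_bounds 2 n.+1 isT isT.
set k := trunc_log 2 n.+1 in lo hi.
have kn : k.+1 <= n.+1 by apply: leq_trans lo; apply: ltn_expl.
have E j : (2 ^ j <= n.+1) = (j < k.+1).
  apply/idP/idP => h; last by apply: leq_trans lo; rewrite leq_pexp2l.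
  by rewrite -(@ltn_exp2l 2) // (leq_ltn_trans h).
rewrite E /bitlen (eq_bigr (fun i : 'I_n.+1 => nat_of_bool (i < k.+1))) => [|j _].
  by rewrite sum_nat_leq.
by rewrite E.
Qed.

Lemma bitlen_gt n : n < 2 ^ bitlen n.
Proof. by rewrite ltnNge -ltn_bitlen ltnn. Qed.

Lemma bitlen_le n : 2 ^ bitlen n <= 2 * n + 1.
Proof.
case E: (bitlen n) => [|b]; first by lia.
have : 2 ^ b <= n by rewrite -ltn_bitlen E.
by rewrite expnS; lia.
Qed.

Lemma exp2_field_param A n : 2 ^ field_param A n <= 2 * (4 * bitlen n + 2) ^ (3 * A).
Proof.
set N := bitlen n; have [le _] := pow3_above_bounds (A * (bitlen N).+1).
apply: (@leq_trans (2 ^ (3 * (A * (bitlen N).+1) + 1))); first by rewrite leq_pexp2l.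
rewrite addn1 expnS leq_mul2l /= mulnA [_ * (bitlen N).+1]mulnC expnM.
by apply: leq_expr; rewrite expnS; have := bitlen_le N; lia.
Qed.

(** Every number that occurs is polynomially bounded; for 2^h this is [exp2_field_param], since h is
    of order log log n. *)
Lemma PT_extractor A C :
  PT (fun env => extractor A C (size (nth [::] env 0)) (size (nth [::] env 1))
                   (nth [::] env 2) (nth [::] env 3)).
Proof.
pose x (env : seq (seq bool)) := nth [::] env 2.
pose u (env : seq (seq bool)) := nth [::] env 3.
pose k (env : seq (seq bool)) := size (nth [::] env 0).
pose e (env : seq (seq bool)) := size (nth [::] env 1).
pose n (env : seq (seq bool)) := size (x env).
have Px : PT x by exact: PT_nth.
have Pu : PT u by exact: PT_nth.
have Pk : PTn k by apply: PT_size_nat; exact: PT_nth.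
have Pe : PTn e by apply: PT_size_nat; exact: PT_nth.
have Pn : PTn n by apply: PT_size_nat.
pose N env := bitlen (n env); have PN : PTn N by apply: PTn_bitlen.
pose h env := field_param A (n env).
have Ph : PTn h by apply: PTn_pow3_above; pt; apply: PTn_bitlen.
pose B env := 2 * (4 * N env + 2) ^ (3 * A).
have PB : PTn B by rewrite /B; pt; apply: PTn_exp; pt.
have hB env : 2 ^ h env <= B env by exact: exp2_field_param.
pose w env := walk_length A C (e env) (n env).
have Pw : PTn w by rewrite /w /walk_length; pt.
pose t env := index_length A C (e env) (n env).
have Pt : PTn t by rewrite /t /index_length; pt.
pose Q env := alphabet A C (e env) (n env).
have PQ : PTn Q by rewrite /Q /alphabet; pt.
pose m env := output_length (k env) (e env) (n env).
have Pm : PTn m.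
  rewrite /m /output_length; move: 10800 => c; pt.
  apply: (@PTn_exp2 _ (fun env => (n env).+1)); pt.
  move=> env; case E: (bitlen (n env)) => [|b] /=; first by rewrite div0n.
  apply: (@leq_trans (2 ^ b)); first by rewrite leq_pexp2l // leq_div.
  by apply: leqW; rewrite -ltn_bitlen E.
pose T env := design (n env) (t env) (Q env) (m env * t env).
have PT' : PT T by apply: PT_design; pt.
apply: (@PT_mkseq (fun env i => code_bit (N env) (h env) (w env) (x env)
  (seed_select (t env) (Q env) (T env) i (u env))) m) => //.
apply: (@PTb_code_bit _ _ _ (fun env => B (behead env))); pt.
- by move=> env; apply: hB.
- by apply: PT_seed_select; pt.
Qed.

Definition extractor_tuple A C (k e n : nat) (x : n.-tuple bool)
    (u : (seed_length A C e n).-tuple bool) : (output_length k e n).-tuple bool :=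
  [tuple code_bit (bitlen n) (field_param A n) (walk_length A C e n) x
     (seed_select (index_length A C e n) (alphabet A C e n)
       (design n (index_length A C e n) (alphabet A C e n)
          (output_length k e n * index_length A C e n)) i u)
    | i < output_length k e n].

Lemma extractor_tupleE A C k e n x u :
  tval (@extractor_tuple A C k e n x u) = extractor A C k e x u.
Proof.
rewrite /extractor size_tuple; apply: (@eq_from_nth _ false).
  by rewrite size_tuple size_mkseq.
move=> i; rewrite size_tuple => im; rewrite nth_mkseq //.
by rewrite -[i]/(nat_of_ord (Ordinal im)) -tnth_nth tnth_mktuple.
Qed.

Lemma explicit_extractor A C (k e : nat -> nat) :
  explicit k e (fun n x u => @extractor_tuple A C (k n) (e n) n x u).
Proof.
have [M [c cP]] := PT_machine (PT_extractor A C); exists M, c => n x u.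
have := cP [:: nseq (k n) true; nseq (e n) true; tval x; tval u] erefl.
by rewrite /= /esize /= !size_nseq !size_tuple addn0 !addnA extractor_tupleE.
Qed.

(** * The greedy weak design *)

Lemma argmin_le (W : nat -> nat) Q y : y < Q ->
  W (iteri Q (fun y r => if W y < W r then y else r) 0) <= W y.
Proof.
elim: Q => //= Q IH; rewrite ltnS leq_eqVlt => /predU1P[->|yQ]; case: ltnP => //.
by move=> lt; apply: leq_trans (ltnW lt) (IH yQ).
by move=> _; apply: IH.
Qed.

Lemma argmin_lt (W : nat -> nat) Q : 0 < Q ->
  iteri Q (fun y r => if W y < W r then y else r) 0 < Q.
Proof.
case: Q => // Q _; elim: Q => [|Q IH] /=; first by case: ifP.
by case: ifP => // _; apply: ltnW.
Qed.

Definition select (t Q : nat) (S : nat -> nat -> nat) (i : nat) (u : seq bool) :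
    seq bool :=
  mkseq (fun p => nth false u (p * Q + S i p)) t.

Definition agree_set (t : nat) (S : nat -> nat -> nat) (i j : nat) : {set 'I_t} :=
  [set p : 'I_t | S j p == S i p].

Section Design.

Variables (B t Q : nat).
Hypothesis Q0 : 0 < Q.

Definition entry (s : nat) : nat := letter B t Q (design B t Q s) s.

Definition word_letter (i p : nat) : nat := entry (i * t + p).

Lemma entry_lt s : entry s < Q.
Proof. exact: argmin_lt. Qed.

Lemma size_design M : size (design B t Q M) = M * Q.
Proof. by elim: M => //= M IH; rewrite size_cat -/(design B t Q M) IH size_mkseq mulSn addnC. Qed.

Lemma cell_design M s y : s < M -> y < Q -> cell Q (design B t Q M) s y = (y == entry s).
Proof.
move=> sM yQ; elim: M sM => // M IH; rewrite ltnS leq_eqVlt /cell /=.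
rewrite -/(design B t Q M) nth_cat size_design.
case/predU1P => [->|sM]; first by rewrite ltnNge leq_addr /= addKn nth_mkseq.
rewrite ifT; first exact: IH.
by apply: (@leq_trans (s.+1 * Q)); rewrite ?leq_mul2r ?sM ?orbT // mulSn addnC ltn_add2r.
Qed.

Lemma index_lt m i p : i < m -> p < t -> i * t + p < m * t.
Proof.
move=> im pt; apply: (@leq_trans (i.+1 * t)); last by rewrite leq_mul2r im orbT.
by rewrite mulSn addnC ltn_add2r.
Qed.

Lemma seed_select_design m i u : i < m ->
  seed_select t Q (design B t Q (m * t)) i u = select t Q word_letter i u.
Proof.
move=> im; apply: (@eq_from_nth _ false); rewrite !size_mkseq // => p pt.
rewrite !nth_mkseq //.
have lt := entry_lt (i * t + p); rewrite (bigD1 (Ordinal lt)) //= big1 => [|y].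
  by rewrite cell_design ?index_lt // eqxx /= addbF.
by rewrite -val_eqE /= => ne; rewrite cell_design ?index_lt // (negbTE ne).
Qed.

Definition common (i j p : nat) : nat := \sum_(q < p) (word_letter i q == word_letter j q).

Lemma agreement_design M i j p : i * t + p <= M -> j * t + p <= M ->
  agreement t Q (design B t Q M) i j p = common i j p.
Proof.
move=> iM jM; apply: eq_bigr => q _; have qp := ltn_ord q.
have lt := entry_lt (i * t + q); rewrite (bigD1 (Ordinal lt)) //= big1 => [|y].
  rewrite addn0 !cell_design ?eqxx //; lia.
rewrite -val_eqE /= => ne; rewrite cell_design //; last by lia.
by rewrite (negbTE ne).
Qed.

Lemma weight_design i p y : p < t -> y < Q ->
  weight B t Q (design B t Q (i * t + p)) i p y =
  \sum_(j < i) (word_letter j p == y) * minn (2 ^ common i j p) B.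
Proof.
move=> pt yQ; apply: eq_bigr => j _; have ji := ltn_ord j.
have lt : j * t + p < i * t + p by have := @index_lt i j 0 ji (leq_ltn_trans (leq0n p) pt); lia.
rewrite agreement_design ?leqnn //; last exact: ltnW.
by rewrite cell_design // eq_sym.
Qed.

Lemma card_agree_set i j : #|agree_set t word_letter i j| = common i j t.
Proof.
rewrite -sum1_card big_mkcond; apply: eq_bigr => p _.
by rewrite inE eq_sym; case: eqP.
Qed.

(* The greedy choice multiplies the total weight by at most 1 + 1 / Q. *)
Lemma weak_design i p : i * Q.+1 ^ t <= B * Q ^ t -> p <= t ->
  (\sum_(j < i) 2 ^ common i j p) * Q ^ p <= i * Q.+1 ^ p.
Proof.
move=> iB; elim: p => [|p IH] pt.
  rewrite !expn0 !muln1 (eq_bigr (fun=> 1)) ?sum_nat_const ?card_ord ?muln1 // => j _.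
  by rewrite /common big_ord0.
have {}IH := IH (ltnW pt); set tot := \sum_(j < i) _ in IH.
(* The potential never exceeds [B], so the cut-off in [weight] is inactive. *)
have totB : tot <= B.
  have Qt : 0 < Q ^ t by rewrite expn_gt0 Q0.
  rewrite -(leq_pmul2r Qt); apply: leq_trans iB.
  have E := subnKC (ltnW pt).
  rewrite -[in Q ^ t]E -[in Q.+1 ^ t]E !expnD !mulnA; apply: leq_mul => //.
  exact: leq_expr.
have minE (j : 'I_i) : minn (2 ^ common i j p) B = 2 ^ common i j p.
  by apply/minn_idPl; apply: leq_trans totB; rewrite /tot (bigD1 j) //= leq_addr.
pose w y := weight B t Q (design B t Q (i * t + p)) i p y.
have wE y : y < Q -> w y = \sum_(j < i) (word_letter j p == y) * 2 ^ common i j p.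
  by move=> yQ; rewrite /w weight_design //; apply: eq_bigr => j _; rewrite minE.
have t0 : 0 < t by apply: leq_ltn_trans pt.
have wmin y : y < Q -> w (word_letter i p) <= w y.
  rewrite /word_letter /entry /letter divnMDl // divn_small // addn0 modnMDl modn_small //.
  exact: argmin_le.
have sumw : \sum_(y < Q) w y = tot.
  under eq_bigr => y _ do rewrite wE //.
  rewrite exchange_big /=; apply: eq_bigr => j _.
  rewrite -big_distrl /= (bigD1 (Ordinal (entry_lt (j * t + p)))) //= eqxx big1 ?mul1n //.
  by move=> y; rewrite -val_eqE eq_sym /= => /negbTE ->.
(* The minimum over the [Q] letters is at most their average. *)
have Qw : Q * w (word_letter i p) <= tot.
  rewrite -sumw -[X in X * _]card_ord -sum_nat_const; apply: leq_sum => y _.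
  exact: wmin.
have -> : \sum_(j < i) 2 ^ common i j p.+1 = tot + w (word_letter i p).
  rewrite wE ?entry_lt // -big_split /=; apply: eq_bigr => j _.
  rewrite /common big_ord_recr /= expnD [_ == word_letter i p]eq_sym.
  by case: eqP => _; rewrite ?expn1 ?expn0; lia.
rewrite !expnS; have := leq_mul (leqnn Q.+1) IH; have := leq_mul Qw (leqnn (Q ^ p)).
by nia.
Qed.

End Design.

Import Order.TTheory GRing.Theory Num.Theory.
Local Open Scope ring_scope.

(** * Arithmetic in the binary fields *)

Lemma exp1D_second_order (x v : nat) : exists w, ((1 + x) ^ v = 1 + v * x + w * x ^ 2)%N.
Proof.
elim: v => [|v [w E]]; first by exists 0%N.
exists (w + v + w * x)%N; rewrite expnS E; ring.
Qed.

(** Cubing 1 + 3^(j+1) c gains exactly one factor 3. *)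
Lemma exp4_pow3 j : exists2 c, (4 ^ 3 ^ j = 1 + 3 ^ j.+1 * c)%N & ~~ (3 %| c)%N.
Proof.
elim: j => [|j [c E cn]]; first by exists 1%N.
exists (c + 3 * (3 ^ j * c ^ 2 + 3 ^ (2 * j) * c ^ 3))%N.
  rewrite (_ : 3 ^ (2 * j) = (3 ^ j) ^ 2)%N; last by rewrite mulnC expnM.
  rewrite [in LHS]expnSr expnM E !expnS; ring.
by rewrite dvdn_addl // dvdn_mulr.
Qed.

(** If u = 3^j v, then 4^u is 1 + v c 3^(j+1) modulo 3^(j+2) with c prime to 3, so that 3 divides
    v. *)
Lemma pow3_dvd_exp4_pred j u : (3 ^ j.+1 %| 4 ^ u - 1)%N -> (3 ^ j %| u)%N.
Proof.
elim: j u => [|j IH] u h; first exact: dvd1n.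
have /dvdnP[v Ev] : (3 ^ j %| u)%N.
  by apply: IH; apply: dvdn_trans h; rewrite [X in (_ %| X)%N]expnS dvdn_mull.
have [c Ec cn] := exp4_pow3 j.
have [w Ew] := exp1D_second_order (3 ^ j.+1 * c) v.
move: h; rewrite Ev mulnC expnM Ec Ew -addnA addKn.
have -> : (3 ^ j.+2 = 3 ^ j.+1 * 3)%N by rewrite expnSr.
rewrite (_ : (v * (3 ^ j.+1 * c) + _ = 3 ^ j.+1 * (v * c + 3 * (w * 3 ^ j * c ^ 2)))%N);
  last by rewrite !expnS; ring.
rewrite dvdn_pmul2l ?expn_gt0 // dvdn_addl; last exact: dvdn_mulr.
rewrite Euclid_dvdM // (negbTE cn) orbF.
by rewrite expnS => h; rewrite mulnC dvdn_mul.
Qed.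

(** That is, 2 is a primitive root modulo 3^(j+1). Odd exponents are excluded modulo 3, even ones
    reduce to powers of 4. *)
Lemma pow3_dvd_exp2_pred j r : (3 ^ j.+1 %| 2 ^ r - 1)%N -> (2 * 3 ^ j %| r)%N.
Proof.
move=> h; have r2 : ~~ odd r.
  apply/negP => ro; have : (3 %| 2 ^ r - 1)%N by apply: dvdn_trans h; rewrite expnS dvdn_mulr.
  rewrite -(odd_double_half r) ro add1n expnS -mul2n expnM.
  have [w Ew] := exp1D_second_order 3 r./2; rewrite (_ : 2 ^ 2 = 1 + 3)%N // Ew.
  rewrite (_ : (2 * _ - 1 = 1 + 3 * (2 * (r./2 + w * 3)))%N); last by lia.
  by rewrite dvdn_addl // dvdn_mulr.
move: h; rewrite -(even_halfK r2) -mul2n expnM => /(@pow3_dvd_exp4_pred j) h.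
by rewrite dvdn_pmul2l.
Qed.

Section BinaryField.

Variables (K : finFieldType) (j : nat) (theta : K).
Let h := (3 ^ j)%N.
Hypotheses (K2 : 2%N \in [pchar K]) (theta_prim : (3 ^ j.+1)%N.-primitive_root theta).

Let h0 : (0 < h)%N. Proof. by rewrite expn_gt0. Qed.

Definition felt (a : nat -> bool) : K := \sum_(i < 2 * h) (a i)%:R * theta ^+ i.

Lemma natr_addb (a b : bool) : (a (+) b)%:R = a%:R + b%:R :> K.
Proof. by case: a b => [] []; rewrite ?addr0 ?add0r // (addrr_pchar2 K2). Qed.

Lemma natr_andb (a b : bool) : (a && b)%:R = a%:R * b%:R :> K.
Proof. by case: a; rewrite ?mul1r ?mul0r. Qed.

Lemma natr_parity I (r : seq I) (F : I -> bool) :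
  (\big[addb/false]_(i <- r) F i)%:R = \sum_(i <- r) (F i)%:R :> K.
Proof. exact: (big_morph (fun b : bool => b%:R : K) natr_addb (erefl _)). Qed.

(** theta^h is a cube root of unity other than 1, hence a root of Y^2 + Y + 1. *)
Lemma theta_relation : theta ^+ (2 * h) = theta ^+ h + 1.
Proof.
have t3 : theta ^+ h ^+ 3 = 1.
  by rewrite -exprM mulnC -expnS (prim_expr_order theta_prim).
have t1 : theta ^+ h != 1.
  rewrite -(expr0 theta) (eq_prim_root_expr theta_prim) mod0n modn_small.
    by rewrite -lt0n.
  by rewrite expnS ltn_Pmull.
have : (theta ^+ h - 1) * (theta ^+ (2 * h) + theta ^+ h + 1) = 0.
  rewrite [(2 * h)%N]mulnC exprM (_ : _ * _ = theta ^+ h ^+ 3 - 1); last by ring.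
  by rewrite t3 subrr.
move/eqP; rewrite mulf_eq0 subr_eq0 (negbTE t1) /= -addrA addr_eq0 => /eqP ->.
by rewrite (oppr_pchar2 K2).
Qed.

Lemma felt_mulX a : felt (nth false (mulX h a)) = theta * felt (nth false a).
Proof.
pose m := (2 * h).-1.
have mE : (m.+1 = 2 * h)%N by rewrite prednK // muln_gt0.
rewrite /felt -!mE.
transitivity (\sum_(i < m.+1) (((0 < i)%N && nth false a i.-1)%:R * theta ^+ i +
    (((i == 0 :> nat) || (i == h :> nat)) && nth false a m)%:R * theta ^+ i)).
  by apply: eq_bigr => i _; rewrite /mulX nth_mkseq ?natr_addb ?mulrDl // -mE.
rewrite [in RHS]big_ord_recr /= mulrDr mulr_sumr [theta * (_ * theta ^+ m)]mulrCA -exprS.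
rewrite [theta ^+ m.+1](_ : _ = theta ^+ h + 1); last by rewrite mE theta_relation.
rewrite big_split /=; congr (_ + _).
  rewrite big_ord_recl /= !mul0r add0r; apply: eq_bigr => i _ /=.
  by rewrite /bump /= exprS mulrCA.
transitivity (\sum_(i < m.+1) (nth false a m)%:R *
    (((i == 0 :> nat) || (i == h :> nat))%:R * theta ^+ i)).
  by apply: eq_bigr => i _; rewrite natr_andb mulrAC mulrC.
have h1 : (h < m.+1)%N by rewrite mE; lia.
have h0' : (0 < m.+1)%N by [].
rewrite -mulr_sumr; congr (_ * _).
rewrite (bigD1 (Ordinal h0')) //= (bigD1 (Ordinal h1)) /=; last first.
  by rewrite -val_eqE /= -lt0n.
rewrite eqxx orbT !mul1r expr0 big1 ?addr0 1?addrC // => i /andP[].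
by rewrite -!val_eqE /= => /negbTE -> /negbTE ->; rewrite mul0r.
Qed.

Lemma felt_mulf a b :
  felt (nth false (mulf h a b)) = felt (nth false a) * felt (nth false b).
Proof.
(* The value of the [n] top coefficients of [a], which are those consumed after [n] rounds. *)
pose part n := \sum_(i < n) (nth false a (2 * h - n + i))%:R * theta ^+ i.
rewrite /mulf; set st := fun i r => _.
have E n : (n <= 2 * h)%N ->
    felt (nth false (iteri n st (nseq (2 * h) false))) = part n * felt (nth false b).
  elim: n => [|n IH] nh.
    rewrite /part big_ord0 mul0r /felt big1 // => i _ /=.
    by rewrite nth_nseq ltn_ord mul0r.
  rewrite /= {1}/st.
  have -> : felt (nth false (mkseq (fun l => nth false (mulX h (iteri n st
        (nseq (2 * h) false))) l (+) nth false a (2 * h - n.+1) && nth false b l)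
        (2 * h))) = theta * (part n * felt (nth false b)) +
        (nth false a (2 * h - n.+1))%:R * felt (nth false b).
    rewrite -(IH (ltnW nh)) -felt_mulX /felt mulr_sumr -big_split /=.
    apply: eq_bigr => i _; rewrite nth_mkseq // natr_addb natr_andb; ring.
  rewrite mulrA -mulrDl; congr (_ * _).
  rewrite /part big_ord_recl /= expr0 mulr1 addn0 addrC; congr (_ + _).
  rewrite mulr_sumr; apply: eq_bigr => i _; rewrite /bump /= exprS mulrCA.
  by congr ((nth false a _)%:R * _); lia.
rewrite E // /part; congr (_ * _); apply: eq_bigr => i _.
by rewrite subnn add0n.
Qed.

Lemma felt_powf a i : felt (nth false (powf h a i)) = felt (nth false a) ^+ i.
Proof.
elim: i => [|i IH]; last by rewrite /powf /= felt_mulf -/(powf h a i) IH exprS.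
have h2 : (0 < 2 * h)%N by rewrite muln_gt0.
rewrite /felt (bigD1 (Ordinal h2)) //= nth_mkseq // mul1r big1 ?addr0 // => l.
rewrite -val_eqE /= => l0; by rewrite nth_mkseq // (negbTE l0) mul0r.
Qed.

(** The difference is a polynomial of degree below 2h over the prime field. If it vanishes at theta,
    it vanishes at the conjugates theta^(2^n), and those with n < 2h are distinct by
    [pow3_dvd_exp2_pred]: too many roots. *)
Lemma felt_inj (a b : nat -> bool) : felt a = felt b ->
  forall i, (i < 2 * h)%N -> a i = b i.
Proof.
move=> E i0 i0h; apply/eqP; apply/negPn/negP => ab.
pose c i := a i (+) b i.
pose p := \poly_(i < 2 * h) (c i)%:R : {poly K}.
have pE x : p.[x] = \sum_(i < 2 * h) (c i)%:R * x ^+ i.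
  by rewrite horner_poly.
have p0 : p != 0.
  apply/eqP => /polyP /(_ i0); rewrite coef_poly i0h coef0 /c.
  by move: ab; case: (a i0) (b i0) => [] [] //= _ /eqP; rewrite oner_eq0.
have pt : root p theta.
  rewrite rootE pE; under eq_bigr => i _ do rewrite natr_addb mulrDl.
  by rewrite big_split /= -/(felt a) -/(felt b) E addrr_pchar2.
have psq x : p.[x ^+ 2] = p.[x] ^+ 2.
  rewrite !pE -[X in _ = X](pFrobenius_autE K2) raddf_sum; apply: eq_bigr => i _ /=.
  rewrite pFrobenius_autE [in RHS]exprMn -[in RHS]exprM [(i * 2)%N]mulnC exprM; congr (_ * _).
  by case: (c i); rewrite ?expr1n ?expr0n.
have rts n : root p (theta ^+ (2 ^ n)%N).
  elim: n => [|n IH]; first by rewrite expn0 expr1.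
  by rewrite rootE expnSr exprM psq (eqP IH) expr0n.
have un : uniq [seq theta ^+ (2 ^ n)%N | n <- iota 0 (2 * h)].
  rewrite map_inj_in_uniq ?iota_uniq // => x y.
  rewrite !mem_iota !add0n /= => xh yh.
  wlog xy : x y xh yh / (x <= y)%N.
    by move=> W; case: (leqP x y) => [|/ltnW] l e; [|symmetry]; apply: W.
  move=> /eqP; rewrite (eq_prim_root_expr theta_prim) eq_sym => e.
  have : (3 ^ j.+1 %| 2 ^ y - 2 ^ x)%N by rewrite -eqn_mod_dvd // leq_pexp2l.
  rewrite -(subnKC xy) expnD -{2}[(2 ^ x)%N]muln1 -mulnBr Gauss_dvdr; last first.
    by rewrite coprimeXl // coprimeXr.
  move/pow3_dvd_exp2_pred; case: (posnP (y - x)) => [z _|z /(dvdn_leq z)].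
    by lia.
  by rewrite -/h; lia.
have := max_poly_roots p0 _ un; rewrite size_map size_iota ltnNge => ne.
suff : false by []; rewrite -(negbTE (ne _)) ?size_poly //.
by apply/allP => _ /mapP[n _ ->]; apply: rts.
Qed.

Lemma card_tuple_roots (p : {poly K}) (S : {set (2 * h).-tuple bool}) : p != 0 ->
  (forall a : (2 * h).-tuple bool, a \in S -> root p (felt (nth false a))) ->
  (#|S| < size p)%N.
Proof.
move=> p0 Sp; rewrite cardE -(size_map (fun a : _.-tuple _ => felt (nth false a))).
apply: max_poly_roots => //.
  by apply/allP => y /mapP[a]; rewrite mem_enum => aS ->; apply: Sp.
rewrite map_inj_uniq ?enum_uniq // => a b /felt_inj ab.
by apply: eq_from_tnth => i; rewrite !(tnth_nth false) ab.
Qed.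

Lemma felt_parity N (F : 'I_N -> nat -> bool) :
  felt (fun l => \big[addb/false]_(i < N) F i l) = \sum_(i < N) felt (F i).
Proof.
rewrite /felt exchange_big /=; apply: eq_bigr => l _.
by rewrite natr_parity mulr_suml.
Qed.

Lemma felt_scale (c : bool) (a : nat -> bool) :
  felt (fun l => c && a l) = c%:R * felt a.
Proof. by rewrite /felt mulr_sumr; apply: eq_bigr => l _; rewrite natr_andb mulrA. Qed.

Lemma eq_felt a b : (forall l, (l < 2 * h)%N -> a l = b l) -> felt a = felt b.
Proof. by move=> ab; apply: eq_bigr => l _; rewrite ab. Qed.

(** Starting the powers at 1 keeps the constant term for the target [y], so that the polynomial is
    nonzero whatever [y] is. *)
Lemma roots_shifted N (c y : nat -> bool) i0 : (i0 < N)%N -> c i0 ->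
  (#|[set a : (2 * h).-tuple bool | [forall l : 'I_(2 * h),
     \big[addb/false]_(i < N) (c i && nth false (powf h a i.+1) l) == y l]]| <= N)%N.
Proof.
move=> iN ci; pose p := \sum_(i < N) (c i)%:R *: 'X^(i.+1) - (felt y)%:P : {poly K}.
have cp i : p`_i.+1 = (if (i < N)%N then (c i)%:R else 0).
  rewrite coefB coefC subr0 coef_sum; under eq_bigr => l _ do rewrite coefZ coefXn.
  case: ifP => iN'.
    rewrite (bigD1 (Ordinal iN')) //= eqxx mulr1 big1 ?addr0 // => l.
    by rewrite -val_eqE /= eqSS eq_sym => /negbTE ->; rewrite mulr0.
  rewrite big1 // => l _; rewrite eqSS; case: eqP => [E|]; rewrite ?mulr0 //.
  by have := ltn_ord l; rewrite -E iN'.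
have p0 : p != 0.
  by apply/eqP => /polyP /(_ i0.+1); rewrite cp iN ci coef0 => /eqP; rewrite oner_eq0.
have sp : (size p <= N.+1)%N.
  by apply/leq_sizeP => -[|l] //; rewrite ltnS => Nl; rewrite cp ltnNge Nl.
rewrite -ltnS; apply: leq_trans sp; apply: card_tuple_roots p0 _ => a.
rewrite inE => /forallP ya; rewrite rootE hornerD hornerN hornerC subr_eq0.
rewrite horner_sum; apply/eqP.
rewrite -(@eq_felt (fun l => \big[addb/false]_(i < N) (c i && nth false (powf h a i.+1) l)) y).
  rewrite (felt_parity (fun i l => c i && nth false (powf h a i.+1) l)).
  by apply: eq_bigr => i _; rewrite felt_scale felt_powf hornerZ hornerXn.
by move=> l lh; have /eqP := ya (Ordinal lh).
Qed.

Lemma roots_unshifted N (c : nat -> bool) i0 : (i0 < N)%N -> c i0 ->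
  (#|[set a : (2 * h).-tuple bool | [forall l : 'I_(2 * h),
     \big[addb/false]_(i < N) (c i && nth false (powf h a i) l) == false]]| <= N)%N.
Proof.
move=> iN ci; pose p := \poly_(i < N) (c i)%:R : {poly K}.
have p0 : p != 0.
  by apply/eqP => /polyP /(_ i0); rewrite coef_poly iN ci coef0 => /eqP; rewrite oner_eq0.
apply: leq_trans (ltnW (card_tuple_roots p0 _)) (size_poly _ _) => a.
rewrite inE => /forallP ya; rewrite rootE horner_poly; apply/eqP.
transitivity (felt (fun=> false)); last by rewrite /felt big1 // => l _; rewrite mul0r.
rewrite -(@eq_felt (fun l => \big[addb/false]_(i < N) (c i && nth false (powf h a i) l)) (fun=> false)).
  rewrite (felt_parity (fun i l => c i && nth false (powf h a i) l)).
  by apply: eq_bigr => i _; rewrite felt_scale felt_powf.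
by move=> l lh; have /eqP := ya (Ordinal lh).
Qed.

End BinaryField.

(** In the field with 4^(3^j) elements, 3^(j+1) divides the order of the cyclic multiplicative
    group. *)
Lemma exists_binary_field j : exists (K : finFieldType) (theta : K),
  2%N \in [pchar K] /\ (3 ^ j.+1)%N.-primitive_root theta.
Proof.
have h0 : (0 < 2 * 3 ^ j)%N by rewrite muln_gt0 expn_gt0.
have [K K2 Kc] := pPrimePowerField (isT : prime 2) h0.
pose rs := [seq x <- enum K | x != 0].
have q1 : (1 < 2 ^ (2 * 3 ^ j))%N by rewrite -{1}(expn0 2) ltn_exp2l.
have srs : size rs = #|K|.-1.
  rewrite size_filter -(cardC1 (0 : K)) cardE /enum_mem size_filter.
  by rewrite count_filter; apply: eq_count => x; rewrite !inE /= andbT.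
have := @has_prim_root K #|K|.-1 rs.
rewrite srs leqnn Kc -ltnS prednK ?q1; last by apply: ltnW.
case/(_ isT _ _ isT)/hasP; last move=> z _ zp.
- apply/allP => x; rewrite mem_filter => /andP[x0 _].
  rewrite unity_rootE -Kc -(inj_eq (mulfI x0)) -exprS prednK ?expf_card ?mulr1 //.
  by rewrite Kc ltnW.
- by rewrite filter_uniq ?enum_uniq.
have d : (3 ^ j.+1 %| (2 ^ (2 * 3 ^ j)).-1)%N.
  have [c E _] := exp4_pow3 j.
  by rewrite expnM -subn1 E addKn dvdn_mulr.
exists K, (z ^+ ((2 ^ (2 * 3 ^ j)).-1 %/ 3 ^ j.+1)); split=> //.
exact: (dvdn_prim_root zp d).
Qed.

Lemma card_shifted_roots j N (c y : nat -> bool) i0 : (i0 < N)%N -> c i0 ->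
  (#|[set a : (2 * 3 ^ j).-tuple bool | [forall l : 'I_(2 * 3 ^ j),
     \big[addb/false]_(i < N) (c i && nth false (powf (3 ^ j) a i.+1) l) == y l]]| <= N)%N.
Proof.
have [K [theta [K2 th]]] := exists_binary_field j; exact: (roots_shifted K2 th).
Qed.

Lemma card_unshifted_roots j N (c : nat -> bool) i0 : (i0 < N)%N -> c i0 ->
  (#|[set a : (2 * 3 ^ j).-tuple bool | [forall l : 'I_(2 * 3 ^ j),
     \big[addb/false]_(i < N) (c i && nth false (powf (3 ^ j) a i) l) == false]]| <= N)%N.
Proof.
have [K [theta [K2 th]]] := exists_binary_field j; exact: (roots_unshifted K2 th).
Qed.

(** * Averages, characters and random walks *)

Section Averages.

Variable R : realFieldType.
Implicit Types (f g : seq bool -> R) (n : nat).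

(** Functions of words, rather than of tuples, let strings of different lengths be concatenated
    freely. *)
Definition tsum n f : R := \sum_(r : n.-tuple bool) f r.

Definition tavg n f : R := tsum n f / 2 ^+ n.

Lemma pow2_gt0 n : 0 < 2 ^+ n :> R. Proof. exact: exprn_gt0. Qed.

Lemma pow2_neq0 n : 2 ^+ n != 0 :> R. Proof. by rewrite gt_eqF ?pow2_gt0. Qed.

Lemma eq_tsum n f g : (forall r, size r = n -> f r = g r) -> tsum n f = tsum n g.
Proof. by move=> fg; apply: eq_bigr => r _; rewrite fg ?size_tuple. Qed.

Lemma eq_tavg n f g : (forall r, size r = n -> f r = g r) -> tavg n f = tavg n g.
Proof. by move=> fg; rewrite /tavg (eq_tsum fg). Qed.

Lemma ler_tavg n f g : (forall r, size r = n -> f r <= g r) -> tavg n f <= tavg n g.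
Proof.
move=> fg; rewrite ler_pM2r ?invr_gt0 ?pow2_gt0 //.
by apply: ler_sum => r _; rewrite fg ?size_tuple.
Qed.

Lemma tavg_cst n (a : R) : tavg n (fun=> a) = a.
Proof.
rewrite /tavg /tsum sumr_const card_tuple card_bool -[a *+ _]mulr_natr natrX mulfK //.
Qed.

Lemma tavgD n f g : tavg n (fun r => f r + g r) = tavg n f + tavg n g.
Proof. by rewrite /tavg /tsum big_split mulrDl. Qed.

Lemma tavgB n f g : tavg n (fun r => f r - g r) = tavg n f - tavg n g.
Proof. by rewrite /tavg /tsum sumrB mulrBl. Qed.

Lemma tavgZ n a f : tavg n (fun r => a * f r) = a * tavg n f.
Proof. by rewrite /tavg /tsum -mulr_sumr mulrA. Qed.

Lemma tavgZr n a f : tavg n (fun r => f r * a) = tavg n f * a.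
Proof. by rewrite /tavg /tsum -mulr_suml mulrAC. Qed.

Lemma tavg_ge0 n f : (forall r, size r = n -> 0 <= f r) -> 0 <= tavg n f.
Proof. by move=> f0; rewrite -(tavg_cst n 0); apply: ler_tavg. Qed.

Lemma tavg_exchange n m (f : seq bool -> seq bool -> R) :
  tavg n (fun r => tavg m (f r)) = tavg m (fun s => tavg n (fun r => f r s)).
Proof.
rewrite /tavg /tsum -!mulr_suml exchange_big /=; ring.
Qed.

Lemma tsum_exchange_avg n m (f : seq bool -> seq bool -> R) :
  tsum n (fun r => tavg m (f r)) = tavg m (fun s => tsum n (fun r => f r s)).
Proof. by rewrite /tavg /tsum -mulr_suml exchange_big. Qed.

Lemma tavg_cat n m f :
  tavg (n + m) f = tavg n (fun r => tavg m (fun s => f (r ++ s))).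
Proof.
rewrite /tavg /tsum -mulr_suml -mulrA -invfM -exprD [(m + n)%N]addnC; congr (_ / _).
rewrite pair_big /=.
pose join (p : n.-tuple bool * m.-tuple bool) := cat_tuple p.1 p.2.
rewrite (reindex join) //=; apply: onW_bij.
apply: inj_card_bij => [[r s] [r' s'] /(congr1 val) /= /eqP|].
  by rewrite eqseq_cat ?size_tuple // => /andP[/eqP/val_inj-> /eqP/val_inj->].
by rewrite card_prod !card_tuple expnD.
Qed.

Lemma sqr_tavg_le n f : tavg n f ^+ 2 <= tavg n (fun r => f r ^+ 2).
Proof.
set m := tavg n f.
have : 0 <= tavg n (fun r => (f r - m) ^+ 2) by apply: tavg_ge0 => r _; exact: sqr_ge0.
have -> : tavg n (fun r => (f r - m) ^+ 2) =
    tavg n (fun r => f r ^+ 2 - (2 * m) * f r + m ^+ 2).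
  by apply: eq_tavg => r _; ring.
by rewrite tavgD tavgB tavgZ tavg_cst -/m; nra.
Qed.

Definition sgn (b : bool) : R := (-1) ^+ b.

Lemma sgn_addb a b : sgn (a (+) b) = sgn a * sgn b.
Proof. exact: signr_addb. Qed.

Lemma sgn_sqr b : sgn b * sgn b = 1.
Proof. by rewrite -sgn_addb addbb. Qed.

Lemma size_xorv l a b : size (xorv l a b) = l.
Proof. by rewrite size_mkseq. Qed.

Lemma nth_xorv l a b i : (i < l)%N ->
  nth false (xorv l a b) i = nth false a i (+) nth false b i.
Proof. by move=> il; rewrite nth_mkseq. Qed.

Lemma xorvK l a b : size a = l -> xorv l (xorv l a b) b = a.
Proof.
move=> sa; apply: (@eq_from_nth _ false); rewrite size_xorv // => i il.
by rewrite !nth_xorv // -addbA addbb addbF.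
Qed.

Lemma dot_xorv l c a b : dot l c (xorv l a b) = dot l c a (+) dot l c b.
Proof.
rewrite /dot -big_split; apply: eq_bigr => i _ /=.
by rewrite nth_xorv // andb_addr.
Qed.

Lemma dotC l a b : dot l a b = dot l b a.
Proof. by apply: eq_bigr => i _; rewrite andbC. Qed.

Lemma tsum_xorv n w f : tsum n (fun v => f (xorv n v w)) = tsum n f.
Proof.
have P (v : n.-tuple bool) : size (xorv n v w) == n by rewrite size_xorv.
pose T v := Tuple (P v).
rewrite [RHS](reindex T) //; exists T => v _; apply: val_inj; exact: xorvK (size_tuple _).
Qed.

Lemma tavg_xorv n w f : tavg n (fun v => f (xorv n v w)) = tavg n f.
Proof. by rewrite /tavg tsum_xorv. Qed.

(** Translation by a unit vector e with <e, w> = 1 preserves the sum and changes its sign. *)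
Lemma tsum_sgn_dot n w i0 : (i0 < n)%N -> nth false w i0 ->
  tsum n (fun c => sgn (dot n c w)) = 0.
Proof.
move=> i0n wi; pose e := mkseq (fun i => i == i0) n.
have ew : dot n e w.
  rewrite /dot (bigD1 (Ordinal i0n)) //= nth_mkseq // eqxx wi big1 // => i.
  by rewrite -val_eqE /= => /negbTE ne; rewrite nth_mkseq // ne.
have : tsum n (fun c => sgn (dot n c w)) = - tsum n (fun c => sgn (dot n c w)).
  rewrite -[LHS](tsum_xorv n e) -[RHS]mulN1r /tsum mulr_sumr; apply: eq_bigr => c _.
  by rewrite dotC dot_xorv sgn_addb [dot n w e]dotC ew mulrC [dot n w c]dotC.
by move=> h; lra.
Qed.

Lemma tavg_sgn_dot n w :
  tavg n (fun c => sgn (dot n c w)) = [forall i : 'I_n, ~~ nth false w i]%:R.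
Proof.
case: (boolP [forall i, _]) => [/forallP w0|].
  rewrite -[RHS](tavg_cst n); apply: eq_tavg => c _.
  by rewrite /dot big1 // => i _; rewrite (negbTE (w0 i)) andbF.
rewrite negb_forall => /existsP[i]; rewrite negbK => wi.
by rewrite /tavg (tsum_sgn_dot (ltn_ord i) wi) mul0r.
Qed.

Lemma parseval n f :
  tsum n (fun c => tavg n (fun v => f v * sgn (dot n c v)) ^+ 2) =
  tavg n (fun v => f v ^+ 2).
Proof.
transitivity (tsum n (fun c => tavg n (fun v => tavg n (fun v' =>
    f v * f v' * sgn (dot n c (xorv n v v')))))).
  apply: eq_tsum => c _; rewrite expr2 -tavgZr; apply: eq_tavg => v _.
  rewrite -tavgZ; apply: eq_tavg => v' _; rewrite dot_xorv sgn_addb; ring.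
rewrite tsum_exchange_avg; apply: eq_tavg => v sv.
rewrite tsum_exchange_avg.
transitivity (tavg n (fun v' => f v ^+ 2 * (2 ^+ n * (v' == v)%:R))).
  apply: eq_tavg => v' sv'; rewrite /tsum -mulr_sumr -[\sum_r _]/(tsum n (fun c => sgn (dot n c (xorv n v v')))).
  have [->|ne] := eqVneq v' v.
    rewrite mulr1 -expr2; congr (_ * _).
    transitivity (2 ^+ n * tavg n (fun=> 1)); last by rewrite tavg_cst mulr1.
    rewrite /tavg mulrC divfK ?pow2_neq0 //.
    by apply: eq_tsum => c _; rewrite dot_xorv addbb.
  rewrite !mulr0; have [i iv ni] : exists2 i, (i < n)%N & nth false (xorv n v v') i.
    apply/not_exists2P => h; case/eqP: ne.
    apply: (@eq_from_nth _ false); rewrite ?sv ?sv' // => i iv.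
    by have [//|/negP] := h i; rewrite nth_xorv // -negb_eqb negbK => /eqP.
  by rewrite (tsum_sgn_dot iv ni) mulr0.
rewrite tavgZ -[RHS]mulr1; congr (_ * _).
have pv : size v == n by rewrite sv.
rewrite /tavg /tsum (bigD1 (Tuple pv)) //= eqxx big1 ?addr0 ?mulr1 ?divff ?pow2_neq0 //.
by move=> c; rewrite -val_eqE /= => /negbTE ->; rewrite mulr0.
Qed.

(** * Averaging over the cosets of a small-bias family *)

Section Spectral.

Variables (N na nb : nat) (g : seq bool -> seq bool -> seq bool) (lam : R).

Definition coset_avg a f (v : seq bool) : R := tavg nb (fun b => f (xorv N v (g a b))).

Hypothesis lam_ge0 : 0 <= lam.

Hypothesis g_bias : forall c i, (i < N)%N -> nth false c i ->
  tavg na (fun a => tavg nb (fun b => sgn (dot N c (g a b))) ^+ 2) <= lam.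

(** The coset average is a convolution: it multiplies the Fourier coefficient at [c] by the bias of
    [g a] at [c]. The coefficient at 0, where the bias is 1, vanishes with the mean. *)
Lemma coset_avg_contracts f : tavg N f = 0 ->
  tavg na (fun a => tavg N (fun v => coset_avg a f v ^+ 2)) <=
  lam * tavg N (fun v => f v ^+ 2).
Proof.
move=> f0; pose fh c := tavg N (fun v => f v * sgn (dot N c v)).
pose gh a c := tavg nb (fun b => sgn (dot N c (g a b))).
have E a : tavg N (fun v => coset_avg a f v ^+ 2) = tsum N (fun c => fh c ^+ 2 * gh a c ^+ 2).
  rewrite -parseval; apply: eq_tsum => c _; rewrite -exprMn; congr (_ ^+ 2).
  transitivity (tavg N (fun v => tavg nb (fun b => f (xorv N v (g a b)) * sgn (dot N c v)))).
    by apply: eq_tavg => v _; rewrite /coset_avg tavgZr.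
  rewrite tavg_exchange /gh -tavgZ; apply: eq_tavg => b _.
  rewrite -tavgZr -[RHS](tavg_xorv N (g a b)); apply: eq_tavg => v sv.
  by rewrite dot_xorv sgn_addb -!mulrA sgn_sqr mulr1.
rewrite (eq_tavg (g := fun a => tsum N (fun c => fh c ^+ 2 * gh a c ^+ 2))) //.
rewrite -tsum_exchange_avg -parseval -/fh /tsum mulr_sumr; apply: ler_sum => c _.
rewrite -[tavg N (fun v => f v * _)]/(fh c) tavgZ mulrC; have [z|] := boolP [forall i : 'I_N, ~~ nth false c i].
  have -> : fh c = 0; last by rewrite expr0n /= !mulr0.
  rewrite -[RHS]f0; apply: eq_tavg => v _.
  by rewrite /dot big1 ?mulr1 // => i _; rewrite (negbTE (forallP z i)).
rewrite negb_forall => /existsP[i]; rewrite negbK => ci.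
by apply: ler_wpM2r; [exact: sqr_ge0|exact: g_bias ci].
Qed.

Section Step.

Variables (F : seq bool -> seq bool -> R) (sig : R).

Hypotheses (F_bound : tavg na (fun a => tavg N (fun v => F v a ^+ 2)) <= sig)
  (F_le1 : forall v a, `|F v a| <= 1).

Definition walk_step f (v : seq bool) : R := tavg na (fun a => F v a * coset_avg a f v).

(** Split [f] into its mean, for which [F_bound] is used, and the rest, which the coset average
    contracts by [lam]. The factor 2 is that of (x + y)^2 <= 2x^2 + 2y^2. *)
Lemma walk_step_contracts f :
  tavg N (fun v => walk_step f v ^+ 2) <=
  2 * (sig + lam) * tavg N (fun v => f v ^+ 2).
Proof.
pose m := tavg N f; pose u v := f v - m.
have u0 : tavg N u = 0 by rewrite tavgB tavg_cst subrr.
have cE a v : coset_avg a f v = m + coset_avg a u v.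
  by rewrite /coset_avg tavgB tavg_cst addrCA subrr addr0.
have fE : tavg N (fun v => f v ^+ 2) = m ^+ 2 + tavg N (fun v => u v ^+ 2).
  transitivity (tavg N (fun v => m ^+ 2 + (2 * m) * u v + u v ^+ 2)).
    by apply: eq_tavg => v _; rewrite /u; ring.
  by rewrite !tavgD tavgZ u0 tavg_cst mulr0 addr0.
have u2 : 0 <= tavg N (fun v => u v ^+ 2) by apply: tavg_ge0 => v _; exact: sqr_ge0.
have sq v : walk_step f v ^+ 2 <=
    tavg na (fun a => 2 * m ^+ 2 * F v a ^+ 2 + 2 * coset_avg a u v ^+ 2).
  apply: le_trans (sqr_tavg_le _ _) _; apply: ler_tavg => a _.
  rewrite cE; set x := F v a; set y := coset_avg a u v.
  have x1 : x ^+ 2 <= 1 by rewrite -real_normK ?num_real // expr_le1 ?F_le1.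
  have : 0 <= (m * x - x * y) ^+ 2 by exact: sqr_ge0.
  by have : 0 <= y ^+ 2 by [exact: sqr_ge0]; nra.
have step : tavg N (fun v => walk_step f v ^+ 2) <=
    2 * m ^+ 2 * tavg na (fun a => tavg N (fun v => F v a ^+ 2)) +
    2 * tavg na (fun a => tavg N (fun v => coset_avg a u v ^+ 2)).
  apply: le_trans (ler_tavg (fun v _ => sq v)) _.
  rewrite tavg_exchange -!tavgZ -tavgD; apply: ler_tavg => a _.
  by rewrite -!tavgZ -tavgD.
have m2 : 0 <= m ^+ 2 by exact: sqr_ge0.
have cu := coset_avg_contracts u0; rewrite fE; apply: le_trans step _.
have sig0 : 0 <= sig.
  apply: le_trans F_bound; apply: tavg_ge0 => a _; apply: tavg_ge0 => v _; exact: sqr_ge0.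
have h1 := mulr_ge0 lam_ge0 m2; have h2 := mulr_ge0 sig0 u2.
have h3 := ler_wpM2l m2 F_bound; lra.
Qed.

Lemma walk_contracts w f :
  tavg N (fun v => iter w walk_step f v ^+ 2) <=
  (2 * (sig + lam)) ^+ w * tavg N (fun v => f v ^+ 2).
Proof.
have sig0 : 0 <= sig.
  apply: le_trans F_bound; apply: tavg_ge0 => a _; apply: tavg_ge0 => v _; exact: sqr_ge0.
elim: w => [|w IH]; first by rewrite expr0 mul1r.
apply: le_trans (walk_step_contracts (iter w walk_step f)) _.
rewrite exprS -[X in _ <= X]mulrA; apply: ler_wpM2l IH.
by rewrite mulr_ge0 // addr_ge0.
Qed.

End Step.

(** Second moment: where the coset misses [D], the coset average of [D - mu] is [- mu], while the
    mean square of [D - mu] is at most [mu]. *)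
Lemma coset_miss (D : seq bool -> bool) (mu := tavg N (fun v => (D v)%:R)) : 0 < mu ->
  tavg na (fun a => tavg N (fun v =>
    (coset_avg a (fun v => (D v)%:R) v == 0)%:R)) <= lam / mu.
Proof.
move=> mu0; pose u v := (D v)%:R - mu : R.
have u0 : tavg N u = 0 by rewrite tavgB tavg_cst subrr.
have cE a v : coset_avg a (fun v => (D v)%:R) v = mu + coset_avg a u v.
  by rewrite /coset_avg tavgB tavg_cst addrCA subrr addr0.
have u2 : tavg N (fun v => u v ^+ 2) <= mu.
  have -> : tavg N (fun v => u v ^+ 2) = tavg N (fun v => (1 - 2 * mu) * (D v)%:R + mu ^+ 2).
    by apply: eq_tavg => v _; rewrite /u; case: (D v) => /=; ring.
  rewrite tavgD tavgZ tavg_cst -/mu; have := sqr_ge0 mu; nra.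
rewrite ler_pdivlMr // -(ler_pM2r mu0) -mulrA -expr2.
apply: (@le_trans _ _ (lam * tavg N (fun v => u v ^+ 2))); last first.
  by apply: ler_wpM2l.
apply: le_trans (coset_avg_contracts u0).
rewrite -tavgZr; apply: ler_tavg => a _; rewrite -tavgZr; apply: ler_tavg => v _.
rewrite cE; case: eqP => [e|_]; last by rewrite mul0r sqr_ge0.
by rewrite mul1r (_ : coset_avg a u v = - mu) ?sqrrN //; lra.
Qed.

End Spectral.

(** * Code words along the walk *)

Lemma subword_catl l p r1 r2 : (p + l <= size r1)%N ->
  subword l p (r1 ++ r2) = subword l p r1.
Proof.
move=> le; apply: (@eq_from_nth _ false); rewrite !size_mkseq // => i il.
by rewrite !nth_mkseq // nth_cat ifT //; lia.
Qed.

Lemma subword_catr l p q r1 r2 : (q = size r1 + p)%N ->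
  subword l q (r1 ++ r2) = subword l p r2.
Proof.
move=> ->; apply: (@eq_from_nth _ false); rewrite !size_mkseq // => i il.
rewrite !nth_mkseq // nth_cat ifF; last by apply/negbTE; lia.
by congr nth; lia.
Qed.

Lemma subword_full l r : size r = l -> subword l 0 r = r.
Proof.
move=> sr; apply: (@eq_from_nth _ false); rewrite ?size_mkseq // => i il.
by rewrite nth_mkseq.
Qed.

Lemma vertexS N h r i : vertex N h r i.+1 =
  xorv N (vertex N h r i) (shift_vec N h (subword (2 * h) (N + i * (7 * h)) r)
    (subword h (N + i * (7 * h) + 2 * h) r)).
Proof. by []. Qed.

Lemma vertex_cat N h w r1 r2 i : size r1 = (N + w * (7 * h))%N -> (i <= w)%N ->
  vertex N h (r1 ++ r2) i = vertex N h r1 i.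
Proof.
move=> s1; elim: i => [|i IH] iw; first by rewrite /vertex /= subword_catl // s1; lia.
have iw' : (i.+1 * (7 * h) <= w * (7 * h))%N by rewrite leq_mul2r iw orbT.
rewrite mulSn in iw'.
rewrite !vertexS IH ?(ltnW iw) //.
by rewrite !subword_catl // s1; lia.
Qed.

Lemma code_bit_cat N h w x r1 r2 : size r1 = (N + w * (7 * h))%N ->
  code_bit N h w x (r1 ++ r2) = code_bit N h w x r1.
Proof.
move=> s1; apply: eq_bigr => -[i iw] _ /=.
have iw' : (i.+1 * (7 * h) <= w * (7 * h))%N by rewrite leq_mul2r iw orbT.
rewrite mulSn in iw'.
by rewrite (vertex_cat _ s1 (ltnW iw)) !subword_catl // s1; lia.
Qed.

Section CodeBias.

Variables (N h : nat) (x x' : seq bool).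

Definition pair_bias (v a : seq bool) : R :=
  tavg (2 * h) (fun c => tavg (2 * h) (fun g : seq bool =>
    sgn (base_bit N h x v a c g (+) base_bit N h x' v a c g))).

(** Induction peels off the last 7h bits of the index. The weight [f] at the final vertex makes this
    possible: it absorbs the removed step. *)
Lemma code_pair_walk w (f : seq bool -> R) :
  tavg (N + w * (7 * h)) (fun r =>
    sgn (code_bit N h w x r (+) code_bit N h w x' r) * f (vertex N h r w)) =
  tavg N (iter w (walk_step N (2 * h) h (shift_vec N h) pair_bias) f).
Proof.
elim: w f => [|w IH] f.
  rewrite mul0n addn0; apply: eq_tavg => r sr.
  by rewrite /code_bit !big_ord0 mul1r /vertex /= subword_full.
rewrite iterSr -IH mulSn addnCA addnC tavg_cat; apply: eq_tavg => r1 s1.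
rewrite /walk_step (_ : 7 * h = 2 * h + (h + (2 * h + 2 * h)))%N; last by lia.
rewrite tavg_cat -tavgZ; apply: eq_tavg => a sa.
set v := vertex N h r1 w.
transitivity (tavg h (fun b => tavg (2 * h) (fun c => tavg (2 * h) (fun g : seq bool =>
   sgn (code_bit N h w x r1 (+) code_bit N h w x' r1) *
   (sgn (base_bit N h x v a c g (+) base_bit N h x' v a c g) *
    f (xorv N v (shift_vec N h a b))))))).
  rewrite tavg_cat; apply: eq_tavg => b sb; rewrite tavg_cat.
  apply: eq_tavg => c sc; apply: eq_tavg => g sg.
  rewrite vertexS /code_bit !big_ord_recr /= -!/(code_bit N h w _ _) !code_bit_cat //.
  rewrite (vertex_cat _ s1 (leqnn w)) -/v.
  have E p l : subword l (N + w * (7 * h) + p) (r1 ++ a ++ b ++ c ++ g) =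
      subword l p (a ++ b ++ c ++ g) by apply: subword_catr; rewrite s1.
  have E0 : subword (2 * h) (N + w * (7 * h)) (r1 ++ a ++ b ++ c ++ g) = a.
    rewrite -[X in subword _ X _]addn0 E subword_catl ?sa ?add0n //; exact: subword_full.
  have E2 : subword h (N + w * (7 * h) + 2 * h) (r1 ++ a ++ b ++ c ++ g) = b.
    rewrite E (@subword_catr _ 0 _ a) ?sa ?addn0 // subword_catl ?sb ?add0n //.
    exact: subword_full.
  have E3 : subword (2 * h) (N + w * (7 * h) + 3 * h) (r1 ++ a ++ b ++ c ++ g) = c.
    rewrite E (@subword_catr _ h _ a) ?sa; last by lia.
    rewrite (@subword_catr _ 0 _ b) ?sb ?addn0 // subword_catl ?sc ?add0n //.
    exact: subword_full.
  have E5 : subword (2 * h) (N + w * (7 * h) + 5 * h) (r1 ++ a ++ b ++ c ++ g) = g.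
    rewrite E (@subword_catr _ (3 * h) _ a) ?sa; last by lia.
    rewrite (@subword_catr _ (2 * h) _ b) ?sb; last by lia.
    by rewrite (@subword_catr _ 0 _ c) ?sc ?addn0 // subword_full.
  rewrite E0 E3 E5 addbACA sgn_addb -mulrA; congr (_ * (_ * f _)).
  by rewrite E2.
rewrite /coset_avg -tavgZ -tavgZ; apply: eq_tavg => b _.
rewrite /pair_bias -tavgZr -tavgZ; apply: eq_tavg => c _.
by rewrite -tavgZr -tavgZ.
Qed.

End CodeBias.

End Averages.

(** * Bias of the code *)

Lemma sum_bits N i : (\sum_(l < N) odd (i %/ 2 ^ l) * 2 ^ l = i %% 2 ^ N)%N.
Proof.
elim: N => [|N IH]; first by rewrite big_ord0 modn1.
rewrite big_ord_recr /= IH.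
have E : (i = (i %/ 2 ^ N)./2 * 2 ^ N.+1 + (i %% 2 ^ N + odd (i %/ 2 ^ N) * 2 ^ N))%N.
  rewrite {1}(divn_eq i (2 ^ N)) -{1}(odd_double_half (i %/ 2 ^ N)) expnS -mul2n; ring.
rewrite [in RHS]E modnMDl [RHS]modn_small //.
rewrite expnS; have : (i %% 2 ^ N < 2 ^ N)%N by rewrite ltn_mod expn_gt0.
by case: (odd _) => /=; lia.
Qed.

Lemma size_bits h j : size (bits h j) = h.
Proof. by rewrite size_mkseq. Qed.

Lemma bits_inj h i j : (i < 2 ^ h)%N -> (j < 2 ^ h)%N -> bits h i = bits h j -> i = j.
Proof.
move=> ih jh E; rewrite -(modn_small ih) -(modn_small jh) -!sum_bits.
apply: eq_bigr => l _; congr (nat_of_bool _ * _)%N.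
by have := congr1 (fun s => nth false s l) E; rewrite !nth_mkseq.
Qed.

Lemma bits_surj h (b : seq bool) : size b = h -> exists2 j, (j < 2 ^ h)%N & bits h j = b.
Proof.
move=> /eqP sb.
have P (j : 'I_(2 ^ h)) : size (bits h j) == h by rewrite size_bits.
pose T j := Tuple (P j).
have Tbij : bijective T.
  apply: inj_card_bij; last by rewrite card_tuple card_bool card_ord.
  by move=> i j /(congr1 val) /bits_inj E; apply: val_inj; apply: E.
have [g _ gK] := Tbij; exists (g (Tuple sb)) => //.
by have := congr1 val (gK (Tuple sb)).
Qed.

Lemma read_at_bits (x : seq bool) i : (i < size x)%N ->
  read_at x (bits (bitlen (size x)) i) (bitlen (size x)) = nth false x i.
Proof.
move=> ix; rewrite /read_at; congr nth.
rewrite -[RHS](@modn_small i (2 ^ bitlen (size x))); last first.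
  exact: ltn_trans ix (bitlen_gt _).
rewrite -sum_bits; apply: eq_bigr => l _; rewrite nth_mkseq //.
by congr (_ * _)%N; apply/minn_idPl; rewrite -ltn_bitlen.
Qed.

Definition hdist n (x x' : n.-tuple bool) : nat := #|[set i | tnth x i != tnth x' i]|.

Section CodeAnalysis.

Variable R : realFieldType.

Lemma tavg_indicator n (P : pred (seq bool)) :
  tavg n (fun r => (P r)%:R) = #|[set r : n.-tuple bool | P r]|%:R / 2 ^+ n :> R.
Proof.
rewrite /tavg /tsum -sum1_card natr_sum; congr (_ / _).
by rewrite big_mkcond /= [RHS]big_mkcond; apply: eq_bigr => r _; rewrite inE; case: (P r).
Qed.

(** The positions of [x] have distinct binary expansions among the 2^N vertices. *)
Lemma read_at_density n (x x' : n.-tuple bool) (N := bitlen n) :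
  (hdist x x')%:R / 2 ^+ N <=
  tavg N (fun v => (read_at x v N (+) read_at x' v N)%:R) :> R.
Proof.
rewrite (tavg_indicator N (fun v => read_at x v N (+) read_at x' v N)).
rewrite ler_pM2r ?invr_gt0 ?pow2_gt0 // ler_nat.
have P (i : 'I_n) : size (bits N i) == N by rewrite size_bits.
pose T i := Tuple (P i).
have Tinj : injective T.
  move=> i j /(congr1 val) /bits_inj E; apply: val_inj; apply: E;
    apply: ltn_trans (bitlen_gt n); exact: ltn_ord.
rewrite /hdist -(card_imset _ Tinj); apply: subset_leq_card.
apply/fintype.subsetP => _ /imsetP[i + ->]; rewrite !inE /=.
have := @read_at_bits x i; have := @read_at_bits x' i.
rewrite !size_tuple -/N => -> // -> //; rewrite !(tnth_nth false).
by case: (nth _ x _) (nth _ x' _) => [] [].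
Qed.

Lemma dot_mkseq_parity l M (F : nat -> nat -> bool) b : 
  dot l (mkseq (fun i => \big[addb/false]_(j < M) F j i) l) b =
  \big[addb/false]_(j < M) dot l (mkseq (F j) l) b.
Proof.
rewrite /dot exchange_big /=; apply: eq_bigr => i _.
rewrite nth_mkseq // (big_morph (fun c => c && nth false b i) (fun c d => andb_addl c d _) (erefl _)).
by apply: eq_bigr => j _; rewrite nth_mkseq.
Qed.

(** The character is linear in [b]; its vector consists of the first h coordinates of the field
    element sum c_i a^(i+1). *)
Lemma dot_shift_vec N h c a b : dot N c (shift_vec N h a b) =
  dot h (mkseq (fun l => \big[addb/false]_(i < N)
     (nth false c i && nth false (powf h a i.+1) l)) h) b.
Proof.
rewrite (dot_mkseq_parity h N (fun i l => nth false c i && nth false (powf h a i.+1) l)).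
apply: eq_bigr => i _.
rewrite nth_mkseq // /dot (big_morph _ (andb_addr (nth false c i)) (andbF _)).
by apply: eq_bigr => l _; rewrite nth_mkseq // andbA.
Qed.

(** The average over [b] is 1 if the first h coordinates of sum c_i a^(i+1) vanish, and 0 otherwise.
    The other h coordinates take at most 2^h values, each for at most N of the 4^h elements [a]. *)
Lemma shift_vec_bias N j c i (h := (3 ^ j)%N) : (i < N)%N -> nth false c i ->
  tavg (2 * h) (fun a => tavg h (fun b => sgn R (dot N c (shift_vec N h a b))) ^+ 2) <=
  N%:R / 2 ^+ h.
Proof.
move=> iN ci; pose Y a l := \big[addb/false]_(i < N)
     (nth false c i && nth false (powf h a i.+1) l).
have E a : tavg h (fun b => sgn R (dot N c (shift_vec N h a b))) ^+ 2 =
    [forall l : 'I_h, ~~ Y a l]%:R.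
  under eq_tavg => b _ do rewrite dot_shift_vec dotC.
  rewrite tavg_sgn_dot -natrX; congr (_%:R).
  have -> : [forall l : 'I_h, ~~ nth false (mkseq (Y a) h) l] = [forall l : 'I_h, ~~ Y a l].
    by apply: eq_forallb => l; rewrite nth_mkseq.
  by case: [forall _, _].
rewrite (eq_tavg (g := fun a => [forall l : 'I_h, ~~ Y a l]%:R)) => [|a _]; last exact: E.
rewrite (tavg_indicator _ (fun a => [forall l : 'I_h, ~~ Y a l])) ler_pdivrMr ?pow2_gt0 //.
have -> : 2 ^+ (2 * h) = 2 ^+ h * 2 ^+ h :> R by rewrite mul2n -addnn exprD.
rewrite mulrA divfK ?pow2_neq0 // -natrX -natrM ler_nat.
rewrite -sum1_card (partition_big (fun a : (2 * h).-tuple bool => [tuple Y a (h + l)%N | l < h])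
  xpredT) //=.
apply: (@leq_trans (\sum_(t : h.-tuple bool) N)); last first.
  by rewrite sum_nat_const card_tuple card_bool mulnC.
apply: leq_sum => t _; rewrite sum1_card.
refine (leq_trans _ (@card_shifted_roots j N (nth false c)
  (fun l => if (l < h)%N then false else nth false t (l - h)%N) i iN ci)).
apply: subset_leq_card; apply/fintype.subsetP => a; rewrite unfold_in inE => /andP[z /eqP <-].
have {}z l := fintype.forallP z l; rewrite inE.
apply/fintype.forallP => l; rewrite -/(Y a l) -/h; case: ltnP => lh.
  by apply/eqP/negbTE; exact: (z (Ordinal lh)).
have lh' : (l - h < h)%N by have := ltn_ord l; rewrite -/h; lia.
rewrite -[(l - h)%N]/(nat_of_ord (Ordinal lh')) -tnth_nth tnth_mktuple /=.
by rewrite subnKC.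
Qed.

Definition differ (N : nat) (x x' v : seq bool) : bool := read_at x v N (+) read_at x' v N.

(** Averaging over [g] leaves the probability over [c] that the polynomial whose coefficients are
    the differences on the coset vanishes at [c]. *)
Lemma pair_bias_forall N h x x' v a : pair_bias R N h x x' v a =
  tavg (2 * h) (fun c => [forall l : 'I_(2 * h), \big[addb/false]_(i < 2 ^ h)
    (differ N x x' (xorv N v (shift_vec N h a (bits h i))) &&
     nth false (powf h c i) l) == false]%:R).
Proof.
rewrite /pair_bias; apply: eq_tavg => c sc.
pose Z l := \big[addb/false]_(i < 2 ^ h)
  (differ N x x' (xorv N v (shift_vec N h a (bits h i))) && nth false (powf h c i) l).
transitivity (tavg (2 * h) (fun e => sgn R (dot (2 * h) e (mkseq Z (2 * h))))).
  apply: eq_tavg => e _; congr sgn.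
  rewrite dotC (dot_mkseq_parity _ _ (fun i l => differ N x x' (xorv N v (shift_vec N h a (bits h i))) && nth false (powf h c i) l)).
  rewrite /base_bit -big_split; apply: eq_bigr => i _ /=; rewrite -andb_addl -/(differ _ _ _ _).
  rewrite /dot (big_morph _ (andb_addr _) (andbF _)).
  by apply: eq_bigr => l _; rewrite nth_mkseq // andbA.
rewrite tavg_sgn_dot; congr (_%:R); apply/congr1/eq_forallb => l.
by rewrite nth_mkseq // eqbF_neg.
Qed.

Lemma tavg_bool_bounds n (P : pred (seq bool)) :
  0 <= tavg n (fun r => (P r)%:R : R) <= 1.
Proof.
apply/andP; split; first by apply: tavg_ge0 => r _; exact: ler0n.
by rewrite -[X in _ <= X](tavg_cst n); apply: ler_tavg => r _; rewrite lern1 leq_b1.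
Qed.

Lemma pair_bias_bounds N h x x' v a : 0 <= pair_bias R N h x x' v a <= 1.
Proof.
rewrite pair_bias_forall; exact: (tavg_bool_bounds _ (fun c => [forall l : 'I_(2 * h), _])).
Qed.

(** A hit makes this polynomial nonzero; its degree is below 2^h, so it has at most 2^h roots among
    4^h elements. *)
Lemma pair_bias_hit N j x x' v a (h := (3 ^ j)%N) :
  coset_avg N h (shift_vec N h) a (fun v => (differ N x x' v)%:R) v != 0 :> R ->
  pair_bias R N h x x' v a <= (2 ^+ h)^-1.
Proof.
move=> hit.
have [i ih di] : exists2 i, (i < 2 ^ h)%N &
    differ N x x' (xorv N v (shift_vec N h a (bits h i))).
  apply/not_exists2P => none; case/eqP: hit.
  rewrite /coset_avg -[RHS](tavg_cst h); apply: eq_tavg => b /bits_surj[i ih <-].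
  by have [//|/negP/negbTE ->] := none i.
rewrite pair_bias_forall (tavg_indicator _ (fun c => [forall l : 'I_(2 * h), _ == false])).
have -> : 2 ^+ (2 * h) = 2 ^+ h * 2 ^+ h :> R by rewrite mul2n -addnn exprD.
rewrite invfM mulrA ger_pMl ?invr_gt0 ?pow2_gt0 // ler_pdivrMr ?pow2_gt0 // mul1r.
rewrite -natrX ler_nat.
exact: (@card_unshifted_roots j (2 ^ h) (fun i =>
  differ N x x' (xorv N v (shift_vec N h a (bits h i)))) i ih di).
Qed.

(** [walk_contracts] on the constant 1. The bias at a vertex is at most 1 on cosets without a
    difference, which are rare by [coset_miss], and at most 2^-h on the others. *)
Lemma code_bias n (x x' : n.-tuple bool) j w (mu0 : R) (N := bitlen n) (h := (3 ^ j)%N) :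
  0 < mu0 -> mu0 <= (hdist x x')%:R / 2 ^+ N ->
  tavg (N + w * (7 * h)) (fun r => sgn R (code_bit N h w x r (+) code_bit N h w x' r)) ^+ 2 <=
  (2 * (N%:R / 2 ^+ h / mu0 + (2 ^+ h)^-1 + N%:R / 2 ^+ h)) ^+ w.
Proof.
move=> mu00 mu0x; pose d v := (differ N x x' v)%:R : R.
have mu0mu := le_trans mu0x (read_at_density x x').
set lam := N%:R / 2 ^+ h.
have lam0 : 0 <= lam by rewrite divr_ge0 // ltW ?pow2_gt0.
have gb := @shift_vec_bias N j.
have miss := @coset_miss R N (2 * h) h (shift_vec N h) lam lam0 (fun c i => gb c i)
  (differ N x x') (lt_le_trans mu00 mu0mu).
have F2 : tavg (2 * h) (fun a => tavg N (fun v => pair_bias R N h x x' v a ^+ 2)) <=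
    lam / mu0 + (2 ^+ h)^-1.
  apply: (@le_trans _ _ (tavg (2 * h) (fun a => tavg N (fun v =>
      (coset_avg N h (shift_vec N h) a d v == 0)%:R + (2 ^+ h)^-1)))).
    apply: ler_tavg => a _; apply: ler_tavg => v _.
    have /andP[p0 p1] := pair_bias_bounds N h x x' v a.
    apply: (@le_trans _ _ (pair_bias R N h x x' v a)).
      by rewrite expr2 ler_piMl.
    case: eqP => [_|/eqP ne].
      by rewrite (le_trans p1) // lerDl invr_ge0 ltW ?pow2_gt0.
    by rewrite add0r; apply: (@pair_bias_hit N j).
  rewrite (eq_tavg (g := fun a => tavg N (fun v =>
    (coset_avg N h (shift_vec N h) a d v == 0)%:R) + (2 ^+ h)^-1)) => [|a _].
    rewrite tavgD tavg_cst lerD2r; apply: le_trans miss _.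
    by rewrite ler_wpM2l // lef_pV2 // posrE (lt_le_trans mu00).
  by rewrite tavgD tavg_cst.
have le1 v a : `|pair_bias R N h x x' v a| <= 1.
  by have /andP[p0 p1] := pair_bias_bounds N h x x' v a; rewrite ger0_norm.
have := code_pair_walk N h x x' w (fun=> 1 : R).
under eq_tavg => r _ do rewrite mulr1.
move=> ->; apply: le_trans (sqr_tavg_le _ _) _.
apply: le_trans (walk_contracts lam0 (fun c i => gb c i) F2 le1 w (fun=> 1)) _.
rewrite (eq_tavg (g := fun=> 1)) ?tavg_cst ?mulr1 // => v _; by rewrite expr1n.
Qed.

End CodeAnalysis.

(** * List decoding *)

Lemma card_le_sum (T I : finType) (B : {set T}) (D : {set I}) (P : T -> I -> bool) :
  (forall x, x \in B -> exists2 i, i \in D & P x i) ->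
  (#|B| <= \sum_(i in D) #|[set x | P x i]|)%N.
Proof.
move=> BP; apply: (@leq_trans (\sum_(x in B) \sum_(i in D) P x i)%N).
  rewrite -sum1_card; apply: leq_sum => x /BP[i iD Pxi].
  by rewrite (bigD1 i) //= Pxi leq_addr.
rewrite exchange_big /=; apply: leq_sum => i _.
rewrite -sum1_card big_mkcond [leqRHS]big_mkcond /=; apply: leq_sum => x _.
by rewrite inE; case: (x \in B) (P x i) => [] [].
Qed.

Lemma card_small_sets n w : (#|[set S : {set 'I_n} | #|S| <= w]| <= n.+1 ^ w)%N.
Proof.
pose F (f : {ffun 'I_w -> option 'I_n}) := [set i | [exists l, f l == Some i]].
apply: (@leq_trans #|F @: [set: {ffun 'I_w -> option 'I_n}]|); last first.
  by apply: leq_trans (leq_imset_card _ _) _; rewrite cardsT card_ffun card_option !card_ord.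
apply: subset_leq_card; apply/fintype.subsetP => S; rewrite inE => Sw; apply/imsetP.
exists [ffun l : 'I_w => nth None [seq Some i | i <- enum S] l] => //.
apply/setP => i; rewrite inE; apply/idP/existsP.
  move=> iS; have lt : (index i (enum S) < w)%N.
    by apply: leq_trans Sw; rewrite cardE index_mem mem_enum.
  exists (Ordinal lt); rewrite ffunE /= (nth_map i) ?nth_index ?mem_enum //.
  by rewrite index_mem mem_enum.
case=> l; rewrite ffunE; have [lt|ge] := ltnP l (size (enum S)).
  by rewrite (nth_map i) // => /eqP[<-]; rewrite -mem_enum mem_nth.
by rewrite nth_default // size_map.
Qed.

Lemma card_ball n (x : n.-tuple bool) w :
  (#|[set x' | hdist x x' <= w]| <= n.+1 ^ w)%N.
Proof.
apply: leq_trans (card_small_sets n w).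
pose D (x' : n.-tuple bool) := [set i | tnth x i != tnth x' i].
have Dinj : injective D.
  move=> y y' /setP E; apply: eq_from_tnth => i; have := E i; rewrite !inE.
  by case: (tnth x i) (tnth y i) (tnth y' i) => [] [] [].
rewrite -(card_imset _ Dinj); apply: subset_leq_card.
by apply/fintype.subsetP => _ /imsetP[x' + ->]; rewrite !inE.
Qed.

Lemma hdist0 n (x : n.-tuple bool) : hdist x x = 0%N.
Proof. by apply: eq_card0 => i; rewrite inE eqxx. Qed.

Section ListDecoding.

Variables (R : realFieldType) (n t : nat) (code : n.-tuple bool -> seq bool -> bool).

Definition correlation (g : seq bool -> bool) (x : n.-tuple bool) : R :=
  tavg t (fun r => sgn R (g r (+) code x r)).

Lemma tavg_sum (I : finType) (P : pred I) (f : I -> seq bool -> R) :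
  tavg t (fun r => \sum_(i | P i) f i r) = \sum_(i | P i) tavg t (f i).
Proof. by rewrite /tavg /tsum exchange_big /= mulr_suml. Qed.

(* The vectors [sgn (code x)], for [x] in [T], have norm 1 and are almost      *)
(* orthogonal, so that few of them have a noticeable projection on [sgn g].    *)
Lemma card_correlated (g : seq bool -> bool) (T : {set n.-tuple bool}) (rho : R) : 0 < rho ->
  (forall x x', x \in T -> x' \in T -> x != x' ->
     tavg t (fun r => sgn R (code x r (+) code x' r)) <= rho ^+ 2 / 2) ->
  (forall x, x \in T -> rho <= correlation g x) ->
  #|T|%:R <= 2 / rho ^+ 2.
Proof.
move=> rho0 far cor.
pose s r := \sum_(x in T) sgn R (code x r).
have h1 : #|T|%:R * rho <= tavg t (fun r => sgn R (g r) * s r).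
  rewrite mulrC -sum1_card natr_sum mulr_sumr.
  have -> : tavg t (fun r => sgn R (g r) * s r) = \sum_(x in T) correlation g x.
    rewrite -tavg_sum; apply: eq_tavg => r _; rewrite /s mulr_sumr.
    by apply: eq_bigr => x _; rewrite sgn_addb.
  by apply: ler_sum => x xT; rewrite mulr1; apply: cor.
have h2 : tavg t (fun r => s r ^+ 2) <= #|T|%:R + #|T|%:R ^+ 2 * (rho ^+ 2 / 2).
  have -> : tavg t (fun r => s r ^+ 2) =
      \sum_(x in T) \sum_(x' in T) tavg t (fun r => sgn R (code x r (+) code x' r)).
    rewrite (eq_tavg (g := fun r => \sum_(x in T) \sum_(x' in T) sgn R (code x r (+) code x' r))).
      by rewrite tavg_sum; apply: eq_bigr => x _; rewrite tavg_sum.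
    move=> r _; rewrite expr2 /s mulr_suml; apply: eq_bigr => x _; rewrite mulr_sumr.
    by apply: eq_bigr => x' _; rewrite sgn_addb.
  have e0 : 0 <= rho ^+ 2 / 2 by rewrite divr_ge0 ?sqr_ge0.
  apply: (@le_trans _ _ (\sum_(x in T) (1 + #|T|%:R * (rho ^+ 2 / 2)))); last first.
    by rewrite sumr_const -[_ *+ #|T|]mulr_natl mulrDr mulr1 mulrA -expr2.
  apply: ler_sum => x xT; rewrite (bigD1 x) //=; apply: lerD.
    rewrite -[X in _ <= X](tavg_cst t); apply: ler_tavg => r _.
    by rewrite addbb /sgn expr0.
  rewrite -sum1_card natr_sum mulr_suml.
  apply: (@le_trans _ _ (\sum_(x' in T | x' != x) rho ^+ 2 / 2)).
    by apply: ler_sum => x' /andP[x'T ne]; apply: far => //; rewrite eq_sym.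
  rewrite [leRHS](bigD1 x) //= mul1r.
  by rewrite lerDr.
have h3 : (#|T|%:R * rho) ^+ 2 <= #|T|%:R + #|T|%:R ^+ 2 * (rho ^+ 2 / 2).
  apply: le_trans h2; apply: (@le_trans _ _ (tavg t (fun r => sgn R (g r) * s r) ^+ 2)).
    by rewrite ler_pXn2r // ?nnegrE ?(le_trans _ h1) // mulr_ge0 // ltW.
  apply: le_trans (sqr_tavg_le _ _) _; apply: ler_tavg => r _.
  by rewrite exprMn [sgn R _ ^+ 2]expr2 sgn_sqr mul1r.
have r2 : 0 < rho ^+ 2 by rewrite exprn_gt0.
rewrite ler_pdivlMr //; have [->|T0] := posnP #|T|; first by rewrite mul0r.
have T1 : 0 < #|T|%:R :> R by rewrite ltr0n.
rewrite -(ler_pM2l T1); move: h3; rewrite exprMn => h3; nra.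
Qed.

(* A maximal [w]-separated subset of the list is small, and the balls of       *)
(* radius [w] around it cover the list.                                        *)
Lemma card_list (g : seq bool -> bool) (rho : R) (w : nat) : 0 < rho ->
  (forall x x', (w < hdist x x')%N ->
     tavg t (fun r => sgn R (code x r (+) code x' r)) <= rho ^+ 2 / 2) ->
  #|[set x | rho <= correlation g x]|%:R <= 2 / rho ^+ 2 * (n.+1 ^ w)%:R.
Proof.
move=> rho0 far; pose L := [set x | rho <= correlation g x].
pose sep (T : {set n.-tuple bool}) := (T \subset L) &&
  [forall x in T, forall x' in T, (x != x') ==> (w < hdist x x')%N].
have sepP (T : {set n.-tuple bool}) : reflect (T \subset L /\ forall x x', x \in T -> x' \in T -> x != x' ->
    (w < hdist x x')%N) (sep T).
  apply: (iffP andP) => -[TL h]; split=> //.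
    move=> x x' xT x'T; move/fintype.forall_inP: h => /(_ _ xT) /fintype.forall_inP /(_ _ x'T).
    by move/implyP.
  apply/fintype.forall_inP => x xT; apply/fintype.forall_inP => x' x'T; apply/implyP.
  exact: h.
have s0 : sep finset.set0.
  by apply/sepP; rewrite finset.sub0set; split=> // x x'; rewrite inE.
have [T mT _] := maxset_exists s0.
have /sepP[TL Tsep] := maxsetp mT.
have cT : #|T|%:R <= 2 / rho ^+ 2.
  apply: (card_correlated rho0) => [x x' xT x'T ne|x xT]; first exact: far (Tsep _ _ xT x'T ne).
  by have := fintype.subsetP TL x xT; rewrite /L inE; apply.
apply: (@le_trans _ _ (#|T|%:R * (n.+1 ^ w)%:R)); last by rewrite ler_wpM2r.
rewrite -natrM ler_nat.
apply: leq_trans (card_le_sum (D := T) (P := fun x y => hdist y x <= w)%N _) _; last first.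
  rewrite -sum_nat_const; apply: leq_sum => y _; exact: card_ball.
move=> x xL; have [xT|xT] := boolP (x \in T); first by exists x; rewrite ?hdist0.
have [[y yT yx]|none] := EM (exists2 y, y \in T & (hdist y x <= w)%N); first by exists y.
have hsym y y' : hdist y y' = hdist y' y.
  by apply: eq_card => i; rewrite !inE eq_sym.
have far' y : y \in T -> (w < hdist y x)%N.
  by move=> yT; rewrite ltnNge; apply/negP => yx; apply: none; exists y.
have sx : sep (x |: T).
  apply/sepP; split; first by rewrite finset.subUset finset.sub1set xL.
  move=> y y'; rewrite !inE => /orP[/eqP->|yT] /orP[/eqP->|y'T] ne.
  - by rewrite eqxx in ne.
  - by rewrite hsym; apply: far'.
  - exact: far'.
  - exact: Tsep.
have := maxsetsup mT sx (finset.subsetUr _ _) => E; case/negP: xT.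
by rewrite -E finset.setU11.
Qed.

End ListDecoding.

(** * The hybrid argument *)

Section Reconstruction.

Variables (R : realFieldType) (n d t Q m : nat) (S : nat -> nat -> nat)
  (code : n.-tuple bool -> seq bool -> bool) (T : seq bool -> bool).

Hypotheses (dE : d = (t * Q)%N)
  (S_lt : forall i p, (i < m)%N -> (p < t)%N -> (S i p < Q)%N).

Local Notation select := (select t Q S).

Definition mix (i : nat) (x : n.-tuple bool) (u rho : seq bool) : seq bool :=
  mkseq (fun l => if (l < i)%N then code x (select l u) else nth false rho l) m.

Definition hybrid (i : nat) (x : n.-tuple bool) : R :=
  tavg d (fun u => tavg m (fun rho => (T (u ++ mix i x u rho))%:R)).

(** Yao's predictor: keep the random bit if the test accepts, flip it otherwise. *)
Definition guess (i : nat) (x : n.-tuple bool) (u rho : seq bool) : bool :=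
  nth false rho i (+) ~~ T (u ++ mix i x u rho).

Lemma hybrid_step i x : (i < m)%N ->
  2 * (hybrid i.+1 x - hybrid i x) =
  tavg d (fun u => tavg m (fun rho => sgn R (guess i x u rho (+) code x (select i u)))).
Proof.
move=> im; rewrite /hybrid -tavgB -tavgZ; apply: eq_tavg => u _.
rewrite -tavgB -tavgZ; set b := code x (select i u).
pose e := mkseq (fun l => l == i) m.
have flip rho l : (l < m)%N ->
    nth false (xorv m rho e) l = nth false rho l (+) (l == i).
  by move=> lm; rewrite nth_xorv // nth_mkseq.
(* Pair each [rho] with its flip at [i]. Exactly one of the two carries the true bit, and the
   identity holds on every pair. *)
have avg2 f : tavg m f = 2^-1 * tavg m (fun rho => f rho + f (xorv m rho e)) :> R.
  by rewrite tavgD tavg_xorv; lra.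
have mixE rho : mix i.+1 x u rho =
    if nth false rho i == b then mix i x u rho else mix i x u (xorv m rho e).
  apply: (@eq_from_nth _ false); rewrite size_mkseq; first by case: ifP; rewrite size_mkseq.
  move=> l lm; rewrite nth_mkseq // ltnS.
  case: (boolP (nth false rho i == b)) => rb; rewrite nth_mkseq // leq_eqVlt ?flip //; case: (eqVneq l i) => [->|ne] /=.
  - by rewrite ltnn (eqP rb).
  - by [].
  - by rewrite ltnn; move: rb; rewrite -/b; case: (nth _ _ _) b => [] [].
  - by rewrite addbF.
have mixF rho : mix i.+1 x u (xorv m rho e) = mix i.+1 x u rho.
  apply: (@eq_from_nth _ false); rewrite !size_mkseq // => l lm.
  rewrite [in RHS]nth_mkseq // nth_mkseq // ltnS; case: leqP => // il.
  by rewrite flip // gtn_eqF // addbF.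
rewrite [LHS]avg2 [RHS]avg2; congr (_ * _); apply: eq_tavg => rho sr.
rewrite mixF mixE /guess flip // eqxx.
by move: (nth false rho i) (b) => [] [] /=;
  case: (T (u ++ mix i x u rho)) (T (u ++ mix i x u (xorv m rho e))) => [] [];
  rewrite /sgn /= ?expr0 ?expr1; ring.
Qed.

Lemma tavg_exists k (f : seq bool -> R) c : c < tavg k f ->
  exists r : k.-tuple bool, c < f r.
Proof.
move=> cf; apply/not_existsP => none; have : tavg k f <= c.
  rewrite -[X in _ <= X](tavg_cst k); apply: ler_tavg => r sr.
  have pr : size r == k by rewrite sr.
  by rewrite leNgt; apply/negP; exact: none (Tuple pr).
by rewrite leNgt cf.
Qed.

(* The seed [u] with its bits at the positions of the [i]-th set replaced by   *)
(* [r].                                                                       *)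
Definition plant (i : nat) (u r : seq bool) : seq bool :=
  xorv d u (mkseq (fun q => (q %% Q == S i (q %/ Q))%N &&
                            nth false (xorv t r (select i u)) (q %/ Q)) d).

(** Shifting [r] by [select i u] turns planting into a translation of [u] that depends on [r]
    alone. *)
Lemma tavg_plant i (f : seq bool -> R) :
  tavg d f = tavg d (fun u => tavg t (fun r => f (plant i u r))).
Proof.
pose del r := mkseq (fun q => (q %% Q == S i (q %/ Q))%N && nth false r (q %/ Q)) d.
transitivity (tavg d (fun u => tavg t (fun r => f (xorv d u (del r))))).
  rewrite tavg_exchange -[LHS](tavg_cst t); apply: eq_tavg => r _.
  by rewrite tavg_xorv.
by apply: eq_tavg => u _; rewrite -(tavg_xorv t (select i u)).
Qed.

Lemma nth_select_plant i j u r p : (i < m)%N -> (j < m)%N -> (p < t)%N ->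
  nth false (select j (plant i u r)) p =
  if S j p == S i p then nth false r p else nth false u (p * Q + S j p).
Proof.
move=> im jm pt; have Sj := S_lt jm pt; rewrite nth_mkseq //.
have Q0 : (0 < Q)%N by apply: leq_ltn_trans Sj.
have lt : (p * Q + S j p < d)%N.
  by rewrite dE (@leq_trans (p.+1 * Q)) ?leq_mul2r ?pt ?orbT // mulSn addnC ltn_add2r.
rewrite nth_xorv // nth_mkseq // divnMDl // divn_small // addn0 modnMDl modn_small //.
case: eqP => [->|_] /=; last by rewrite addbF.
rewrite nth_xorv // nth_mkseq //.
by rewrite addbCA addbb addbF.
Qed.

Lemma select_plant i u r : (i < m)%N -> size r = t -> select i (plant i u r) = r.
Proof.
move=> im sr; apply: (@eq_from_nth _ false); rewrite size_mkseq ?sr // => p pt.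
by rewrite nth_select_plant // eqxx.
Qed.

Local Notation agree_set := (agree_set t S).

Definition supported (A : {set 'I_t}) : {set {ffun t.-tuple bool -> bool}} :=
  [set H : {ffun t.-tuple bool -> bool} | [forall r : t.-tuple bool, forall r' : t.-tuple bool,
     [forall p in A, tnth r p == tnth r' p] ==> (H r == H r')]].

(** Such a function is determined by its values on the strings that vanish outside [A]. *)
Lemma card_supported A : (#|supported A| <= 2 ^ 2 ^ #|A|)%N.
Proof.
pose Z := [set r : t.-tuple bool | [forall p, (p \notin A) ==> ~~ tnth r p]].
pose rs (H : {ffun t.-tuple bool -> bool}) := [ffun r => (r \in Z) && H r].
have ZA : (#|Z| <= 2 ^ #|A|)%N.
  rewrite -card_powerset; pose pos (r : t.-tuple bool) := [set p | tnth r p].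
  have pinj : injective pos.
    by move=> r r' /setP E; apply: eq_from_tnth => p; have := E p; rewrite !inE.
  rewrite -(card_imset _ pinj); apply: subset_leq_card.
  apply/fintype.subsetP => _ /imsetP[r + ->]; rewrite !inE => /fintype.forallP rZ.
  apply/fintype.subsetP => p; rewrite inE => rp; apply: contraLR rp => pA.
  exact: implyP (rZ p) pA.
apply: leq_trans (leq_pexp2l _ ZA); last by [].
rewrite -card_bool -(card_pffun_on false Z predT) -(card_in_imset (f := rs)).
  apply: subset_leq_card; apply/fintype.subsetP => _ /imsetP[H _ ->].
  apply/pffun_onP; split=> [|r _ //].
  by apply/fintype.subsetP => r; rewrite inE ffunE; case: (r \in Z).
move=> H H'; rewrite !inE => HA HA' /ffunP E; apply/ffunP => r.
pose r0 := [tuple (p \in A) && tnth r p | p < t].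
have r0Z : r0 \in Z.
  rewrite inE; apply/fintype.forallP => p; apply/implyP => pA.
  by rewrite tnth_mktuple (negbTE pA).
have rr0 : [forall p in A, tnth r p == tnth r0 p].
  by apply/fintype.forall_inP => p pA; rewrite tnth_mktuple pA.
have /eqP -> := implyP (fintype.forallP (fintype.forallP HA r) r0) rr0.
have /eqP -> := implyP (fintype.forallP (fintype.forallP HA' r) r0) rr0.
by have := E r0; rewrite !ffunE r0Z.
Qed.

(** Tables of the earlier output bits as functions of the planted [r]. The entries from [i] on are
    pinned to one value so as not to count. *)
Definition advice (i : 'I_m) : {set {ffun 'I_m -> {ffun t.-tuple bool -> bool}}} :=
  [set H | H \in family (fun j : 'I_m =>
     if (j < i)%N then supported (agree_set i j) else [set [ffun=> false]])].

Lemma card_advice (i : 'I_m) W : (\sum_(j < i) 2 ^ #|agree_set i j| <= W)%N ->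
  (#|advice i| <= 2 ^ W)%N.
Proof.
move=> iW; rewrite cardsE card_family.
rewrite foldrE big_map big_enum /=.
apply: (@leq_trans (\prod_(j : 'I_m) 2 ^ (if (j < i)%N then 2 ^ #|agree_set i j| else 0))%N).
  apply: leq_prod => j _; case: ifP => _; first exact: card_supported.
  by rewrite cards1.
rewrite -expn_sum leq_exp2l //; apply: leq_trans iW.
rewrite (big_ord_widen _ (fun j => 2 ^ #|agree_set i j|)%N (ltnW (ltn_ord i))).
by rewrite [leqRHS]big_mkcond.
Qed.

Definition predictor (i : 'I_m) (u : d.-tuple bool) (rho : m.-tuple bool)
    (H : {ffun 'I_m -> {ffun t.-tuple bool -> bool}}) (r : seq bool) : bool :=
  nth false rho i (+) ~~ T (plant i u r ++
    [tuple if (l < i)%N then H l [tuple nth false r p | p < t] else nth false rho l | l < m]).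

(** Averaging fixes [u] and [rho]. An earlier output bit then depends on [r] only at the positions
    where its set agrees with the i-th one. *)
Lemma exists_predictor (i : 'I_m) x c : c < hybrid i.+1 x - hybrid i x ->
  exists u rho, exists2 H, H \in advice i &
    2 * c <= correlation R t code (predictor i u rho H) x.
Proof.
move=> ci; have im := ltn_ord i.
have : 2 * c < 2 * (hybrid i.+1 x - hybrid i x) by rewrite ltr_pM2l.
rewrite hybrid_step // (tavg_plant i) => /tavg_exists[u].
rewrite tavg_exchange => /tavg_exists[rho] /ltW cu.
pose H := [ffun l : 'I_m => if (l < i)%N then
  [ffun r : t.-tuple bool => code x (select l (plant i u r))] else [ffun=> false]].
exists u, rho, H.
  rewrite inE; apply/familyP => l; rewrite ffunE; case: ifP => li; last by rewrite inE.
  rewrite inE; apply/fintype.forallP => r; apply/fintype.forallP => r'.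
  apply/implyP => /fintype.forall_inP rr'; rewrite !ffunE; apply/eqP; congr code.
  apply: (@eq_from_nth _ false); rewrite !size_mkseq // => p pt.
  rewrite !nth_select_plant //; case: eqP => // /eqP E.
  have := rr' (Ordinal pt); rewrite inE => /(_ E) /eqP.
  by rewrite !(tnth_nth false).
apply: le_trans cu _; rewrite le_eqVlt; apply/orP; left; apply/eqP.
apply: eq_tavg => r sr; congr sgn; rewrite /guess select_plant // /predictor.
have pr : size r == t by rewrite sr.
have rE : [tuple nth false r p | p < t] = Tuple pr.
  by apply: eq_from_tnth => p; rewrite tnth_mktuple (tnth_nth false).
congr (_ (+) ~~ T (_ ++ _) (+) _); apply: (@eq_from_nth _ false).
  by rewrite size_mkseq size_tuple.
rewrite size_mkseq => l lm; rewrite nth_mkseq //.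
rewrite -[in RHS](tnth_nth false _ (Ordinal lm)) tnth_mktuple /= ffunE /= rE.
by case: ifP => _ //; rewrite ffunE.
Qed.

(** Some hybrid step gains more than [c]; the union bound runs over the step, the seed, the padding
    and the advice. *)
Lemma card_distinguished (W Lb : nat) (c : R) :
  (forall i : 'I_m, \sum_(j < i) 2 ^ #|agree_set i j| <= W)%N ->
  (forall g, (#|[set x | (2 * c <= correlation R t code g x)%R]| <= Lb)%N) ->
  (#|[set x | (m%:R * c < hybrid m x - hybrid 0 x)%R]| <=
    m * 2 ^ d * 2 ^ m * (2 ^ W * Lb))%N.
Proof.
move=> HW HL.
pose inner (p : 'I_m * d.-tuple bool * m.-tuple bool) x :=
  [exists H, (H \in advice p.1.1) && (2 * c <= correlation R t code (predictor p.1.1 p.1.2 p.2 H) x)].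
apply: leq_trans (card_le_sum (D := [set: 'I_m * d.-tuple bool * m.-tuple bool])
  (P := fun x p => inner p x) _) _.
  move=> x; rewrite inE => cx.
  have [i ci] : exists i : 'I_m, c < hybrid i.+1 x - hybrid i x.
    apply/not_existsP => none; move: cx; rewrite ltNge => /negP; apply.
    rewrite -(telescope_sumr (fun i => hybrid i x) (leq0n m)) big_mkord.
    rewrite -[X in X%:R * _]card_ord mulr_natl -sumr_const; apply: ler_sum => i _.
    by rewrite leNgt; apply/negP; exact: none.
  have [u [rho [H HA Hc]]] := exists_predictor ci.
  exists (i, u, rho); rewrite ?inE //.
  by apply/existsP; exists H; rewrite HA.
apply: (@leq_trans (\sum_(p in [set: 'I_m * d.-tuple bool * m.-tuple bool]) 2 ^ W * Lb)%N).
  apply: leq_sum => -[[i u] rho] _.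
  apply: leq_trans (card_le_sum (D := advice i)
    (P := fun x H => 2 * c <= correlation R t code (predictor i u rho H) x) _) _.
    by move=> x; rewrite inE => /existsP[H /andP[HA Hc]]; exists H.
  apply: (@leq_trans (\sum_(H in advice i) Lb)%N).
    by apply: leq_sum => H _; apply: HL.
  by rewrite sum_nat_const leq_mul2r card_advice ?orbT.
by rewrite sum_nat_const cardsT !card_prod card_ord !card_tuple card_bool.
Qed.

End Reconstruction.

Section HybridArgument.

Variables (R : realType) (n d t Q m : nat) (S : nat -> nat -> nat)
  (code : n.-tuple bool -> seq bool -> bool)
  (Ext : n.-tuple bool -> d.-tuple bool -> m.-tuple bool).

Hypotheses (dE : d = (t * Q)%N)
  (S_lt : forall i p, (i < m)%N -> (p < t)%N -> (S i p < Q)%N)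
  (ExtE : forall x u, tval (Ext x u) = mkseq (fun i => code x (select t Q S i u)) m).

Lemma source_le (k : R) (X : {ffun n.-tuple bool -> R}) x :
  is_source k X -> X x <= 2 `^ (- k).
Proof.
move=> [[X0 X1] kX]; set M := \big[Num.max/0]_x X x.
have XM y : X y <= M by rewrite /M; apply: le_bigmax.
have M0 : 0 < M.
  rewrite lt_neqAle (le_trans (X0 x) (XM x)) andbT; apply/negP => /eqP z.
  have : \sum_x X x <= \sum_(x : n.-tuple bool) 0 by apply: ler_sum => y _; rewrite z.
  by rewrite X1 big1 // ler10.
apply: le_trans (XM x) _; rewrite -[M]lnK ?posrE // /powR ifF; last first.
  by apply/negbTE; rewrite pnatr_eq0.
rewrite ler_expR; move: kX; rewrite /min_entropy /log2 -/M.
have l2 : 0 < ln 2 :> R by rewrite ln_gt0 // ltr1n.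
by rewrite lerNr ler_pdivrMr.
Qed.

Lemma stat_dist_test (A : finType) (P U : {ffun A -> R}) :
  \sum_x P x = 1 -> \sum_x U x = 1 ->
  stat_dist P U = \sum_x (U x <= P x)%R%:R * (P x - U x).
Proof.
move=> P1 U1; rewrite /stat_dist mulr_sumr.
have z : \sum_x (P x - U x) = 0 by rewrite sumrB P1 U1 subrr.
rewrite -[LHS]addr0 -{2}(mulr0 2^-1) -[X in 2^-1 * X]z mulr_sumr -big_split /=.
apply: eq_bigr => x _; case: lerP => h.
  by rewrite mul1r; lra.
by rewrite mul0r; lra.
Qed.

Lemma strong_extractor_of_list (W Lb : nat) (k eps : R) : (0 < m)%N -> 0 < eps ->
  (forall i : 'I_m, \sum_(j < i) 2 ^ #|agree_set t S i j| <= W)%N ->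
  (forall g, (#|[set x | (eps / m%:R <= correlation R t code g x)%R]| <= Lb)%N) ->
  (m * 2 ^ d * 2 ^ m * (2 ^ W * Lb))%:R * 2 `^ (- k) <= eps / 2 ->
  strong_extractor k eps Ext.
Proof.
move=> m0 eps0 HW HL small X sX; have [[X0 X1] _] := sX.
set P := dmap _ _; set U := unif _ _.
have U1 : \sum_x U x = 1.
  under eq_bigr do rewrite ffunE.
  by rewrite sumr_const -[_ *+ _]mulr_natl divff // card_tuple card_bool pnatr_eq0 -lt0n expn_gt0.
have law (f : seq bool -> R) : \sum_(z : (d + m).-tuple bool) P z * f z =
    \sum_x X x * tavg d (fun u => f (u ++ mkseq (fun i => code x (select t Q S i u)) m)).
  pose F (w : n.-tuple bool * d.-tuple bool) := cat_tuple w.2 (Ext w.1 w.2).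
  transitivity (\sum_w dprod X (unif R (d.-tuple bool)) w * f (F w)).
    rewrite [RHS](partition_big F xpredT) //=; apply: eq_bigr => z _.
    by rewrite ffunE mulr_suml; apply: eq_bigr => w /eqP <-.
  transitivity (\sum_x \sum_u dprod X (unif R (d.-tuple bool)) (x, u) * f (F (x, u))).
    by rewrite pair_bigA /=; apply: eq_bigr => -[x u].
  apply: eq_bigr => x _; rewrite /tavg /tsum mulr_suml mulr_sumr; apply: eq_bigr => u _; rewrite !ffunE /= ExtE.
  by rewrite card_tuple card_bool natrX; ring.
have lawU (f : seq bool -> R) : \sum_(z : (d + m).-tuple bool) U z * f z = tavg (d + m) f.
  rewrite /tavg /tsum mulr_suml; apply: eq_bigr => z _.
  by rewrite ffunE card_tuple card_bool natrX mulrC.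
pose tup s : (d + m).-tuple bool := [tuple nth false s i | i < d + m].
have tupK (z : (d + m).-tuple bool) : tup z = z.
  by apply: eq_from_tnth => i; rewrite tnth_mktuple (tnth_nth false).
(* The optimal test: its advantage is the statistical distance itself. *)
pose T s := U (tup s) <= P (tup s).
have P1 : \sum_x P x = 1.
  have := law (fun=> 1); under eq_bigr do rewrite mulr1; move=> ->.
  by under eq_bigr do rewrite tavg_cst mulr1.
rewrite stat_dist_test //.
have -> : \sum_x (U x <= P x)%R%:R * (P x - U x) =
    \sum_(z : (d + m).-tuple bool) P z * (T z)%:R -
    \sum_(z : (d + m).-tuple bool) U z * (T z)%:R.
  by rewrite -sumrB; apply: eq_bigr => z _; rewrite /T tupK; ring.
rewrite (law (fun s => (T s)%:R)) (lawU (fun s => (T s)%:R)) tavg_cat.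
pose H i x := @hybrid R n d t Q m S code T i x.
have Hm x : H m x = tavg d (fun u => (T (u ++ mkseq (fun i => code x (select t Q S i u)) m))%:R).
  apply: eq_tavg => u _; rewrite -[RHS](tavg_cst m); apply: eq_tavg => rho _.
  congr (T (_ ++ _))%:R; apply: (@eq_from_nth _ false); rewrite !size_mkseq // => l lm.
  by rewrite !nth_mkseq // lm.
have H0 x : H 0%N x = tavg d (fun u => tavg m (fun s => (T (u ++ s))%:R)).
  apply: eq_tavg => u _; apply: eq_tavg => rho sr.
  congr (T (_ ++ _))%:R; apply: (@eq_from_nth _ false); rewrite size_mkseq // => l lm.
  by rewrite !nth_mkseq.
have H1 i x : 0 <= H i x <= 1.
  apply/andP; split.
    by apply: tavg_ge0 => u _; apply: tavg_ge0 => rho _; exact: ler0n.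
  rewrite -[X in _ <= X](tavg_cst d); apply: ler_tavg => u _.
  rewrite -[X in _ <= X](tavg_cst m); apply: ler_tavg => rho _.
  by rewrite lern1 leq_b1.
set h0 := tavg d _; have {}H0 x : H 0%N x = h0 := H0 x.
under eq_bigr => x _ do rewrite -Hm.
have m0' : m%:R != 0 :> R by rewrite pnatr_eq0 -lt0n.
have -> : \sum_x X x * H m x - h0 = \sum_x X x * (H m x - H 0%N x).
  under [RHS]eq_bigr => x _ do rewrite H0 mulrBr.
  by rewrite sumrB -mulr_suml X1 mul1r.
(* Strings outside [B] contribute at most eps/2 on average, and [B] itself has probability at most
   eps/2. *)
pose c := eps / 2 / m%:R; have mc : m%:R * c = eps / 2 by rewrite /c mulrC divfK.
have c2 : 2 * c = eps / m%:R by rewrite /c; field; rewrite m0'.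
pose B := [set x | m%:R * c < H m x - H 0%N x].
have cardB : (#|B| <= m * 2 ^ d * 2 ^ m * (2 ^ W * Lb))%N.
  by apply: card_distinguished => // g; rewrite c2; apply: HL.
apply: (@le_trans _ _ (\sum_x ((x \in B)%:R * 2 `^ (- k) + X x * (eps / 2)))).
  apply: ler_sum => x _; rewrite inE mc.
  have := X0 x; have := source_le x sX; have /andP[a0 a1] := H1 m x.
  have /andP[b0 b1] := H1 0%N x; case: ltP => h le x0; last by rewrite mul0r add0r ler_wpM2l.
  rewrite mul1r; apply: ler_wpDr; first by rewrite mulr_ge0 // divr_ge0 // ltW.
  by apply: le_trans le; rewrite ler_piMr //; lra.
rewrite big_split /= -!mulr_suml X1 mul1r -natr_sum.
have -> : (\sum_(x : n.-tuple bool) (x \in B) = #|B|)%N.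
  by rewrite -sum1_card [RHS]big_mkcond; apply: eq_bigr => x _; case: (x \in B).
rewrite [leRHS]splitr lerD2r; apply: le_trans small.
by rewrite ler_wpM2r ?powR_ge0 // ler_nat.
Qed.

End HybridArgument.

(** * Parameters *)

Lemma pow3_aboveE X : exists j, pow3_above X = (3 ^ j)%N.
Proof.
rewrite /pow3_above; elim: X => [|X [j IH]] /=; first by exists 0%N.
by rewrite IH; case: ifP => _; [exists j.+1; rewrite expnS|exists j].
Qed.

(** [w0] is the radius of the balls in the list decoding and [W] the overlap bound of the design.
    [mu0] is a lower bound for the density of differing positions at distance above [w0], as 2^N <=
    2n + 1. *)
Lemma extractor_strong (R : realType) A C k e n (kr eps : R) (w0 W : nat)
  (m := output_length k e n) (t := index_length A C e n) (Q := alphabet A C e n)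
  (h := field_param A n) (N := bitlen n) (rho := eps / m%:R)
  (mu0 := w0.+1%:R / (2 * n + 1)%:R : R) :
  (0 < m)%N -> 0 < eps ->
  (2 * (N%:R / 2 ^+ h / mu0 + (2 ^+ h)^-1 + N%:R / 2 ^+ h)) ^+ walk_length A C e n <=
    (rho ^+ 2 / 2) ^+ 2 ->
  (m * Q.+1 ^ t <= W * Q ^ t)%N -> (W <= n)%N ->
  (m * 2 ^ seed_length A C e n * 2 ^ m * 2 ^ W)%:R *
    (2 / rho ^+ 2 * (n.+1 ^ w0)%:R) * 2 `^ (- kr) <= eps / 2 ->
  strong_extractor kr eps (@extractor_tuple A C k e n).
Proof.
move=> m0 eps0 bias WQ Wn small.
set w := walk_length A C e n in bias.
have Q0 : (0 < Q)%N by rewrite muln_gt0.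
have rho0 : 0 < rho by rewrite divr_gt0 // ltr0n.
have mu00 : 0 < mu0 by rewrite divr_gt0 // ltr0n addn1.
pose code (x : n.-tuple bool) (r : seq bool) := code_bit N h w x r.
have far (x x' : n.-tuple bool) : (w0 < hdist x x')%N ->
    tavg t (fun r => sgn R (code x r (+) code x' r)) <= rho ^+ 2 / 2.
  move=> xx; have [j hj] := pow3_aboveE (A * (bitlen N).+1).
  have := @code_bias R n x x' j w mu0 mu00; rewrite -hj -/(field_param A n) -/h -/N => cb.
  have r2 : 0 <= rho ^+ 2 / 2 by rewrite divr_ge0 // sqr_ge0.
  rewrite leNgt; apply/negP => lt.
  have : (rho ^+ 2 / 2) ^+ 2 < tavg t (fun r => sgn R (code x r (+) code x' r)) ^+ 2.
    by rewrite ltr_pXn2r // nnegrE // (le_trans r2) // ltW.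
  rewrite ltNge => /negP; apply; apply: le_trans bias; apply: cb.
  rewrite ler_pM ?invr_ge0 // ?ler_nat //.
  rewrite lef_pV2 ?posrE ?pow2_gt0 ?ltr0n ?addn1 // -natrX ler_nat.
  by have := bitlen_le n; rewrite addn1.
have list g := @card_list R n t code g rho w0 rho0 far.
set lb := 2 / rho ^+ 2 * _ in list small.
have lb0 : 0 <= lb by rewrite mulr_ge0 // divr_ge0 // sqr_ge0.
apply: (@strong_extractor_of_list R n _ t Q m (word_letter n t Q) code _ _ _ _ W
  (Num.truncn lb)) => //.
- by move=> i p _ _; apply: entry_lt.
- move=> x u; rewrite extractor_tupleE /extractor size_tuple.
  apply: (@eq_from_nth _ false); rewrite !size_mkseq // => i im.
  by rewrite !nth_mkseq // seed_select_design.
- move=> i; under eq_bigr => j _ do rewrite card_agree_set //.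
  have iW : (i * Q.+1 ^ t <= W * Q ^ t)%N.
    by apply: leq_trans WQ; rewrite leq_mul2r ltnW ?orbT // ltn_ord.
  have iB : (i * Q.+1 ^ t <= n * Q ^ t)%N.
    by apply: leq_trans iW _; rewrite leq_mul2r Wn orbT.
  have Qt : (0 < Q ^ t)%N by rewrite expn_gt0 Q0.
  rewrite -(leq_pmul2r Qt); apply: leq_trans iW; exact: weak_design.
- by move=> g; rewrite truncn_ge_nat //; apply: list.
apply: le_trans small; rewrite ler_wpM2r ?powR_ge0 // mulnA natrM.
by rewrite ler_wpM2l // truncn_le.
Qed.

Definition read_position (N n : nat) (v : seq bool) : nat :=
  \sum_(i < N) nth false v i * minn (2 ^ i) n.

Lemma extractor_locality A C k e n :
  has_locality (@extractor_tuple A C k e n)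
    (walk_length A C e n * 2 ^ field_param A n)%N.
Proof.
move=> u i; set w := walk_length A C e n; set h := field_param A n; set N := bitlen n.
set r := seed_select (index_length A C e n) (alphabet A C e n)
  (design n (index_length A C e n) (alphabet A C e n)
     (output_length k e n * index_length A C e n)) i u.
pose pos (q : 'I_w * 'I_(2 ^ h)) := read_position N n
  (xorv N (vertex N h r q.1) (shift_vec N h (subword (2 * h) (N + q.1 * (7 * h)) r) (bits h q.2))).
exists [set p : 'I_n | [exists q, pos q == p]].
  apply: leq_trans (card_le_sum (D := [set: 'I_w * 'I_(2 ^ h)]) (P := fun (p : 'I_n) q => pos q == p) _) _.
    by move=> p; rewrite inE => /existsP[q qp]; exists q; rewrite ?inE.
  apply: (@leq_trans (\sum_(q in [set: 'I_w * 'I_(2 ^ h)]) 1)%N).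
    apply: leq_sum => q _; apply/card_le1_eqP => p p'; rewrite !inE.
    by move=> /eqP e1 /eqP e2; apply: val_inj; rewrite /= -e1.
  by rewrite sum1_card cardsT card_prod !card_ord.
move=> x y xy; rewrite !tnth_mktuple -/w -/h -/N -/r.
apply: eq_bigr => a _; apply: eq_bigr => b _; congr (_ && _).
rewrite /read_at !size_tuple -/(read_position N n _) -/(pos (a, b)).
have [lt|ge] := ltnP (pos (a, b)) n; last by rewrite !nth_default ?size_tuple.
have := xy (Ordinal lt); rewrite !(tnth_nth false) /=; apply.
by rewrite inE; apply/existsP; exists (a, b).
Qed.

Lemma ln2_ge_half (R : realType) : 2^-1 <= ln 2 :> R.
Proof.
have lt : -1 < - 2^-1 :> R by lra.
have := le_ln1Dx lt; rewrite (_ : 1 + - 2^-1 = 2^-1 :> R); last by lra.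
by rewrite lnV ?posrE // lerN2.
Qed.

(** With x = n^(1/10), the terms stand for four output lengths, the seed, the design overlap, three
    times log(1/eps) and the logarithm of the volume of a ball. *)
Lemma size_budget (R : realType) (x kr : R) : 100 <= x -> x ^+ 9 <= kr ->
  4 * (2 * x ^+ 2) + 64 * x ^+ 4 + 4 * x ^+ 5 + 3 * (x + 1) + 2 + kr / 4 <= kr.
Proof.
move=> x100 kr9; have x1 : 1 <= x by lra.
have le i j : (i <= j)%N -> x ^+ i <= x ^+ j by move=> ij; exact: ler_weXn2l.
have h2 := le 2%N 5%N isT; have h4 := le 4%N 5%N isT; have h1 := le 1%N 5%N isT.
have h0 := le 0%N 5%N isT; rewrite expr1 in h1; rewrite expr0 in h0.
have x0 : 0 <= x by lra.
have h6 : 100 * x ^+ 5 <= x ^+ 6 by have := ler_wpM2r (exprn_ge0 5 x0) x100; rewrite -exprS.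
have h3 : 2 <= x ^+ 3 by apply: (@le_trans _ _ (x ^+ 1)); [rewrite expr1; lra|exact: le].
have h9 : x ^+ 6 * 2 <= x ^+ 9 by rewrite (exprD _ 6 3) ler_wpM2l // exprn_ge0.
by move: h2 h4 h1 h0 h6 h9 kr9; move: (x ^+ 2) (x ^+ 4) (x ^+ 5) (x ^+ 6) (x ^+ 9) => *; lra.
Qed.

Lemma length_budget (R : realType) (x b c : R) : 100 <= x -> b <= x -> c <= x + 1 ->
  92 * (b + c) <= 2 * x ^+ 2.
Proof. by move=> x100 bx cx; rewrite expr2; nra. Qed.

Lemma output_budget (R : realType) (x : R) : 100 <= x -> (x + 1) * x <= 2 * x ^+ 2.
Proof. by move=> x100; rewrite expr2; nra. Qed.

Lemma design_budget (R : realType) (x : R) : 100 <= x ->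
  2 * x ^+ 2 * x ^+ 3 <= 4 * x ^+ 5 - 1 /\ 4 * x ^+ 5 <= x ^+ 10.
Proof.
move=> x100; have x1 : 1 <= x by lra.
have h5 : 100 <= x ^+ 5.
  by apply: (le_trans x100); rewrite -[leLHS]expr1; exact: ler_weXn2l.
have -> : 2 * x ^+ 2 * x ^+ 3 = 2 * x ^+ 5 by ring.
by rewrite (exprD _ 5 5); split; nra.
Qed.

Lemma exponent_regroup (x y z u v : nat) :
  (x + y + x + z + 1 + (2 * x + 2 * u) + v + u + 1 = 4 * x + y + z + 3 * u + 2 + v)%N.
Proof. ring. Qed.

(** * Estimates in terms of X = n^(1/10) *)

Section Estimates.

Variables (R : realType) (a n k e : nat) (kr eps X : R).

Let A := (2 * a + 10)%N.
Let N := bitlen n.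
Let h := field_param A n.
Let w := walk_length A 13 e n.
Let t := index_length A 13 e n.
Let Q := alphabet A 13 e n.
Let d := seed_length A 13 e n.
Let m := output_length k e n.

Hypotheses (n_gt0 : (0 < n)%N) (hN_ge : (h <= N)%N).

Lemma bitlen_gt0 : (0 < N)%N.
Proof. by rewrite ltn_bitlen expn0. Qed.

Lemma field_param_gt0 : (0 < h)%N.
Proof. by have [_] := pow3_above_bounds (A * (bitlen N).+1); apply: leq_ltn_trans. Qed.

(** Rounding loses less than h <= N out of 13(N + e). *)
Lemma walk_length_ge : (12 * (N + e) <= h * w)%N.
Proof.
(* [lia] would otherwise make the statement depend on [k], through [m]. *)
clear m d Q t.
have := divn_eq (13 * (N + e)) h; rewrite -/(walk_length A 13 e n) -/w.
have := ltn_pmod (13 * (N + e)) field_param_gt0; rewrite -/N -/h; lia.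
Qed.

Lemma walk_length_le : (h * w <= 13 * (N + e))%N.
Proof. by rewrite mulnC leq_divM. Qed.

Lemma index_length_ge : (84 * (N + e) <= t)%N.
Proof.
clear m d Q; have := walk_length_ge.
by rewrite /t /index_length -/N -/h -/w; lia.
Qed.

Lemma index_length_le : (t <= 92 * (N + e))%N.
Proof.
clear m d Q hN_ge n_gt0; have := walk_length_le.
by rewrite /t /index_length -/N -/h -/w; lia.
Qed.

Lemma exp2_field_param_ge : ((2 * N) ^ A <= 2 ^ h)%N.
Proof.
have [_ lt] := pow3_above_bounds (A * (bitlen N).+1).
apply: (@leq_trans (2 ^ (A * (bitlen N).+1))%N); last by rewrite leq_pexp2l // ltnW.
by rewrite [(A * _)%N]mulnC expnM leq_expr // expnS leq_mul2l /= ltnW // bitlen_gt.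
Qed.

(** The factor is at most 28 N^(a+2) 2^-h, and 2^h >= (2N)^(2a+10) absorbs the square of 28
    N^(a+2). *)
Lemma walk_factor_le (mu0 : R) : 0 < mu0 -> mu0^-1 <= 12 * N%:R ^+ a.+1 ->
  (2 * (N%:R / 2 ^+ h / mu0 + (2 ^+ h)^-1 + N%:R / 2 ^+ h)) ^+ 2 <= (2 ^+ h)^-1.
Proof.
move=> mu00 mu0N; set y := (2 ^+ h)^-1; have y0 : 0 < y by rewrite invr_gt0 exprn_gt0.
have N1 : 1 <= N%:R :> R by rewrite ler1n bitlen_gt0.
have Na : N%:R * N%:R ^+ a.+1 = N%:R ^+ a.+2 :> R by rewrite -exprS.
have Np : N%:R <= N%:R ^+ a.+2 :> R by rewrite exprS ler_peMr // exprn_ege1.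
have le : 2 * (N%:R * y / mu0 + y + N%:R * y) <= 28 * N%:R ^+ a.+2 * y.
  have : N%:R * y / mu0 <= 12 * N%:R ^+ a.+2 * y.
    rewrite mulrAC ler_pM2r // -Na mulrCA ler_wpM2l //; lra.
  have : y <= N%:R ^+ a.+2 * y by apply: ler_peMl; [exact: ltW | exact: le_trans Np].
  have : N%:R * y <= N%:R ^+ a.+2 * y by rewrite ler_pM2r.
  lra.
have z0 : 0 <= 2 * (N%:R * y / mu0 + y + N%:R * y).
  have y0' := ltW y0; have mu0' := ltW mu00.
  by rewrite mulr_ge0 // !addr_ge0 ?mulr_ge0 ?invr_ge0.
apply: (@le_trans _ _ ((28 * N%:R ^+ a.+2 * y) ^+ 2)).
  by apply: lerXn2r; rewrite ?nnegrE // (le_trans z0).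
rewrite exprMn expr2 [y ^+ 2]expr2 mulrA ger_pMl //.
rewrite /y ler_pdivrMr ?exprn_gt0 // mul1r.
have := exp2_field_param_ge; rewrite -(ler_nat R) !natrX natrM => le2.
apply: le_trans le2; rewrite exprMn /A.
have -> : N%:R ^+ (2 * a + 10) = N%:R ^+ a.+2 * N%:R ^+ a.+2 * N%:R ^+ 6 :> R.
  by rewrite -!exprD; congr (_ ^+ _); lia.
have -> : 2 ^+ (2 * a + 10) = 2 ^+ a * 2 ^+ a * 2 ^+ 10 :> R.
  by rewrite mul2n -addnn !exprD.
set u := N%:R ^+ a.+2; have u0 : 0 <= u * u by rewrite -expr2 sqr_ge0.
have N6 : 1 <= N%:R ^+ 6 :> R by rewrite exprn_ege1.
have v1 : 1 <= 2 ^+ a * 2 ^+ a :> R by rewrite -expr2 exprn_ege1 // exprn_ege1 // ler1n.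
rewrite (_ : 28 * u * (28 * u) = 28 * 28 * (u * u)); last by ring.
apply: ler_pM => //.
  apply: (@le_trans _ _ (2 ^+ 10)).
    by rewrite -natrM -natrX ler_nat.
  by rewrite ler_peMl // exprn_ge0.
by rewrite ler_peMr.
Qed.

Hypotheses (eps_gt0 : 0 < eps) (eps_ge : (2 ^+ e)^-1 <= eps) (m_gt0 : (0 < m)%N)
  (m_le : (m <= 2 ^ N)%N).

(** theta^w is at most 2^(-hw/2) <= 2^(-6(N+e)), whereas eps/m >= 2^-(N+e). *)
Lemma bias_small (theta : R) : 0 <= theta -> theta ^+ 2 <= (2 ^+ h)^-1 ->
  theta ^+ w <= ((eps / m%:R) ^+ 2 / 2) ^+ 2.
Proof.
move=> th0 th2; set rho := eps / m%:R.
have m0 : 0 < m%:R :> R by rewrite ltr0n.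
have rho0 : 0 <= rho by rewrite divr_ge0 // ltW.
have r2 : 0 <= rho ^+ 2 / 2 by rewrite divr_ge0 // sqr_ge0.
rewrite -(@ler_pXn2r _ 2) ?nnegrE ?exprn_ge0 //.
rewrite -exprM mulnC exprM.
apply: (@le_trans _ _ ((2 ^+ h)^-1 ^+ w)).
  by apply: lerXn2r; rewrite ?nnegrE ?exprn_ge0 // invr_ge0 exprn_ge0.
rewrite exprVn -exprM.
have -> : (rho ^+ 2 / 2) ^+ 2 ^+ 2 = (rho / 2) ^+ 8 * 2 ^+ 4 by field.
have rl : (2 ^+ (e + N))^-1 <= rho.
  rewrite exprD invfM ler_pM ?invr_ge0 ?exprn_ge0 //.
  by rewrite lef_pV2 ?posrE ?exprn_gt0 // -natrX ler_nat.
apply: (@le_trans _ _ (((2 ^+ (e + N))^-1 / 2) ^+ 8 * 2 ^+ 4)); last first.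
  rewrite ler_pM2r ?exprn_gt0 //; apply: lerXn2r; rewrite ?nnegrE.
  - by rewrite divr_ge0 // invr_ge0 exprn_ge0.
  - by rewrite divr_ge0.
  - by rewrite ler_pM2r ?invr_gt0.
have -> : ((2 ^+ (e + N))^-1 / 2) ^+ 8 * 2 ^+ 4 = (2 ^+ (8 * (e + N) + 4))^-1 :> R.
  by rewrite exprMn exprVn -exprM [in RHS]exprD [(8 * _)%N]mulnC invfM -mulrA; congr (_ * _); field.
rewrite lef_pV2 ?posrE ?exprn_gt0 // ler_eXn2l ?ltr1n //.
have := walk_length_ge; have := bitlen_gt0; lia.
Qed.

Hypotheses (X_ge : 100 <= X) (nX : n%:R = X ^+ 10).

Lemma X_ge0 : 0 <= X.
Proof. exact: le_trans X_ge. Qed.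

(** The left side is at most exp(t/Q) <= exp(N/8), and exp(N/2) <= 2^N <= 2n + 1 <= X^12. *)
Lemma alphabet_growth : (1 + Q%:R^-1) ^+ t <= X ^+ 3 :> R.
Proof.
have Q0 : 0 < Q%:R :> R by rewrite ltr0n muln_gt0.
have N0 : 0 < N%:R :> R by rewrite ltr0n bitlen_gt0.
have tQ : t%:R / Q%:R <= N%:R / 8 :> R.
  have := ltn_ceil t bitlen_gt0; rewrite -/N => /ltnW lt.
  have : (8 * t <= N * Q)%N by rewrite /Q /alphabet -/t -/N mulnCA leq_mul2l mulnC lt orbT.
  rewrite -(ler_nat R) !natrM => le.
  by rewrite ler_pdivrMr // mulrAC ler_pdivlMr // mulrC.
have x0 : 0 <= (1 + Q%:R^-1) ^+ t :> R by rewrite exprn_ge0 // addr_ge0 // invr_ge0 ltW.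
rewrite -(@ler_pXn2r _ 4) ?nnegrE ?exprn_ge0 ?X_ge0 //.
apply: (@le_trans _ _ (expR (N%:R / 2))).
  apply: (@le_trans _ _ (expR (t%:R / Q%:R) ^+ 4)).
    apply: lerXn2r; rewrite ?nnegrE ?expR_ge0 //.
    apply: (@le_trans _ _ (expR (Q%:R^-1) ^+ t)).
      have Qi : 0 <= Q%:R^-1 :> R by rewrite invr_ge0 ltW.
      apply: lerXn2r; rewrite ?nnegrE ?expR_ge0 ?addr_ge0 //.
      exact: expR_ge1Dx.
    by rewrite -expRM_natl.
  rewrite -expRM_natl ler_expR (_ : N%:R / 2 = 4%:R * (N%:R / 8)) ?ler_pM2l //.
  by field.
apply: (@le_trans _ _ (2 ^+ N)).
  by rewrite -[X in X ^+ N](@lnK R) ?posrE // -expRM_natl ler_expR ler_wpM2l // ln2_ge_half.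
have : (2 ^ N)%:R <= (2 * n + 1)%:R :> R by rewrite ler_nat bitlen_le.
rewrite natrX natrD natrM nX => le; apply: le_trans le _.
rewrite -exprM (_ : 3 * 4 = 10 + 2)%N // exprD.
have u1 : 1 <= X ^+ 10 by rewrite exprn_ege1 // (le_trans _ X_ge) // ler1n.
rewrite [leRHS]mulrC; apply: (@le_trans _ _ (3 * X ^+ 10)).
  rewrite (_ : 3 * X ^+ 10 = 2 * X ^+ 10 + X ^+ 10) ?lerD2l //; ring.
rewrite ler_wpM2r ?(le_trans _ u1) // expr2 (@le_trans _ _ (100 * 100)) //.
  by rewrite -natrM ler_nat.
exact: ler_pM.
Qed.

Hypotheses (kr_ge : X ^+ 9 <= kr) (n_le_kr : n%:R <= kr * N%:R ^+ a)
  (k_le : (k <= n)%N) (e_le : e%:R <= X + 1) (N_le : N%:R <= X)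
  (root_le : (2 ^ (N.-1 %/ 10800))%:R <= X).

Lemma output_length_le : m%:R <= 2 * X ^+ 2.
Proof.
apply: le_trans (output_budget X_ge).
apply: (@le_trans _ _ (e * 2 ^ (N.-1 %/ 10800))%:R).
  rewrite ler_nat /m /output_length -/N -(@mulKn (e * 2 ^ (N.-1 %/ 10800)) n n_gt0).
  by apply: leq_div2r; rewrite mulnA !leq_mul2r k_le !orbT.
by rewrite natrM ler_pM.
Qed.

Lemma index_length_leX : t%:R <= 2 * X ^+ 2.
Proof.
apply: le_trans (length_budget X_ge N_le e_le).
by rewrite -natrD -natrM ler_nat index_length_le.
Qed.

Lemma seed_length_leX : d%:R <= 64 * X ^+ 4.
Proof.
have t0 : (0 < t)%N.
  by apply: leq_trans index_length_ge; rewrite muln_gt0 addn_gt0 bitlen_gt0.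
have dt : (d <= 16 * t ^ 2)%N.
  rewrite /d /seed_length -/t /alphabet -/t -/N.
  have := leq_div t N; set q := (t %/ N)%N => qt; rewrite expnS expn1; nia.
apply: (@le_trans _ _ (16 * t ^ 2)%:R); first by rewrite ler_nat.
have T2 : t%:R ^+ 2 <= (2 * X ^+ 2) ^+ 2.
  by apply: lerXn2r (index_length_leX); rewrite nnegrE // mulr_ge0 // exprn_ge0 // X_ge0.
rewrite natrM natrX (_ : 64 * X ^+ 4 = 16 * (2 * X ^+ 2) ^+ 2); last by ring.
by rewrite ler_wpM2l.
Qed.

(** A ball of this radius has at most 2^(k/4) elements, yet its relative radius is only
    polylogarithmically small ([density_ge]). *)
Let w0 := Num.truncn (kr / (4 * N%:R)).
(** Above m (1 + 1/Q)^t, which is at most 2 X^5. *)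
Let W := Num.truncn (4 * X ^+ 5).

Let kr_ge0 : 0 <= kr.
Proof. by apply: le_trans kr_ge; rewrite exprn_ge0 // X_ge0. Qed.

Let X5_ge0 : 0 <= 4 * X ^+ 5.
Proof. by rewrite mulr_ge0 // exprn_ge0 // X_ge0. Qed.

Let N_gt0 : 0 < N%:R :> R. Proof. by rewrite ltr0n bitlen_gt0. Qed.

Lemma advice_le : W%:R <= 4 * X ^+ 5. Proof. by rewrite truncn_le. Qed.

Lemma radius_le : (N * w0)%:R <= kr / 4.
Proof.
have : w0%:R <= kr / (4 * N%:R) by rewrite truncn_le divr_ge0 // mulr_ge0 // ltW.
rewrite invfM mulrA ler_pdivlMr // => le; by rewrite natrM mulrC.
Qed.

Lemma density_ge : (w0.+1%:R / (2 * n + 1)%:R : R)^-1 <= 12 * N%:R ^+ a.+1.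
Proof.
rewrite invf_div ler_pdivrMr ?ltr0n //.
have lt : kr / (4 * N%:R) <= w0.+1%:R by apply: ltW; exact: truncnS_gt.
have lt' : kr <= 4 * (N%:R * w0.+1%:R).
  by move: lt; rewrite ler_pdivrMr ?mulr_gt0 // mulrC -mulrA.
apply: (@le_trans _ _ (3 * n%:R)).
  by rewrite -natrM ler_nat (mulSn 2) addnC leq_add2r.
rewrite (_ : 12 * N%:R ^+ a.+1 * w0.+1%:R = 3 * ((4 * (N%:R * w0.+1%:R)) * N%:R ^+ a)).
  rewrite ler_wpM2l //; apply: le_trans n_le_kr _.
  by rewrite ler_wpM2r // exprn_ge0.
by rewrite exprS; ring.
Qed.

(** In order: hybrid step (m <= 2^m), seed, padding, advice, the factor 2/rho^2 of the list size for
    rho = eps/m, the ball, and eps/2. *)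
Lemma exponent_budget :
  (m + seed_length A 13 e n + m + W + 1 + (2 * m + 2 * e) + N * w0 + e + 1)%:R <= kr.
Proof.
apply: le_trans (size_budget X_ge kr_ge); rewrite -/d.
rewrite exponent_regroup 5!natrD; apply: lerD radius_le; rewrite lerD2r.
apply: lerD; last by rewrite natrM ler_wpM2l.
apply: lerD advice_le; apply: lerD seed_length_leX.
by rewrite natrM ler_wpM2l // output_length_le.
Qed.

Lemma strong_at : strong_extractor kr eps (@extractor_tuple A 13 k e n).
Proof.
have [bud1 bud2] := design_budget X_ge.
have Q0 : 0 < Q%:R :> R by rewrite ltr0n muln_gt0.
have m0 : 0 < m%:R :> R by rewrite ltr0n.
apply: (@extractor_strong R A 13 k e n kr eps w0 W) => //; rewrite -/m -/t -/Q -/h -/N.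
- apply: bias_small; last first.
    by apply: walk_factor_le; [rewrite divr_gt0 ?ltr0n // addn1|exact: density_ge].
  by rewrite mulr_ge0 // !addr_ge0 // ?mulr_ge0 // ?invr_ge0 ?exprn_ge0 // mulr_ge0 // invr_ge0.
- rewrite -(ler_nat R) !natrM !natrX -ler_pdivrMr ?exprn_gt0 //.
  rewrite -mulrA -expr_div_n (_ : Q.+1%:R / Q%:R = 1 + Q%:R^-1); last first.
    by rewrite -addn1 natrD mulrDl divff ?gt_eqF // mul1r.
  apply: (@le_trans _ _ (2 * X ^+ 2 * X ^+ 3)).
    by rewrite ler_pM // ?exprn_ge0 // ?addr_ge0 ?invr_ge0 ?output_length_le
      ?alphabet_growth // ltW.
  apply: le_trans bud1 _; rewrite lerBlDr natr1; apply: ltW; exact: truncnS_gt.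
- by rewrite -(ler_nat R) nX; apply: le_trans advice_le bud2.
set T := (m + seed_length A 13 e n + m + W + 1 + (2 * m + 2 * e) + N * w0)%N.
have krT : 2 `^ (- kr) <= (2 ^+ (T + e + 1))^-1.
  rewrite -powR_mulrn // -powRN ler_powR ?ler1n // lerN2; exact: exponent_budget.
have ie : eps^-1 <= 2 ^+ e by rewrite -[leRHS]invrK lef_pV2 ?posrE // invr_gt0 exprn_gt0.
have mm : m%:R <= 2 ^+ m :> R by rewrite -natrX ler_nat ltnW // ltn_expl.
have rhoi : (eps / m%:R) ^- 2 <= 2 ^+ (2 * m + 2 * e).
  rewrite -exprVn invf_div -mulnDr mulnC exprM; apply: lerXn2r; rewrite ?nnegrE ?exprn_ge0 //.
    by rewrite divr_ge0 // ltW.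
  by rewrite exprD ler_pM // invr_ge0 ltW.
have ri0 : 0 <= (eps / m%:R) ^- 2 by rewrite invr_ge0 sqr_ge0.
have TE : 2 ^+ T = 2 ^+ (m + seed_length A 13 e n + m + W) *
    (2 * 2 ^+ (2 * m + 2 * e) * 2 ^+ (N * w0)) :> R.
  by rewrite -exprS -!exprD; congr (_ ^+ _); rewrite /T -!addnA.
apply: (@le_trans _ _ (2 ^+ T * (2 ^+ (T + e + 1))^-1)).
  apply: ler_pM; rewrite ?powR_ge0 //; first by rewrite mulr_ge0 // mulr_ge0 // mulr_ge0.
  rewrite TE; apply: ler_pM => //; first by rewrite mulr_ge0 // mulr_ge0.
    by rewrite -natrX ler_nat !expnD !leq_mul // ltnW // ltn_expl.
  apply: ler_pM => //; first by rewrite mulr_ge0.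
    by rewrite ler_wpM2l.
  by rewrite -natrX ler_nat expnM leq_expr // bitlen_gt.
rewrite -addnA exprD invfM mulrA divff ?mul1r; last by rewrite expf_neq0.
by rewrite addn1 exprSr invfM ler_pM2r // invr_gt0.
Qed.

End Estimates.

Import numFieldNormedType.Exports.
Local Open Scope classical_set_scope.
Local Open Scope ring_scope.

(** * Asymptotics *)

Lemma near_bigTheta (R : realType) (f g : nat -> R) (k1 k2 : R) : 0 < k1 -> 0 < k2 ->
  (\forall n \near \oo, [/\ 0 <= g n, k1 * g n <= f n & f n <= k2 * g n]) ->
  f =Theta_\oo g.
Proof.
move=> k10 k20 H; rewrite eqThetaE qualifE; apply/asboolP; exists (k1, k2) => /=.
  by rewrite k10 k20.
near=> n; have [g0 h1 h2] : [/\ 0 <= g n, k1 * g n <= f n & f n <= k2 * g n].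
  by near: n.
rewrite (ger0_norm g0) ger0_norm //; apply: le_trans h1.
by rewrite mulr_ge0 // ltW.
Unshelve. all: by end_near. Qed.

Section Log.

Variable R : realType.
Implicit Types x y c : R.

Lemma ln2_gt0 : 0 < ln 2 :> R.
Proof. by rewrite ln_gt0 // ltr1n. Qed.

Lemma log2_le_nat x k : 0 < x -> x <= 2 ^+ k -> log2 x <= k%:R.
Proof.
move=> x0 xk; rewrite /log2 ler_pdivrMr ?ln2_gt0 // mulr_natl -lnXn //.
by rewrite ler_ln ?posrE // exprn_gt0.
Qed.

Lemma nat_le_log2 x k : 2 ^+ k <= x -> k%:R <= log2 x.
Proof.
move=> xk; rewrite /log2 ler_pdivlMr ?ln2_gt0 // mulr_natl -lnXn //.
by rewrite ler_ln ?posrE ?exprn_gt0 // (lt_le_trans _ xk) // exprn_gt0.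
Qed.

Lemma powR2_log2 x : 0 < x -> 2 `^ (log2 x) = x.
Proof.
by move=> x0; rewrite /powR pnatr_eq0 /= /log2 divfK ?gt_eqF ?ln2_gt0 // lnK.
Qed.

Lemma log2V x : 0 < x -> log2 x^-1 = - log2 x.
Proof. by move=> x0; rewrite /log2 lnV // mulNr. Qed.

Lemma ler_log2 x y : 0 < x -> x <= y -> log2 x <= log2 y.
Proof.
move=> x0 xy; rewrite /log2 ler_pM2r ?invr_gt0 ?ln2_gt0 // ler_ln ?posrE //.
exact: lt_le_trans xy.
Qed.

Lemma log2_powR y : log2 (2 `^ y) = y.
Proof. by rewrite /log2 ln_powR mulfK // gt_eqF ?ln2_gt0. Qed.

Lemma log2_gt0 x : 1 < x -> 0 < log2 x.
Proof. by move=> x1; rewrite divr_gt0 ?ln2_gt0 // ln_gt0. Qed.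

Lemma bitlen_log2 n : (0 < n)%N ->
  log2 (n%:R : R) <= (bitlen n)%:R <= log2 (n%:R : R) + 1.
Proof.
move=> n0; apply/andP; split.
  by apply: log2_le_nat; rewrite ?ltr0n // -natrX ler_nat ltnW // bitlen_gt.
have b0 : (0 < bitlen n)%N by rewrite ltn_bitlen expn0.
rewrite -(prednK b0) -natr1 lerD2r; apply: nat_le_log2.
by rewrite -natrX ler_nat -ltn_bitlen prednK.
Qed.

Lemma root_exprn x k : 0 <= x -> (0 < k)%N -> (x ^+ k) `^ k%:R^-1 = x.
Proof.
move=> x0 k0; rewrite -powR_mulrn // -powRrM divff ?powRr1 //.
by rewrite pnatr_eq0 -lt0n.
Qed.

Lemma exprn_root x k : 0 <= x -> (0 < k)%N -> (x `^ k%:R^-1) ^+ k = x.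
Proof.
move=> x0 k0; rewrite -powR_mulrn ?powR_ge0 // -powRrM mulVf ?powRr1 //.
by rewrite pnatr_eq0 -lt0n.
Qed.

Lemma root_le x y k : 0 <= x -> 0 <= y -> (0 < k)%N -> x <= y ^+ k -> x `^ k%:R^-1 <= y.
Proof.
move=> x0 y0 k0 xy; rewrite -[leRHS](@root_exprn y k) //.
by apply: ge0_ler_powR; rewrite ?nnegrE ?invr_ge0 ?exprn_ge0.
Qed.

Lemma root_ge x y k : 0 <= x -> 0 <= y -> (0 < k)%N -> y ^+ k <= x -> y <= x `^ k%:R^-1.
Proof.
move=> x0 y0 k0 xy; rewrite -[leLHS](@root_exprn y k) //.
by apply: ge0_ler_powR; rewrite ?nnegrE ?invr_ge0 ?exprn_ge0.
Qed.

Lemma exp2_root n k : (0 < n)%N -> (0 < k)%N ->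
  (2 ^ ((bitlen n).-1 %/ k))%:R <= (n%:R : R) `^ k%:R^-1 <=
  2 * (2 ^ ((bitlen n).-1 %/ k))%:R.
Proof.
move=> n0 k0; have b0 : (0 < bitlen n)%N by rewrite ltn_bitlen expn0.
apply/andP; split.
  apply: root_ge => //; rewrite -natrX ler_nat -expnM.
  apply: (@leq_trans (2 ^ (bitlen n).-1)%N); first by rewrite leq_pexp2l // leq_divM.
  by rewrite -ltn_bitlen prednK.
rewrite -natrM -expnS; apply: root_le => //; rewrite -natrX ler_nat -expnM.
apply: leq_trans (ltnW (bitlen_gt n)) _; rewrite leq_pexp2l //.
by have := ltn_ceil (bitlen n).-1 k0; rewrite prednK.
Qed.

Lemma near_log2_ge c : \forall n \near \oo, c <= log2 n%:R.
Proof.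
near=> n; rewrite -[leLHS]log2_powR; apply: ler_log2; first exact: powR_gt0.
by near: n; exact: nbhs_infty_ger.
Unshelve. all: by end_near. Qed.

Lemma near_powR_ge c M : 0 < c -> \forall n \near \oo, M <= n%:R `^ c.
Proof.
move=> c0; near=> n; have n1 : 1 <= n%:R :> R by near: n; exact: nbhs_infty_ger.
have n0 : 0 < n%:R :> R by apply: lt_le_trans n1.
have : M / (c * ln 2) <= log2 n%:R by near: n; exact: near_log2_ge.
rewrite ler_pdivrMr ?mulr_gt0 ?ln2_gt0 // mulrCA /log2 divfK ?gt_eqF ?ln2_gt0 // => h.
rewrite /powR gt_eqF //; apply: le_trans (expR_ge1Dx _).
by apply: le_trans h _; rewrite lerDr.
Unshelve. all: by end_near. Qed.

(** With y = n^(c/(p+1)), log n <= C y, and one spare factor y absorbs K C^p. *)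
Lemma near_log2_poly c K p : 0 < c ->
  \forall n \near \oo, K * log2 n%:R ^+ p <= n%:R `^ c.
Proof.
move=> c0; pose c' := c / p.+1%:R; have c'0 : 0 < c' by rewrite divr_gt0 // ltr0n.
pose C := (c' * ln 2)^-1; have C0 : 0 < C by rewrite invr_gt0 mulr_gt0 ?ln2_gt0.
near=> n; have n1 : 1 <= n%:R :> R by near: n; exact: nbhs_infty_ger.
have n0 : 0 < n%:R :> R by apply: lt_le_trans n1.
set y := n%:R `^ c'; have y0 : 0 < y by exact: powR_gt0.
have -> : n%:R `^ c = y ^+ p.+1.
  by rewrite -powR_mulrn ?powR_ge0 // /y -powRrM /c' divfK // pnatr_eq0.
have l0 : 0 <= log2 n%:R :> R by near: n; exact: near_log2_ge.
have ly : log2 n%:R <= C * y.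
  rewrite /log2 ler_pdivrMr ?ln2_gt0 //.
  have -> : C * y * ln 2 = y / c' by rewrite /C; field; rewrite !gt_eqF ?ln2_gt0.
  by rewrite ler_pdivlMr // mulrC -ln_powR ltW // ln_sublinear.
have Ky : `|K| * C ^+ p <= y by rewrite /y; near: n; exact: near_powR_ge.
apply: (@le_trans _ _ (`|K| * (C * y) ^+ p)).
  apply: (@le_trans _ _ (`|K| * log2 n%:R ^+ p)).
    by rewrite ler_wpM2r ?exprn_ge0 // ler_norm.
  by rewrite ler_wpM2l //; apply: lerXn2r; rewrite ?nnegrE // mulr_ge0 // ltW.
by rewrite exprMn mulrA exprS ler_wpM2r // exprn_ge0 // ltW.
Unshelve. all: by end_near. Qed.

End Log.

Lemma linear_lt_exp2 K c : (4 * K + 8 <= c)%N -> (K * (c + 2) + 1 <= 2 ^ c)%N.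
Proof.
move=> /subnKC <-; have base : (K * (4 * K + 8 + 2) + 1 <= 2 ^ (4 * K + 8))%N.
  have := ltn_expl K (ltnSn 1); rewrite expnD (_ : 4 * K = K * 2 + K * 2)%N; last by lia.
  rewrite expnD expnM (_ : 2 ^ 8 = 256)%N // => h; nia.
move: (4 * K + 8)%N (c - _)%N base => b; elim=> [|i IH] base; first by rewrite addn0.
by have := IH base; rewrite (addnS b i) expnS; nia.
Qed.

(** h is linear in the bit length of N, hence eventually below N. *)
Lemma field_param_le A n b :
  (4 * (3 * A) + 8 <= b)%N -> (2 ^ b <= bitlen n)%N -> (field_param A n <= bitlen n)%N.
Proof.
rewrite -ltn_bitlen => Ab; set B := bitlen (bitlen n) => bB.
have [le _] := pow3_above_bounds (A * B.+1); apply: leq_trans le _.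
have B0 : (0 < B)%N by apply: leq_ltn_trans bB.
have hB : (2 ^ B.-1 <= bitlen n)%N by rewrite -ltn_bitlen prednK.
apply: leq_trans hB; have le : (4 * (3 * A) + 8 <= B.-1)%N by lia.
by have := linear_lt_exp2 le; rewrite mulnA; have := prednK B0; nia.
Qed.

Lemma sum_succ_sqr_le (R : realType) (x y : R) : 2 <= x ->
  (x + 1) ^+ 2 + (y + 1) ^+ 2 <= 3 * (x ^+ 2 + y ^+ 2).
Proof.
move=> x2; have : 0 <= (2 * y - 1) ^+ 2 by exact: sqr_ge0.
have : 0 <= (x - 2) * (x + 1) by rewrite mulr_ge0 ?subr_ge0 // addr_ge0 //; lra.
by lra.
Qed.

Section Bounds.

Variable R : realType.

(** d = tQ with t of order N + e and Q of order t/N. *)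
Lemma seed_length_nat a e n (N := bitlen n) (d := seed_length (2 * a + 10) 13 e n) :
  (0 < n)%N -> (field_param (2 * a + 10) n <= N)%N ->
  (N ^ 2 + e ^ 2 <= d * N)%N /\ (d * N <= 32 * 92 ^ 2 * (N ^ 2 + e ^ 2))%N.
Proof.
move=> n0 hN; have lo := index_length_ge e n0 hN; have hi := index_length_le a n e.
have N0 : (0 < N)%N by exact: bitlen_gt0.
rewrite -/N in lo hi.
rewrite /d /seed_length /alphabet -/N; set t := index_length _ _ _ _ in lo hi *.
have q1 := leq_divM t N; have q2 := ltn_ceil t N0.
move: (t %/ N)%N q1 q2 => q q1 q2.
have -> : (t * (8 * q.+1) * N = 8 * (t * (q.+1 * N)))%N by ring.
have u1 : (t * t <= t * (q.+1 * N))%N by rewrite leq_mul2l ltnW ?orbT.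
have Nt : (N <= t)%N by lia.
have u2 : (t * (q.+1 * N) <= 2 * (t * t))%N.
  by rewrite mulSn mulnCA leq_mul2l; apply/orP; right; lia.
have sq : ((N + e) * (N + e) <= 2 * (N ^ 2 + e ^ 2))%N.
  by rewrite mulnn sqrnD (mulSn 1 (N ^ 2 + e ^ 2)) mul1n leq_add2l; case: (nat_Cauchy N e).
have u3 : (t * t <= 92 * (N + e) * (92 * (N + e)))%N by exact: leq_mul.
have u4 : ((N + e) * (N + e) <= t * t)%N by apply: leq_mul; lia.
have sq' : (N ^ 2 + e ^ 2 <= (N + e) * (N + e))%N by rewrite mulnn sqrnD leq_addr.
move: sq sq' u1 u2 u3 u4; rewrite mulnACA (mulnn 92).
move: (N ^ 2 + e ^ 2)%N (t * (q.+1 * N))%N (t * t)%N ((N + e) * (N + e))%N => x y z v *.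
split; lia.
Qed.

Lemma seed_length_bounds a e n (l L : R) (d := seed_length (2 * a + 10) 13 e n)
  (c := (32 * 92 ^ 2)%N%:R : R) : (0 < n)%N ->
  (field_param (2 * a + 10) n <= bitlen n)%N -> 2 <= l -> l <= (bitlen n)%:R <= l + 1 ->
  0 <= L -> L <= e%:R <= L + 1 ->
  2^-1 * (l + L ^+ 2 / l) <= d%:R <= 3 * c * (l + L ^+ 2 / l).
Proof.
move=> n0 hN l2 /andP[lN Nl] L0 /andP[Le eL].
have [] := seed_length_nat e n0 hN; rewrite -/d.
rewrite -(ler_nat R) natrD !natrX natrM => lo.
rewrite -(ler_nat R) natrM natrM natrD -/c !natrX => hi.
have c0 : 0 <= c by exact: ler0n.
have l0 : 0 < l by lra.
move: (bitlen n)%:R (e%:R) lN Nl Le eL lo hi => N E lN Nl LE EL lo hi.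
have N0 : 0 < N by lra.
have D0 : 0 <= d%:R :> R by exact: ler0n.
move: d%:R D0 lo hi => D D0 lo hi.
have N2 : N <= 2 * l by lra.
have fl : l + L ^+ 2 / l = (l ^+ 2 + L ^+ 2) / l by field; rewrite gt_eqF.
rewrite fl; apply/andP; split.
  rewrite mulrA ler_pdivrMr //.
  have h1 : l ^+ 2 <= N ^+ 2 by apply: lerXn2r; rewrite ?nnegrE //; lra.
  have h2 : L ^+ 2 <= E ^+ 2 by apply: lerXn2r; rewrite ?nnegrE //; lra.
  have h3 : D * N <= 2 * (D * l) by rewrite mulrCA ler_wpM2l.
  lra.
rewrite mulrA ler_pdivlMr //.
have h1 : N ^+ 2 <= (l + 1) ^+ 2 by apply: lerXn2r; rewrite ?nnegrE //; lra.
have h2 : E ^+ 2 <= (L + 1) ^+ 2 by apply: lerXn2r; rewrite ?nnegrE //; lra.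
have h3 : D * l <= D * N by rewrite ler_wpM2l.
have h4 := sum_succ_sqr_le L l2.
have h5 := ler_wpM2l c0 (le_trans (lerD h1 h2) h4).
lra.
Qed.

(** Truncating [kr] and rounding n^(1/10800) to a power of 2 lose a factor 2 each. The division
    loses 1, at most half of the rest once the product is at least 8. Above, e <= L + 1 <= (1 +
    1/L0) L. *)
Lemma output_length_bounds k e n (kr L L0 delta r : R)
  (rt := (2 ^ ((bitlen n).-1 %/ 10800))%:R : R) (m := output_length k e n) :
  (0 < n)%N -> 2 <= kr -> k = Num.truncn kr -> kr = delta * n%:R ->
  0 < L0 -> L0 <= L -> L <= e%:R <= L + 1 -> rt <= r <= 2 * rt ->
  8 <= delta * r * L ->
  8^-1 * (delta * r * L) <= m%:R <= (1 + L0^-1) * (delta * r * L).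
Proof.
move=> n0 kr2 kE krE L00 L0L /andP[Le eL] /andP[rtr rrt] big.
have n0' : 0 < n%:R :> R by rewrite ltr0n.
have kr0 : 0 <= kr by lra.
have k1 : k%:R <= kr by rewrite kE truncn_le.
have k2 : kr < k%:R + 1 by rewrite kE natr1; exact: truncnS_gt.
have kl : 2^-1 * kr <= k%:R by lra.
have d0 : 0 < delta by rewrite -(pmulr_lgt0 _ n0') -krE; lra.
have L0' : 0 < L by lra.
have rt0 : 0 < rt by rewrite ltr0n expn_gt0.
have mlo : k%:R * e%:R * rt < (m%:R + 1) * n%:R.
  by rewrite -!natrM natr1 -natrM ltr_nat; apply: ltn_ceil.
have mhi : m%:R * n%:R <= k%:R * e%:R * rt.
  by rewrite -!natrM ler_nat; apply: leq_divM.
have e0 : 0 <= e%:R :> R by exact: ler0n.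
have k0 : 0 <= k%:R :> R by exact: ler0n.
apply/andP; split.
  have h : (2^-1 * kr) * L * (2^-1 * r) <= k%:R * e%:R * rt.
    apply: ler_pM; [rewrite mulr_ge0 //; lra|lra| |lra].
    by apply: ler_pM => //; lra.
  have : 4^-1 * (delta * r * L) * n%:R < (m%:R + 1) * n%:R.
    apply: le_lt_trans mlo; apply: le_trans h; rewrite krE.
    by rewrite le_eqVlt; apply/orP; left; apply/eqP; field.
  by rewrite ltr_pM2r // => h'; lra.
rewrite -(ler_pM2r n0'); apply: (le_trans mhi).
have eL' : e%:R <= (1 + L0^-1) * L.
  apply: (le_trans eL); rewrite mulrDl mul1r lerD2l.
  by rewrite mulrC ler_pdivlMr // mul1r.
have h : k%:R * e%:R * rt <= kr * ((1 + L0^-1) * L) * r.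
  apply: ler_pM => //; try (by rewrite mulr_ge0); try exact: ltW.
  by apply: ler_pM.
apply: (le_trans h); rewrite krE le_eqVlt; apply/orP; left; apply/eqP; ring.
Qed.

(** Since L is bounded below by L0 > 0, both 1 and L are O(L^2), so 26(N + e) is absorbed in L^2
    l^2; the factor 2^h accounts for l^(6A). *)
Lemma locality_bound a e n (l L L0 : R) (A := (2 * a + 10)%N) : (0 < n)%N ->
  (field_param A n <= bitlen n)%N -> 10 <= l -> (bitlen n)%:R <= l + 1 ->
  0 < L0 -> L0 <= L -> e%:R <= L + 1 -> 26 * (3 / L0 ^+ 2 + L0^-1) <= l ->
  (walk_length A 13 e n * 2 ^ field_param A n)%:R <= L ^+ 2 * l ^+ (6 * A + 2).
Proof.
move=> n0 hN l10 Nl L00 L0L eL lbig.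
have h0 := field_param_gt0 a n; rewrite -/A in h0.
have wle : (walk_length A 13 e n <= 13 * (bitlen n + e))%N.
  apply: leq_trans (walk_length_le a n e); exact: leq_pmull.
have := leq_mul wle (exp2_field_param A n); rewrite -(ler_nat R) => le; apply: le_trans le _.
rewrite natrM natrM natrD natrM natrX natrD natrM.
move: (bitlen n)%:R (e%:R) Nl eL (ler0n R (bitlen n)) (ler0n R e) => N E Nl EL N0 E0.
have l0 : 0 < l by lra.
have h1 : 4 * N + 2 <= l ^+ 2 by nra.
have h2 : (4 * N + 2) ^+ (3 * A) <= l ^+ (6 * A).
  have -> : (6 * A = 2 * (3 * A))%N by rewrite mulnA.
  by rewrite [leRHS]exprM; apply: lerXn2r; rewrite ?nnegrE ?exprn_ge0 //; lra.
have L0' : 0 < L by lra.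
have L2 : 0 <= L ^+ 2 by exact: sqr_ge0.
have i1 : 1 <= L ^+ 2 / L0 ^+ 2.
  rewrite ler_pdivlMr ?exprn_gt0 // mul1r; apply: lerXn2r; rewrite ?nnegrE //; lra.
have i2 : L <= L ^+ 2 * L0^-1.
  by rewrite ler_pdivlMr // expr2 ler_pM2l.
have h3 : 26 * (N + E) <= L ^+ 2 * l ^+ 2.
  apply: (@le_trans _ _ (L ^+ 2 * l * (26 * (3 / L0 ^+ 2 + L0^-1)))); last first.
    rewrite [l ^+ 2]expr2 mulrA ler_wpM2l // mulr_ge0 //; lra.
  have -> : L ^+ 2 * l * (26 * (3 / L0 ^+ 2 + L0^-1)) =
     26 * (3 * (L ^+ 2 / L0 ^+ 2) * l + L ^+ 2 * L0^-1 * l) by ring.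
  rewrite ler_pM2l //; move: i1 i2; move: (L ^+ 2 / L0 ^+ 2) (L ^+ 2 * L0^-1) => x y i1 i2.
  nra.
have -> : 13 * (N + E) * (2 * (4 * N + 2) ^+ (3 * A)) =
  26 * (N + E) * (4 * N + 2) ^+ (3 * A) by ring.
rewrite (addnC (6 * A)%N) exprD mulrA; apply: ler_pM h3 h2.
  by rewrite mulr_ge0 // addr_ge0.
by rewrite exprn_ge0 // addr_ge0 // mulr_ge0.
Qed.

End Bounds.

Lemma absz_ceil_bounds (R : realType) (x : R) : 0 <= x ->
  x <= `|Num.ceil x|%N%:R <= x + 1.
Proof.
move=> x0; have c0 : 0 <= Num.ceil x by rewrite ceil_ge0 (lt_le_trans _ x0) // ltrN10.
have -> : `|Num.ceil x|%N%:R = (Num.ceil x)%:~R :> R by rewrite natr_absz ger0_norm.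
rewrite ceil_ge /=; have := ceilB1_lt x; rewrite intrD => lt; lra.
Qed.

(** Half of the exponent 1/10800 pays for the loss log^a n in delta, and half remains. *)
Lemma near_10800th_root (R : realType) (a : nat) (L0 : R) : 0 < L0 ->
  \forall n \near \oo,
    8 * n%:R `^ (10800%:R^-1 / 2) * log2 n%:R ^+ a <= n%:R `^ 10800%:R^-1 * L0.
Proof.
move: 10800%N (isT : (0 < 10800)%N) => c c_gt0 L00.
have c0 : 0 < c%:R^-1 / 2 :> R by rewrite divr_gt0 // invr_gt0 ltr0n.
near=> n.
have -> : n%:R `^ c%:R^-1 = n%:R `^ (c%:R^-1 / 2) * n%:R `^ (c%:R^-1 / 2) :> R.
  rewrite -powRD; last by rewrite gt_eqF ?addr_gt0.
  by congr (_ `^ _); field; rewrite pnatr_eq0 -lt0n.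
rewrite [8 * _]mulrC -!mulrA ler_wpM2l ?powR_ge0 // -ler_pdivrMr // mulrAC.
by near: n; exact: near_log2_poly.
Unshelve. all: by end_near. Qed.

Section Main.

Variables (R : realType) (a : nat) (delta eps : nat -> R) (eps0 : R).

Let kr n := delta n * n%:R.
Let L n := log2 (eps n)^-1.
Let l n : R := log2 n%:R.
Let X n : R := n%:R `^ 10^-1.
Let r n : R := n%:R `^ 10800%:R^-1.
Let c1 : R := 10800%:R^-1 / 2.
(** A positive lower bound for log(1/eps); the maximum with 1/2 keeps the argument positive for
    every [eps0]. *)
Let L0 : R := log2 (Num.max eps0 2^-1)^-1.

Hypothesis delta_near : \forall n \near \oo, (l n ^+ a)^-1 <= delta n <= 1.
Hypothesis eps0_lt1 : eps0 < 1.
Hypothesis eps_near : \forall n \near \oo, 2 `^ (- (kr n `^ 10^-1)) <= eps n <= eps0.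

Lemma L0_gt0 : 0 < L0.
Proof.
apply: log2_gt0; rewrite invf_gt1 ?gt_max ?lt_max ?eps0_lt1 ?invf_lt1 ?ltr1n //.
by rewrite invr_gt0 ltr0n orbT.
Qed.

Lemma near_log_error :
  \forall n \near \oo, [/\ 0 < eps n, L0 <= L n & L n <= kr n `^ 10^-1].
Proof.
near=> n; have /andP[lo hi] : 2 `^ (- (kr n `^ 10^-1)) <= eps n <= eps0 by near: n.
have e0 : 0 < eps n by apply: lt_le_trans lo; exact: powR_gt0.
split=> //.
  apply: ler_log2; first by rewrite invr_gt0 lt_max invr_gt0 ltr0n orbT.
  rewrite lef_pV2 ?posrE ?lt_max ?(lt_le_trans e0 hi) //.
  by rewrite le_max hi.
rewrite /L log2V // lerNl; apply: le_trans (ler_log2 _ lo); last exact: powR_gt0.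
by rewrite log2_powR.
Unshelve. all: by end_near. Qed.

(** k is at least n / log^a n, and log^a n <= X = n^(1/10) eventually. *)
Lemma near_source : \forall n \near \oo,
  [/\ 0 <= kr n, kr n <= n%:R, X n ^+ 9 <= kr n & n%:R <= kr n * (bitlen n)%:R ^+ a].
Proof.
near=> n; have n0 : (0 < n)%N by near: n; exact: nbhs_infty_gt.
have /andP[lo hi] : (l n ^+ a)^-1 <= delta n <= 1 by near: n.
have l0 : 0 < l n by apply: lt_le_trans ltr01 _; near: n; exact: near_log2_ge.
have la0 : 0 < l n ^+ a by exact: exprn_gt0.
have /andP[lN _] := bitlen_log2 R n0.
have n0' : 0 < n%:R :> R by rewrite ltr0n.
have d0 : 0 <= delta n by apply: le_trans lo; rewrite invr_ge0 ltW.
have nk : n%:R <= kr n * l n ^+ a.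
  rewrite /kr mulrAC ler_peMl ?ler0n // -ler_pdivrMr // mul1r; exact: lo.
split.
- by rewrite mulr_ge0.
- by rewrite ler_piMl.
- have lX : l n ^+ a <= X n.
    by rewrite -[leLHS]mul1r; near: n; apply: near_log2_poly; rewrite invr_gt0.
  have X0 : 0 < X n by exact: powR_gt0.
  rewrite -(ler_pM2r X0) -exprSr exprn_root //.
  apply: le_trans nk _; rewrite ler_wpM2l // mulr_ge0 //.
- apply: (le_trans nk); rewrite ler_wpM2l ?mulr_ge0 //.
  by apply: lerXn2r; rewrite ?nnegrE // ltW.
Unshelve. all: by end_near. Qed.

Lemma near_sizes K : \forall n \near \oo,
  [/\ (0 < n)%N, (field_param (2 * a + 10) n <= bitlen n)%N, K <= l n,
    100 <= X n & (bitlen n)%:R <= X n].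
Proof.
near=> n; have n0 : (0 < n)%N by near: n; exact: nbhs_infty_gt.
have /andP[lN Nl] := bitlen_log2 R n0.
split=> //.
- apply: (field_param_le (leqnn _)).
  by rewrite -(ler_nat R); apply: le_trans lN; near: n; exact: near_log2_ge.
- by near: n; exact: near_log2_ge.
- by near: n; apply: near_powR_ge; rewrite invr_gt0.
apply: le_trans Nl _; apply: (@le_trans _ _ (2 * l n ^+ 1)).
  have l1 : 1 <= l n by near: n; exact: near_log2_ge.
  by rewrite expr1 mulr_natl mulr2n lerD2l.
by near: n; apply: near_log2_poly; rewrite invr_gt0.
Unshelve. all: by end_near. Qed.

Lemma near_output_main : \forall n \near \oo,
  1 <= n%:R `^ c1 /\ 8 * n%:R `^ c1 <= delta n * r n * L n.
Proof.
have c10 : 0 < c1 by rewrite divr_gt0 // invr_gt0 ltr0n.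
have L00 := L0_gt0.
near=> n.
have [_ LL _] : [/\ 0 < eps n, L0 <= L n & L n <= kr n `^ 10^-1].
  by near: n; exact: near_log_error.
split; first by near: n; exact: near_powR_ge.
have l0 : 0 < l n by apply: lt_le_trans ltr01 _; near: n; exact: near_log2_ge.
have la0 : 0 < l n ^+ a by exact: exprn_gt0.
have /andP[lo _] : (l n ^+ a)^-1 <= delta n <= 1 by near: n.
have lai : 0 <= (l n ^+ a)^-1 by rewrite invr_ge0 ltW.
have r0 : 0 <= r n by exact: powR_ge0.
apply: (@le_trans _ _ ((l n ^+ a)^-1 * r n * L0)); last first.
  apply: ler_pM => //; [by rewrite mulr_ge0 | exact: ltW | exact: ler_wpM2r].
rewrite -mulrA [leRHS]mulrC ler_pdivlMr //; near: n.
exact: near_10800th_root.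
Unshelve. all: by end_near. Qed.

Let k n := Num.truncn (kr n).
Let e n := `|Num.ceil (L n)|%N.
Let m n := output_length (k n) (e n) n.

Lemma near_output_length : \forall n \near \oo,
  [/\ 8^-1 * (delta n * r n * L n) <= (m n)%:R,
    (m n)%:R <= (1 + L0^-1) * (delta n * r n * L n),
    n%:R `^ c1 <= (m n)%:R & (m n)%:R <= 2 * X n ^+ 2].
Proof.
move: near_output_main; apply: filter_app.
move: near_log_error near_source (near_sizes 0); apply: filterS3 =>
  n [e0 L0L LX] [kr0 krn X9 nkr] [n0 _ _ X100 NX] [n1 main].
have L00 := L0_gt0.
have Lge0 : 0 <= L n by apply: le_trans L0L; exact: ltW.
have eb := absz_ceil_bounds Lge0; have /andP[Le eL] := eb.
have X1 : 1 <= X n by apply: le_trans X100; rewrite ler1n.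
have kr2 : 2 <= kr n.
  apply: le_trans X9; apply: (@le_trans _ _ (X n ^+ 1)).
    by rewrite expr1; apply: le_trans X100; rewrite ler_nat.
  exact: ler_weXn2l.
have /andP[rt1 rt2] := @exp2_root R n 10800 n0 isT.
have rr : (2 ^ ((bitlen n).-1 %/ 10800))%:R <= r n <= 2 * (2 ^ ((bitlen n).-1 %/ 10800))%:R.
  by apply/andP; split.
have big : 8 <= delta n * r n * L n by apply: le_trans main; rewrite ler_peMr.
have /andP[m1 m2] := output_length_bounds n0 kr2 erefl erefl L00 L0L eb rr big.
split=> //.
  by apply: le_trans m1; rewrite ler_pdivlMl.
have rX : r n <= X n.
  apply: ler_powR; first by rewrite ler1n.
  by rewrite lef_pV2 ?posrE ?ltr0n // ler_nat.
apply: (output_length_le n0 X100).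
- by rewrite -(ler_nat R); apply: le_trans krn; rewrite truncn_le.
- apply: (le_trans eL); rewrite lerD2r; apply: (le_trans LX).
  by apply: ge0_ler_powR; rewrite ?nnegrE ?invr_ge0.
- exact: le_trans rt1 rX.
Qed.

Lemma near_strong_extractor : \forall n \near \oo,
  strong_extractor (kr n) (eps n) (@extractor_tuple (2 * a + 10) 13 (k n) (e n) n).
Proof.
move: near_output_length; apply: filter_app.
move: near_log_error near_source (near_sizes 0); apply: filterS3 =>
  n [e0 L0L LX] [kr0 krn X9 nkr] [n0 hN _ X100 NX] [_ _ mlo mhi].
have Lge0 : 0 <= L n by apply: le_trans L0L; apply: ltW; exact: L0_gt0.
have /andP[Le eL] := absz_ceil_bounds Lge0.
have nX : n%:R = X n ^+ 10 by rewrite exprn_root.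
have /andP[rt1 _] := @exp2_root R n 10800 n0 isT.
have rX : r n <= X n.
  apply: ler_powR; first by rewrite ler1n.
  by rewrite lef_pV2 ?posrE ?ltr0n // ler_nat.
have eps_ge : (2 ^+ e n)^-1 <= eps n.
  rewrite -[leRHS]invrK lef_pV2 ?posrE ?exprn_gt0 ?invr_gt0 //.
  rewrite -[leLHS]powR2_log2 ?invr_gt0 // -powR_mulrn // ler_powR ?ler1n //.
have m0 : (0 < m n)%N by rewrite -(ltr_nat R); apply: lt_le_trans mlo; rewrite powR_gt0 ?ltr0n.
have mN : (m n <= 2 ^ bitlen n)%N.
  apply: leq_trans (ltnW (bitlen_gt n)); rewrite -(ler_nat R) nX.
  apply: (le_trans mhi); rewrite (exprD _ 8 2) ler_wpM2r ?sqr_ge0 //.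
  have X1 : 1 <= X n by apply: le_trans X100; rewrite ler1n.
  apply: (@le_trans _ _ (X n ^+ 1)); last exact: ler_weXn2l.
  by rewrite expr1; apply: le_trans X100; rewrite ler_nat.
apply: (strong_at n0 hN e0 eps_ge m0 mN X100 nX X9 nkr) => //.
- by rewrite -(ler_nat R); apply: le_trans krn; rewrite truncn_le.
- apply: (le_trans eL); rewrite lerD2r; apply: (le_trans LX).
  by apply: ge0_ler_powR; rewrite ?nnegrE ?invr_ge0.
- exact: le_trans rt1 rX.
Qed.

Lemma seed_length_bigTheta :
  (fun n => (seed_length (2 * a + 10) 13 (e n) n)%:R : R) =Theta_\oo
  (fun n => l n + L n ^+ 2 / l n).
Proof.
apply: (@near_bigTheta _ _ _ 2^-1 (3 * (32 * 92 ^ 2)%N%:R)); rewrite ?mulr_gt0 ?ltr0n //.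
move: near_log_error (near_sizes 2); apply: filterS2 =>
  n [e0 L0L LX] [n0 hN l2 X100 NX].
have Lge0 : 0 <= L n by apply: le_trans L0L; apply: ltW; exact: L0_gt0.
have /andP[lo hi] := seed_length_bounds n0 hN l2 (bitlen_log2 R n0) Lge0
  (absz_ceil_bounds Lge0).
have l0 : 0 <= l n by apply: le_trans l2.
by split=> //; rewrite addr_ge0 // divr_ge0 // sqr_ge0.
Qed.

Lemma output_length_bigTheta :
  (fun n => (m n)%:R : R) =Theta_\oo (fun n => delta n * r n * L n).
Proof.
apply: (@near_bigTheta _ _ _ 8^-1 (1 + L0^-1)).
- by rewrite invr_gt0.
- by rewrite addr_gt0 // invr_gt0 L0_gt0.
move: near_output_main near_output_length; apply: filterS2 =>
  n [n1 main] [m1 m2 _ _].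
by split=> //; apply: le_trans main; rewrite mulr_ge0 // powR_ge0.
Qed.

Lemma output_length_poly : exists c c' : R, 0 < c /\ 0 < c' /\
  \forall n \near \oo, kr n `^ c <= (m n)%:R <= kr n `^ c'.
Proof.
have c10 : 0 < c1 by rewrite divr_gt0 // invr_gt0 ltr0n.
(* m >= n^c1 >= k^c1, and m <= 2X^2 <= X^9 <= k. *)
exists c1, 1; split=> //; split=> //.
move: near_source (near_sizes 0) near_output_length; apply: filterS3 =>
  n [kr0 krn X9 nkr] [_ _ _ X100 _] [_ _ mlo mhi].
rewrite powRr1 //; apply/andP; split.
  by apply: le_trans mlo; apply: ge0_ler_powR; rewrite ?nnegrE // ltW.
apply: (le_trans mhi); apply: le_trans X9.
have X1 : 1 <= X n by apply: le_trans X100; rewrite ler1n.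
rewrite (exprD _ 7 2) ler_wpM2r ?sqr_ge0 //.
apply: (@le_trans _ _ (X n ^+ 1)); last exact: ler_weXn2l.
by rewrite expr1; apply: le_trans X100; rewrite ler_nat.
Qed.

Lemma locality_poly : exists b : nat, \forall n \near \oo,
  (walk_length (2 * a + 10) 13 (e n) n * 2 ^ field_param (2 * a + 10) n)%:R <=
  L n ^+ 2 * l n ^+ b.
Proof.
exists (6 * (2 * a + 10) + 2)%N.
move: near_log_error (near_sizes (Num.max 10 (26 * (3 / L0 ^+ 2 + L0^-1)))).
apply: filterS2 => n [e0 L0L LX] [n0 hN big _ _].
move: big; rewrite ge_max => /andP[l10 lbig].
have L00 := L0_gt0; have Lge0 : 0 <= L n by apply: le_trans L0L; exact: ltW.
have /andP[_ eL] := absz_ceil_bounds Lge0; have /andP[_ Nl] := bitlen_log2 R n0.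
exact: (locality_bound n0 hN l10 Nl L00 L0L eL lbig).
Qed.

End Main.

Theorem mainTheorem11 (R : realType) (delta : nat -> R) (a : nat)
  (hdelta : \forall n \near \oo, (log2 n%:R ^+ a)^-1 <= delta n <= 1) :
  let k := fun n : nat => delta n * n%:R in
  exists2 alpha : R, 0 < alpha < 1 &
  forall (eps : nat -> R) (eps0 : R),
  eps0 < 1 ->
  (\forall n \near \oo, 2 `^ (- (k n `^ alpha)) <= eps n <= eps0) ->
  let L := fun n : nat => log2 (eps n)^-1 in
  exists (d m l : nat -> nat)
    (Ext : forall n, n.-tuple bool -> (d n).-tuple bool -> (m n).-tuple bool),
  explicit (fun n => Num.truncn (k n)) (fun n => `|Num.ceil (L n)|%N) Ext /\
  (\forall n \near \oo, strong_extractor (k n) (eps n) (Ext n)) /\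
  (fun n => (d n)%:R : R) =Theta_\oo
    (fun n => log2 n%:R + L n ^+ 2 / log2 n%:R) /\
  (fun n => (m n)%:R : R) =Theta_\oo
    (fun n => delta n * n%:R `^ 10800%:R^-1 * L n) /\
  (exists c1 c2 : R, 0 < c1 /\ 0 < c2 /\
    \forall n \near \oo, k n `^ c1 <= (m n)%:R <= k n `^ c2) /\
  (\forall n \near \oo, has_locality (Ext n) (l n)) /\
  (exists b : nat,
    \forall n \near \oo, (l n)%:R <= L n ^+ 2 * log2 n%:R ^+ b).
Proof.
(* With alpha = 1/10, log(1/eps) <= k^(1/10) <= X. *)
move=> k; exists 10^-1; first by rewrite invr_gt0 ltr0n invf_lt1 ?ltr1n.
move=> eps eps0 eps01 eps_near L.
(* The value 2a + 10 is what [walk_factor_le] needs, and 13 what [walk_length_ge] needs. *)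
pose A := (2 * a + 10)%N; pose e n := `|Num.ceil (L n)|%N; pose kn n := Num.truncn (k n).
exists (fun n => seed_length A 13 (e n) n), (fun n => output_length (kn n) (e n) n),
  (fun n => (walk_length A 13 (e n) n * 2 ^ field_param A n)%N),
  (fun n x u => @extractor_tuple A 13 (kn n) (e n) n x u).
split; first exact: explicit_extractor.
split; first exact: (near_strong_extractor hdelta eps01 eps_near).
split; first exact: (seed_length_bigTheta a eps01 eps_near).
split; first exact: (output_length_bigTheta hdelta eps01 eps_near).
split; first exact: (output_length_poly hdelta eps01 eps_near).
split; last exact: (locality_poly a eps01 eps_near).
by apply: nearW => n; exact: extractor_locality.
Qed.
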